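(* Let $\nu$ be an inhomogeneous Mandelbrot measure on $\Sigma$ associated with a sequence $((C^{(n)},W^{(n)}))_{n\ge1}$, and $\mu_\omega=\pi_*\nu_\omega$. If $$\liminf_{N\to+\infty}\frac1N\sum_{n=1}^NH(W^{(n)})>0\quad\text{and}\quad\sum_{n\ge1}\frac{\phi''_{W^{(n)}}(1^-)}{n^2}<+\infty,$$ then $\mathbb E(\|\nu\|)=1$. Moreover, if (in addition) for all $v\in\mathcal I^*$ and $i\in\mathcal I$ one has $\mathbb P(W_i(v)>0)=\mathbb P(c_i(v)=1)$, then, conditional on $K_\omega\ne\emptyset$, almost surely $\operatorname{supp}(\mu_\omega)=K_\omega$.
   Context: **Good sponges.** Let $d\ge2$, let $\mathcal I$ be a finite set and $\{f_i\}_{i\in\mathcal I}$ a family of pairwise distinct affine maps of $\mathbb R^d$, $f_i(x)=A_ix+t_i$, $A_i=\mathrm{diag}(a_{i,1},\dots,a_{i,d})$, $0<|a_{i,k}|<1$, $f_i([0,1]^d)\subset[0,1]^d$, with no fixed point common to all the $f_i$. $K$ is its attractor. $P_{\mathcal I}$ is the set of probability vectors $(p_i)_{i\in\mathcal I}$ and $\chi_k(p)=-\sum_ip_i\log|a_{i,k}|$. For nonempty $D\subset\{1,\dots,d\}$, $\pi^D$ is the orthogonal projection of $\mathbb R^d$ onto the span of the coordinate axes indexed by $D$. $K$ is assumed to be a good sponge: for all $p\in P_{\mathcal I}$, $x\ge0$, with $D=\{k:\chi_k(p)\le x\}$ (if nonempty), for all $i,j\in\mathcal I$ either $\pi^D\circ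 f_i=\pi^D\circ f_j$ on $[0,1]^d$ or $\pi^D f_i((0,1)^d)\cap\pi^Df_j((0,1)^d)=\emptyset$. **Symbolic notation.** $\mathcal I^*=\bigcup_{n\ge0}\mathcal I^n$, $\Sigma=\mathcal I^{\mathbb N^+}$, $\boldsymbol i_{|n}=\boldsymbol i_1\cdots\boldsymbol i_n$, $[w]$ is the cylinder generated by $w$, $\pi:\Sigma\to K$, $\pi(\boldsymbol i)=\lim_kf_{i_1}\circ\cdots\circ f_{i_k}(0)$. **Random set and inhomogeneous Mandelbrot measures (IMM).** $C=(c_i)_{i\in\mathcal I}$ is a random vector in $\{0,1\}^{\mathcal I}$ with $\mathbb E(\sum_ic_i)>1$ and $\mathbb P(c_i=1)>0$ for all $i$. $((C^{(n)},W^{(n)}))_{n\ge1}$ is a sequence of random vectors such that $C^{(n)}$ has the law of $C$, $W^{(n)}\in\mathbb R_+^{\mathcal I}$, $\mathbb E(\sum_iW^{(n)}_i)=1$ and $\{W^{(n)}_i>0\}\subset\{c^{(n)}_i=1\}$ a.s. $((C(v),W(v)))_{v\in\mathcal I^*}$ are independent, with $(C(v),W(v))$ distributed as $(C^{(n)},W^{(n)})$ for $v\in\mathcal I^{n-1}$. $\Sigma_\omega=\{\boldsymbol i:\ c_{\boldsymbol i_m}(\boldsymbol i_{|m-1})(\omega)=1\ \forall m\ge1\}$, $K_\omega=\pi(\Sigma_\omega)$. For $w=i_1\cdots i_n$, $Q^v(w)=W_{i_1}(v)W_{i_2}(vi_1)\cdots W_{i_n}(vi_1\cdots i_{n-1})$,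 $Q=Q^{\boldsymbol\epsilon}$ ($\boldsymbol\epsilon$ the empty word), $Y_n(v)=\sum_{w\in\mathcal I^n}Q^v(w)$, $Y(v)=\lim_nY_n(v)$ a.s., and $\nu_\omega$ is the measure on $\Sigma$ with $\nu_\omega([v])=Q(v)Y(v)$; $\|\nu\|=Y(\boldsymbol\epsilon)$ is its total mass. **Functions.** For a nonnegative random vector $W$, $\phi_W(q)=\mathbb E(\sum_iW_i^q)$ and $H(W)=-\phi_W'(1^-)=-\sum_i\mathbb E(W_i\log W_i)$ (with $0\log0=0$); $\phi_W''(1^-)=\mathbb E(\sum_iW_i(\log W_i)^2)$. *)

(* Defs.v *)
From HB Require Import structures.
From mathcomp Require Import all_boot all_order all_algebra.
From mathcomp Require Import all_classical all_reals all_analysis.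

Set Implicit Arguments.
Unset Strict Implicit.
Unset Printing Implicit Defensive.

Import Order.TTheory GRing.Theory Num.Theory.
Import numFieldNormedType.Exports.

Local Open Scope classical_set_scope.
Local Open Scope ring_scope.

(* Finite alphabets.  The distinguished letter is used only because the
   carrier of a measurableType has to be pointed (alphabets are nonempty). *)
#[short(type="pointedFinType")]
HB.structure Definition PointedFinite := {T of Finite T & Pointed T}.

Section good_sponge.
Context {R : realType} {d : nat} {I : finType}.
Implicit Types (a : I -> 'rV[R]_d) (t : I -> 'cV[R]_d) (D : {set 'I_d}).
Implicit Types (p : I -> R) (i j : I) (k : 'I_d).

Definition ifs_map a t i (x : 'cV[R]_d) : 'cV[R]_d := diag_mx (a i) *m x + t i.

Definition closed_cube : set 'cV[R]_d := [set x | forall k, 0 <= x k 0 <= 1].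
Definition open_cube : set 'cV[R]_d := [set x | forall k, 0 < x k 0 < 1].

Definition sponge_ifs a t :=
  [/\ injective (ifs_map a t),
      forall i k, 0 < `|a i 0 k| < 1,
      forall i, ifs_map a t i @` closed_cube `<=` closed_cube
    & ~ exists x, forall i, ifs_map a t i x = x].

Definition prob_vector p := (forall i, 0 <= p i) /\ \sum_i p i = 1.

Definition lyapunov a p k : R := - \sum_i p i * ln `|a i 0 k|.

Definition axis_proj D (x : 'cV[R]_d) : 'cV[R]_d :=
  \col_k (if k \in D then x k 0 else 0).

Definition good_sponge a t :=
  forall p (x : R), prob_vector p -> 0 <= x ->
  let D := [set k | lyapunov a p k <= x]%SET in
  D != finset.set0 ->
  forall i j,
    (forall y, closed_cube y ->
       axis_proj D (ifs_map a t i y) = axis_proj D (ifs_map a t j y)) \/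
    ((axis_proj D \o ifs_map a t i) @` open_cube) `&`
    ((axis_proj D \o ifs_map a t j) @` open_cube) = set0.

End good_sponge.

Section codes.
Context {I : pointedFinType}.

(* Sequences are indexed from 0: the paper's m-th letter is [s m.-1], and
   [mkseq s n] is the prefix of length n. *)
Definition cylinder (w : seq I) : set (nat -> I) :=
  [set s | mkseq s (size w) = w].

Definition coding {R : realType} {d : nat}
    (a : I -> 'rV[R]_d) (t : I -> 'cV[R]_d) (s : nat -> I) : 'cV[R]_d :=
  limn (fun n => foldr (ifs_map a t) 0 (mkseq s n)).

End codes.

Notation codes I := (g_sigma_algebraType (range (@cylinder I))).

Section random_vectors.

Definition coord_cylinders (I : Type) d (T : measurableType d) :
    set (set (I -> T)) :=
  [set A | exists i, exists2 B, measurable B & A = [set x | B (x i)]].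

Context d (Omega : measurableType d) (R : realType) (P : probability Omega R).

Definition same_law d' (T : measurableType d') (X Y : Omega -> T) :=
  forall A : set T, measurable A -> pushforward P X A = pushforward P Y A.

Definition mutually_independent (V : eqType) d' (T : measurableType d')
    (X : V -> Omega -> T) :=
  forall (s : seq V) (B : V -> set T), uniq s ->
    (forall v, v \in s -> measurable (B v)) ->
    P (\bigcap_(v in [set` s]) (X v @^-1` B v)) =
    (\prod_(v <- s) P (X v @^-1` B v))%E.

End random_vectors.

(* [I -> T] with the product sigma-algebra. *)
Notation random_vec_space I T :=
  (g_sigma_algebraType (@coord_cylinders I _ T)).

(* A point of [weighted I R] is a pair (c, W) of vectors indexed by I. *)
Notation weighted I R := (random_vec_space I (bool * R)%type).

Definition cpt (I : Type) (R : realType) (x : weighted I R) (i : I) : bool :=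
  (x i).1.
Definition wgt (I : Type) (R : realType) (x : weighted I R) (i : I) : R :=
  (x i).2.

Section cascade.
Context {R : realType} {I : pointedFinType}.
Implicit Types (x : seq I -> weighted I R) (v w : seq I).

Fixpoint Qprod x v w : R :=
  if w is i :: w' then wgt (x v) i * Qprod x (rcons v i) w' else 1.

Definition Ysum x (n : nat) v : R := \sum_(w : n.-tuple I) Qprod x v w.

Definition Ylim x v : R := limn (fun n => Ysum x n v).

Definition surviving x : set (nat -> I) :=
  [set s | forall m, cpt (x (mkseq s m)) (s m)].

Definition random_limit_set d (a : I -> 'rV[R]_d) (t : I -> 'cV[R]_d) x :
    set 'cV[R]_d :=
  coding a t @` surviving x.

End cascade.

Section laws.
Context d (Omega : measurableType d) (R : realType) (P : probability Omega R).
Context (I : pointedFinType).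
Local Open Scope ereal_scope.

Definition supercritical (C : {RV P >-> random_vec_space I bool}) :=
  1 < 'E_P[fun om => (\sum_i (C om i)%:R)%R] /\
  forall i, 0 < P [set om | C om i].

Definition admissible_weights (C : {RV P >-> random_vec_space I bool})
    (X : {RV P >-> weighted I R}) :=
  [/\ same_law P (fun om => cpt (X om) : random_vec_space I bool) C,
      forall om i, (0 <= wgt (X om) i)%R,
      'E_P[fun om => (\sum_i wgt (X om) i)%R] = 1
    & {ae P, forall om, forall i, (0 < wgt (X om) i)%R -> cpt (X om) i}].

Definition cascade_of (X : nat -> {RV P >-> weighted I R})
    (V : seq I -> {RV P >-> weighted I R}) :=
  [/\ mutually_independent P (fun v => V v : Omega -> weighted I R),
      forall v, same_law P (V v) (X (size v).+1)
    & forall v om i, (0 <= wgt (V v om) i)%R].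

Definition mandelbrot_measure (V : seq I -> {RV P >-> weighted I R})
    (nu : Omega -> {measure set (codes I) -> \bar R}) :=
  {ae P, forall om, forall w : seq I,
    nu om (cylinder w) =
    (Qprod (fun v => V v om) [::] w * Ylim (fun v => V v om) w)%:E}.

(* With phi_W(q) = E(sum_i W_i^q), [Hent] is H(W) = - phi_W'(1^-) and [phi2]
   is phi_W''(1^-), written as expectations; either may be infinite.  The
   convention 0 log 0 = 0 holds because [ln 0 = 0]. *)
Definition Hent (X : Omega -> weighted I R) : \bar R :=
  - \sum_i 'E_P[fun om => (wgt (X om) i * ln (wgt (X om) i))%R].

Definition phi2 (X : Omega -> weighted I R) : \bar R :=
  'E_P[fun om => (\sum_i wgt (X om) i * ln (wgt (X om) i) ^+ 2)%R].

End laws.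

Notation borel T := (g_sigma_algebraType (@open T)).

Definition measure_support (T : ptopologicalType) (R : realType)
    (mu : set (borel T) -> \bar R) : set T :=
  [set x | forall U : set T, open U -> U x -> (0 < mu U)%E].

Definition projected_measure {R : realType} {d : nat} {I : pointedFinType}
    (a : I -> 'rV[R]_d) (t : I -> 'cV[R]_d)
    (nu : {measure set (codes I) -> \bar R}) : set (borel ('cV[R]_d)) -> \bar R :=
  pushforward nu (coding a t : codes I -> borel ('cV[R]_d)).

(* Main.v *)
Require Import Defs.
From HB Require Import structures.
From mathcomp Require Import all_boot all_order all_algebra.
From mathcomp Require Import all_classical all_reals all_analysis.
From mathcomp Require Import measurable_realfun ring lra.

(** Write [S_k] for the logarithm of [Q] along a word of length [k].  Under the
    size-biased law [Q(w) dP] the steps of [S_k] are independent with means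
    [- H] and second moments [phi''], so a Hajek-Renyi inequality, obtained
    from a supermartingale along words, bounds the [Q]-mass of the words that
    ever leave the tube [|S_k + sum H| < b_k] by [sum phi'' / b_k^2].  On the
    other words [Q] decays exponentially, and after truncating the weights the
    increments of the total mass martingale [Y_n] have exponentially small
    variance.  Hence [Y_n] is Cauchy in L^1, Doob's maximal inequality gives
    almost sure convergence, and [E Y = 1].

    For the support, the same estimate at a vertex of generation [l], where
    [H <= log m] with [m] the mean offspring number, gives
    [P(Y(v) > 0) >= const * theta^-l] for some [theta < m].  The probabilities
    [p_l] of [Y(v) = 0] satisfy [p_l <= f(p_(l+1))] with [f] the offspring
    generating function; were [p_0] larger than the extinction probability,
    [1 - p_l] would decay like [m^-l].  So [Y(v) = 0] almost surely only on
    the extinction of the subtree of [v]. *)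

Set Implicit Arguments.
Unset Strict Implicit.
Unset Printing Implicit Defensive.

Import Order.TTheory GRing.Theory Num.Theory.
Import numFieldNormedType.Exports.

Local Open Scope classical_set_scope.
Local Open Scope ring_scope.

(** * Expectations and independent families *)

(** Only the moments [W ln W ^+ 2] are assumed, so powers of [Y_n] above the first need not be
    integrable and a direct L^p bound is out of reach; the two truncations replace the missing
    moment. Both are tied to one linear tube [b k = A + c (l + k)], where [3 c] is a lower slope for
    the summed entropies: the tube uses up one [c], the cut of the weights at [expR (b k.+1)]
    another, and a decay rate [c] is left for the variance. The free constant [A] serves two ends.
    Chosen large once the precision is fixed, it makes [sum phi'' / b ^ 2] small and yields the
    Cauchy property. Set to 0 at a vertex of large generation [l], it keeps the variance constant of
    order [expR (l (ln m - c))], which is where [theta = m e^-c < m] comes from. For the support,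
    the obstacle is that the law of the weights changes with the generation: in a homogeneous
    cascade [P(Y(v) = 0)] is a fixed point of [f], whereas here there is only a chain of
    inequalities, and the quantitative lower bound is needed to exclude that [p_l] creeps up to
    1. *)

Section real_expectation.
Context d (Omega : measurableType d) (R : realType) (P : probability Omega R).
Implicit Types f g : Omega -> R.

Definition L1 f := P.-integrable setT (EFin \o f).
(** Real-valued, hence 0 by default when the integral is infinite; the rules that compute with it
    ask for [L1]. *)
Definition Ex f : R := \int[P]_x f x.

Lemma ExE f : L1 f -> (\int[P]_x (f x)%:E)%E = (Ex f)%:E.
Proof. by move=> If; rewrite fineK// integrable_fin_num. Qed.

Lemma L1_measurable f : L1 f -> measurable_fun setT f.
Proof. by move=> /measurable_int /measurable_EFinP. Qed.

Lemma eq_Ex f g : f =1 g -> Ex f = Ex g.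
Proof. by move=> fg; apply: eq_Rintegral => x _; exact: fg. Qed.

Lemma eq_L1 f g : f =1 g -> L1 f -> L1 g.
Proof. by move=> /funext ->. Qed.

Lemma L1_cst c : L1 (fun=> c).
Proof. exact: finite_measure_integrable_cst. Qed.

Lemma Ex_cst c : Ex (fun=> c) = c.
Proof. by rewrite /Ex Rintegral_cst// [X in fine X]probability_setT/= mulr1. Qed.

Lemma L1_le f g : measurable_fun setT f -> L1 g ->
  (forall x, `|f x| <= g x) -> L1 f.
Proof.
move=> mf Ig fg; apply: (le_integrable _ _ _ Ig) => //.
  exact/measurable_EFinP.
by move=> x _ /=; rewrite lee_fin (le_trans (fg x))// ler_norm.
Qed.

Lemma L1_bounded f (M : R) : measurable_fun setT f ->
  (forall x, `|f x| <= M) -> L1 f.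
Proof. by move=> mf fM; apply: (L1_le mf (L1_cst M)). Qed.

Lemma L1D f g : L1 f -> L1 g -> L1 (fun x => f x + g x).
Proof. by move=> If Ig; have := integrableD measurableT If Ig. Qed.

Lemma ExD f g : L1 f -> L1 g -> Ex (fun x => f x + g x) = Ex f + Ex g.
Proof. by move=> If Ig; rewrite /Ex RintegralD. Qed.

Lemma L1B f g : L1 f -> L1 g -> L1 (fun x => f x - g x).
Proof. by move=> If Ig; have := integrableB measurableT If Ig. Qed.

Lemma ExB f g : L1 f -> L1 g -> Ex (fun x => f x - g x) = Ex f - Ex g.
Proof. by move=> If Ig; rewrite /Ex RintegralB. Qed.

Lemma L1Z c f : L1 f -> L1 (fun x => c * f x).
Proof. by move=> If; have := integrableZl measurableT c If. Qed.

Lemma ExZ c f : L1 f -> Ex (fun x => c * f x) = c * Ex f.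
Proof. by move=> If; rewrite /Ex RintegralZl. Qed.

Lemma L1_norm f : L1 f -> L1 (fun x => `|f x|).
Proof. by move=> If; have := integrable_abse If. Qed.

Lemma Ex_norm f : L1 f -> `|Ex f| <= Ex (fun x => `|f x|).
Proof. by move=> If; exact: le_normr_Rintegral. Qed.

Lemma Ex_le f g : L1 f -> L1 g -> (forall x, f x <= g x) -> Ex f <= Ex g.
Proof. by move=> If Ig fg; apply: le_Rintegral. Qed.

Lemma Ex_ge0 f : (forall x, 0 <= f x) -> 0 <= Ex f.
Proof. by move=> f0; exact: Rintegral_ge0. Qed.

Lemma L1_sum (J : Type) (s : seq J) (p : pred J) (F : J -> Omega -> R) :
  (forall j, p j -> L1 (F j)) -> L1 (fun x => \sum_(j <- s | p j) F j x).
Proof.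
move=> IF; elim: s => [|j s ih].
  by apply: eq_L1 (L1_cst 0) => x; rewrite big_nil.
case: (boolP (p j)) => pj; last by apply: eq_L1 ih => x; rewrite big_cons (negbTE pj).
by apply: eq_L1 (L1D (IF j pj) ih) => x; rewrite big_cons pj.
Qed.

Lemma Ex_sum (J : Type) (s : seq J) (p : pred J) (F : J -> Omega -> R) :
  (forall j, p j -> L1 (F j)) ->
  Ex (fun x => \sum_(j <- s | p j) F j x) = \sum_(j <- s | p j) Ex (F j).
Proof.
move=> IF; elim: s => [|j s ih].
  by rewrite big_nil; under eq_Ex do rewrite big_nil; rewrite Ex_cst.
rewrite big_cons; case: ifPn => pj; last first.
  by under eq_Ex do rewrite big_cons (negbTE pj).
under eq_Ex do rewrite big_cons pj.
rewrite ExD ?ih//; [exact: IF|exact: L1_sum].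
Qed.

Lemma L1_indic (A : set Omega) : measurable A -> L1 (\1_A : Omega -> R).
Proof.
by move=> mA; apply: (L1_bounded (M := 1)) => // x; rewrite indicE ger0_norm// lern1 leq_b1.
Qed.

Lemma Ex_indic (A : set Omega) : measurable A -> Ex \1_A = fine (P A).
Proof. by move=> mA; rewrite /Ex /Rintegral integral_indic// setIT. Qed.

Lemma L1_mul_indic (A : set Omega) f : measurable A -> L1 f ->
  L1 (fun x => f x * \1_A x).
Proof.
move=> mA If; apply: (L1_le _ (L1_norm If)) => [|x].
  by apply: measurable_funM => //; exact: L1_measurable.
by rewrite normrM ler_piMr// indicE ger0_norm// lern1 leq_b1.
Qed.

End real_expectation.

Section independent_families.
Context d (Omega : measurableType d) (R : realType) (P : probability Omega R).
Context (V : choiceType) d' (T : measurableType d') (X : V -> Omega -> T).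
Hypothesis mX : forall v, measurable_fun setT (X v).
Hypothesis indX : mutually_independent P X.
Implicit Types S : set V.

Definition events_of S : set (set Omega) :=
  [set A | exists2 v, S v & exists2 B, measurable B & A = X v @^-1` B].

(** A pi-system that generates the sigma-algebra of the [X v] with [v] in [S]; mutual independence
    speaks only of such finite intersections. *)
Definition finite_events S : set (set Omega) :=
  [set A | exists (s : seq V) (B : V -> set T),
    [/\ uniq s, {in s, forall v, S v}, forall v, measurable (B v) &
        A = \bigcap_(v in [set` s]) (X v @^-1` B v)]].

Lemma measurable_pre v B : measurable B -> measurable (X v @^-1` B).
Proof. by move=> mB; rewrite -[_ @^-1` _]setTI; exact: mX. Qed.

Lemma events_of_measurable S : events_of S `<=` measurable.
Proof. by move=> _ [v _ [B mB ->]]; exact: measurable_pre. Qed.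

Lemma sigma_events_measurable S A : <<s events_of S >> A -> measurable A.
Proof.
apply: smallest_sub; first exact: sigma_algebra_measurable.
exact: events_of_measurable.
Qed.

Lemma finite_events_measurable S : finite_events S `<=` measurable.
Proof.
move=> _ [s [B [us Ss mB ->]]].
by apply: fin_bigcap_measurable => // v _; exact: measurable_pre.
Qed.

Lemma finite_events_generate S : <<s events_of S >> `<=` <<s finite_events S >>.
Proof.
apply: smallest_sub; first exact: smallest_sigma_algebra.
move=> _ [v Sv [B mB ->]]; apply: sub_sigma_algebra.
exists [:: v], (fun=> B); split => //; first by move=> u; rewrite inE => /eqP ->.
by rewrite set_cons1 bigcap_set1.
Qed.

Lemma finite_events_setI S : setI_closed (finite_events S).
Proof.
move=> _ _ [s1 [B1 [u1 S1 m1 ->]]] [s2 [B2 [u2 S2 m2 ->]]].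
exists (undup (s1 ++ s2)), (fun v => (if v \in s1 then B1 v else setT) `&`
   (if v \in s2 then B2 v else setT)); split.
- exact: undup_uniq.
- by move=> v; rewrite mem_undup mem_cat => /orP[/S1|/S2].
- by move=> v; apply: measurableI; case: ifP.
apply/seteqP; split=> om /=.
  move=> [h1 h2] v /= _; split; case: ifPn => // vs; [exact: h1|exact: h2].
move=> h; split=> v /= vs; have := h v; rewrite /= mem_undup mem_cat vs ?orbT /=.
  by case/(_ isT).
by case/(_ isT).
Qed.

Lemma finite_events_indep S1 S2 A B : (forall v, S1 v -> ~ S2 v) ->
  finite_events S1 A -> finite_events S2 B -> P (A `&` B) = (P A * P B)%E.
Proof.
move=> S12 [s1 [B1 [u1 S1s m1 ->]]] [s2 [B2 [u2 S2s m2 ->]]].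
have ds v : v \in s2 -> v \notin s1.
  by move=> v2; apply/negP => v1; exact: (S12 v (S1s v v1) (S2s v v2)).
pose B' v := if v \in s1 then B1 v else B2 v.
have mB' v : measurable (B' v) by rewrite /B'; case: ifP.
have -> : \bigcap_(v in [set` s1]) (X v @^-1` B1 v) `&`
   \bigcap_(v in [set` s2]) (X v @^-1` B2 v) =
   \bigcap_(v in [set` s1 ++ s2]) (X v @^-1` B' v).
  apply/seteqP; split => om /=.
    move=> [h1 h2] v /=; rewrite mem_cat /B'.
    case: ifPn => [vs _|vs]; first exact: h1.
    by move=> /= vs2; exact: h2.
  move=> h; split=> v /= vs; have := h v; rewrite /= mem_cat vs ?orbT => /(_ isT).
    by rewrite /B' vs.
  by rewrite /B' (negbTE (ds _ vs)).
rewrite indX//; last first.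
  by rewrite cat_uniq u1 u2 andbT/=; apply/hasPn => v; exact: ds.
rewrite !indX// big_cat/=; congr (_ * _)%E; apply: eq_big_seq => v vs.
  by rewrite /B' vs.
by rewrite /B' (negbTE (ds _ vs)).
Qed.

Let finite_setT S : finite_events S setT.
Proof.
exists [::], (fun=> setT); split => //.
by rewrite set_nil bigcap_set0.
Qed.

(** Both sides, as functions of [A], are finite measures that agree on a pi-system containing
    [setT], so they agree on the sigma-algebra it generates. *)
Let extend (G : set (set Omega)) (B : set Omega) : G `<=` measurable ->
  setI_closed G -> G setT -> measurable B ->
  (forall A, G A -> P (A `&` B) = (P A * P B)%E) ->
  forall A, <<s G >> A -> P (A `&` B) = (P A * P B)%E.
Proof.
move=> Gm GI GT mB h A sA.
have fB : (0 <= fine (P B))%R by rewrite fine_ge0.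
pose m1 : {measure set Omega -> \bar R} := mrestr P mB.
pose m2 : {measure set Omega -> \bar R} := mscale (NngNum fB) P.
have PB : (P B = (fine (P B))%:E)%E by rewrite fineK// fin_num_measure.
have -> : P (A `&` B) = m1 A by [].
have -> : (P A * P B)%E = m2 A by rewrite muleC PB.
apply: (@g_sigma_algebra_measure_unique _ _ _ G Gm (fun=> setT)) => //.
- by apply/seteqP; split => // x _; exists 0%N.
- by move=> C GC; rewrite /m1 /m2 /= /mrestr /mscale /= [LHS](h _ GC) muleC [in LHS]PB.
- move=> _; rewrite /m1 /= /mrestr setTI (le_lt_trans (probability_le1 _ mB))//.
  by rewrite ltry.
Qed.

(** The extension is made one side at a time: from rectangles to [B] with a rectangle of [S1] fixed,
    then from rectangles to [A] with [B] fixed. *)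
Lemma events_indep S1 S2 A B : (forall v, S1 v -> ~ S2 v) ->
  <<s events_of S1 >> A -> <<s events_of S2 >> B -> P (A `&` B) = (P A * P B)%E.
Proof.
move=> S12 sA sB.
apply: (@extend (finite_events S1)) => //.
- exact: finite_events_measurable.
- exact: finite_events_setI.
- exact: sigma_events_measurable sB.
- move=> C GC; rewrite setIC [RHS]muleC.
  apply: (@extend (finite_events S2)) => //.
  + exact: finite_events_measurable.
  + exact: finite_events_setI.
  + exact: finite_events_measurable GC.
  + by move=> D GD; rewrite setIC [RHS]muleC; exact: finite_events_indep GC GD.
  + exact: finite_events_generate.
- exact: finite_events_generate.
Qed.

Lemma sigma_events_mono S1 S2 : S1 `<=` S2 ->
  <<s events_of S1 >> `<=` <<s events_of S2 >>.
Proof.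
move=> S12; apply: smallest_sub; first exact: smallest_sigma_algebra.
move=> _ [v Sv [B mB ->]]; apply: sub_sigma_algebra.
by exists v; [exact: S12|exists B].
Qed.

End independent_families.

(** The source is re-equipped with the generated sigma-algebra as its own measurable structure, so
    that the ordinary closure lemmas for measurable functions serve for sub-sigma-algebras too. *)
Definition meas_wrt {Omega : pointedType} (G : set (set Omega)) {d'} {T : measurableType d'}
  (f : Omega -> T) := measurable_fun setT (f : g_sigma_algebraType G -> T).

Lemma measurable_true_set d' (T : measurableType d') (b : T -> bool) :
  measurable_fun setT b -> measurable [set x | b x].
Proof.
by move=> mb; rewrite -[X in measurable X]setTI; exact: (mb measurableT [set true]).
Qed.

Lemma measurable_pattern d' (T : measurableType d') (I : finType)
    (b : I -> T -> bool) (J : {set I}) :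
  (forall i, measurable_fun setT (b i)) ->
  measurable [set x | [set i | b i x]%SET = J].
Proof.
move=> mb.
have mc i : measurable [set x | b i x] by exact: measurable_true_set.
have -> : [set x | [set i | b i x]%SET = J] = \bigcap_(i in [set` enum I])
   (if i \in J then [set x | b i x] else ~` [set x | b i x]).
  apply/seteqP; split => x /=.
    by move=> <- i _; case: ifPn; rewrite inE//; move/negP.
  move=> h; apply/setP => i; have := h i; rewrite /= mem_enum inE => /(_ isT).
  case: ifPn => _ /= nc //; exact/negbTE/negP.
apply: fin_bigcap_measurable => // i _.
by case: ifP => _ //; exact: measurableC.
Qed.

Section independent_product.
Context d (Omega : measurableType d) (R : realType) (P : probability Omega R).

(* Joint law = product of the marginals, then Fubini for [(x, y) |-> x * y]. *)
Lemma Ex_mul_of_indep (f g : Omega -> R) : L1 P f -> L1 P g ->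
  (forall A B : set R, measurable A -> measurable B ->
     P (f @^-1` A `&` g @^-1` B) = (P (f @^-1` A) * P (g @^-1` B))%E) ->
  L1 P (fun x => f x * g x) /\ Ex P (fun x => f x * g x) = Ex P f * Ex P g.
Proof.
move=> If Ig ind; have mf := L1_measurable If; have mg := L1_measurable Ig.
have mh : measurable_fun setT (fun x => (f x, g x)) by exact: measurable_fun_pair.
pose rf : {RV P >-> R} := HB.pack f (isMeasurableFun.Build _ _ _ _ f mf).
pose rg : {RV P >-> R} := HB.pack g (isMeasurableFun.Build _ _ _ _ g mg).
pose rh : {RV P >-> (R * R)%type} :=
  HB.pack (fun x => (f x, g x)) (isMeasurableFun.Build _ _ _ _ _ mh).
pose m1 : probability R R := distribution P rf.
pose m2 : probability R R := distribution P rg.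
pose m12 : probability (R * R)%type R := distribution P rh.
have m12E X : measurable X -> (m1 \x m2)%E X = m12 X.
  by move=> mX; apply: product_measure_unique => // A B mA mB; exact: ind.
pose F (z : R * R) : \bar R := (z.1 * z.2)%:E.
have mF : measurable_fun setT F.
  by apply/measurable_EFinP; apply: measurable_funM.
have I1 : (\int[m1]_x `|x|%:E < +oo)%E.
  rewrite ge0_integral_distribution//; last exact/measurable_EFinP.
  by move/integrableP: If => [].
have I2 : (\int[m2]_x `|x|%:E < +oo)%E.
  rewrite ge0_integral_distribution//; last exact/measurable_EFinP.
  by move/integrableP: Ig => [].
have i2 : m2.-integrable setT (EFin : R -> \bar R).
  by apply/integrableP; split => //; exact/measurable_EFinP.
have i1 : m1.-integrable setT (EFin : R -> \bar R).
  by apply/integrableP; split => //; exact/measurable_EFinP.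
have IF : (m1 \x m2)%E.-integrable setT F.
  apply/integrable12ltyP => //.
  under eq_integral => x _.
    rewrite (_ : (\int[m2]_y _)%E = (`|x|%:E * \int[m2]_y `|y|%:E)%E); last first.
      rewrite -ge0_integralZl//; last exact/measurable_EFinP.
      by apply: eq_integral => y _; rewrite /F /= normrM EFinM.
    over.
  rewrite ge0_integralZr//; [|exact/measurable_EFinP|exact: integral_ge0].
  by rewrite lte_mul_pinfty// ?integral_ge0// ge0_fin_numE// integral_ge0.
have eqI : (\int[m1 \x m2]_z F z = \int[m12]_z F z)%E.
  by apply: eq_measure_integral => A mA _; exact: m12E.
have Ifg : L1 P (fun x => f x * g x).
  apply/integrableP; split; first by apply/measurable_EFinP; exact: measurable_funM.
  have -> : (\int[P]_x `|(EFin \o (fun x => f x * g x)%R) x| =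
     \int[m12]_z `|F z|)%E.
    by rewrite ge0_integral_distribution//; exact: measurableT_comp.
  have -> : (\int[m12]_z `|F z| = \int[m1 \x m2]_z `|F z|)%E.
    by apply: eq_measure_integral => A mA _; exact/esym/m12E.
  by move/integrableP: IF => [].
split => //.
apply/EFin_inj; rewrite -ExE// EFinM -!ExE//.
transitivity (\int[m12]_z F z)%E.
  by rewrite integral_distribution.
rewrite -eqI -integral12_prod_meas1//=.
have -> : (\int[P]_x (f x)%:E = \int[m1]_x x%:E)%E.
  by rewrite integral_distribution//; exact/measurable_EFinP.
have e2 : (\int[P]_x (g x)%:E = \int[m2]_x x%:E)%E.
  by rewrite integral_distribution//; exact/measurable_EFinP.
under eq_integral => x _.
  rewrite /fubini_F /F /=.
  under eq_integral do rewrite EFinM.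
  rewrite integralZl// -e2 (ExE Ig).
  over.
by rewrite integralZr// e2 -e2 (ExE Ig).
Qed.

End independent_product.

Section measurable_wrt_families.
Context d (Omega : measurableType d) (R : realType) (P : probability Omega R).
Context (V : choiceType) d' (T : measurableType d') (X : V -> Omega -> T).
Hypothesis mX : forall v, measurable_fun setT (X v).
Hypothesis indX : mutually_independent P X.
Implicit Types S : set V.

Notation wrt S := (meas_wrt (events_of X S)).

Lemma eq_wrt S d2 (T2 : measurableType d2) (f g : Omega -> T2) :
  f =1 g -> wrt S f -> wrt S g.
Proof. by move=> /funext ->. Qed.

Lemma wrt_sum S (J : Type) (s : seq J) (F : J -> Omega -> R) :
  (forall j, wrt S (F j)) -> wrt S (fun om => \sum_(j <- s) F j om).
Proof.
move=> mF.
exact: (@measurable_sum _ (g_sigma_algebraType (events_of X S)) R setT J s F).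
Qed.

Lemma wrtM S (f g : Omega -> R) : wrt S f -> wrt S g ->
  wrt S (fun om => f om * g om).
Proof. by move=> mf mg; exact: measurable_funM. Qed.

Lemma wrt_pre S d2 (T2 : measurableType d2) (f : Omega -> T2) B :
  wrt S f -> measurable B -> <<s events_of X S >> (f @^-1` B).
Proof. by move=> mf mB; rewrite -[f @^-1` _]setTI; exact: mf. Qed.

Lemma wrt_measurable S d2 (T2 : measurableType d2) (f : Omega -> T2) :
  wrt S f -> measurable_fun setT f.
Proof.
move=> mf _ B mB; rewrite setTI.
exact: (sigma_events_measurable mX (wrt_pre mf mB)).
Qed.

Lemma wrt_mono S1 S2 d2 (T2 : measurableType d2) (f : Omega -> T2) :
  S1 `<=` S2 -> wrt S1 f -> wrt S2 f.
Proof.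
move=> S12 mf _ B mB; rewrite setTI.
exact: (sigma_events_mono (X := X) S12 (wrt_pre mf mB)).
Qed.

Lemma wrt_var S v : S v -> wrt S (X v).
Proof.
move=> Sv _ B mB; rewrite setTI; apply: sub_sigma_algebra.
by exists v => //; exists B.
Qed.

Lemma Ex_mul S1 S2 (f g : Omega -> R) : (forall v, S1 v -> ~ S2 v) ->
  wrt S1 f -> wrt S2 g -> L1 P f -> L1 P g ->
  Ex P (fun x => f x * g x) = Ex P f * Ex P g.
Proof.
move=> S12 mf mg If Ig; apply: (Ex_mul_of_indep If Ig _).2 => A B mA mB.
by apply: (events_indep mX indX S12); exact: wrt_pre.
Qed.

Lemma L1_mul S1 S2 (f g : Omega -> R) : (forall v, S1 v -> ~ S2 v) ->
  wrt S1 f -> wrt S2 g -> L1 P f -> L1 P g -> L1 P (fun x => f x * g x).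
Proof.
move=> S12 mf mg If Ig; apply: (Ex_mul_of_indep If Ig _).1 => A B mA mB.
by apply: (events_indep mX indX S12); exact: wrt_pre.
Qed.

End measurable_wrt_families.

(** * Word sums and the total mass martingale *)

Section word_sums.
Context {R : realType} {I : pointedFinType}.
Implicit Types (F : seq I -> R) (x : seq I -> weighted I R) (v w : seq I).

Lemma sum_tuple0 F : \sum_(w : 0.-tuple I) F w = F [::].
Proof.
rewrite (bigD1 [tuple])//= big1 ?addr0// => w.
by rewrite (tuple0 w) => /eqP.
Qed.

Lemma sum_tuple_rcons n F : \sum_(w : n.+1.-tuple I) F w =
  \sum_(w : n.-tuple I) \sum_i F (rcons w i).
Proof.
rewrite pair_big /=.
rewrite (reindex (fun p : n.-tuple I * I => [tuple of rcons p.1 p.2])) //=.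
pose f (w : n.+1.-tuple I) : n.-tuple I * I :=
  (belast_tuple (thead w) [tuple of behead w], last (thead w) (behead w)).
exists f => [[w i] _|w _]; last first.
  by apply: val_inj; rewrite /f/= -lastI -[RHS]/(val w) [in RHS](tuple_eta w).
have e : thead [tuple of rcons w i] :: behead [tuple of rcons w i] = rcons w i.
  by rewrite -[RHS]/(val [tuple of rcons w i]) [in RHS](tuple_eta [tuple of rcons w i]).
have := lastI (thead [tuple of rcons w i]) (behead [tuple of rcons w i]).
rewrite e => /rcons_inj[ew ei].
by congr pair; [apply: val_inj; rewrite /= -ew|rewrite -ei].
Qed.

Lemma sum_tuple_cons n F : \sum_(w : n.+1.-tuple I) F w =
  \sum_i \sum_(w : n.-tuple I) F (i :: w).
Proof.
rewrite pair_big /=.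
rewrite (reindex (fun p : I * n.-tuple I => [tuple of p.1 :: p.2])) //=.
exists (fun w : n.+1.-tuple I => (thead w, [tuple of behead w])) => [[i w] _|w _].
  by congr pair; apply: val_inj.
by apply: val_inj; rewrite /= [in RHS](tuple_eta w).
Qed.

Lemma Qprod_rcons x v w i :
  Qprod x v (rcons w i) = Qprod x v w * wgt (x (v ++ w)) i.
Proof.
elim: w v => [|j w ih] v /=; first by rewrite cats0 mul1r mulr1.
by rewrite ih mulrA cat_rcons.
Qed.

Lemma Qprod_shift x v u w :
  Qprod x (v ++ u) w = Qprod (fun u => x (v ++ u)) u w.
Proof. by elim: w u => //= i w ih u; rewrite -ih rcons_cat. Qed.

Lemma Qprod_ge0 x v w : (forall u i, 0 <= wgt (x u) i) -> 0 <= Qprod x v w.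
Proof. by move=> x0; elim: w v => //= i w ih v; rewrite mulr_ge0. Qed.

Lemma Ysum_shift x n v : Ysum x n v = Ysum (fun u => x (v ++ u)) n [::].
Proof. by apply: eq_bigr => w _; rewrite -{1}(cats0 v) Qprod_shift. Qed.

Lemma Ysum0 x v : Ysum x 0 v = 1.
Proof. by rewrite /Ysum sum_tuple0. Qed.

Lemma YsumS x n v : Ysum x n.+1 v =
  \sum_(w : n.-tuple I) Qprod x v w * \sum_i wgt (x (v ++ w)) i.
Proof.
rewrite /Ysum (sum_tuple_rcons _ (Qprod x v)); apply: eq_bigr => w _.
by rewrite mulr_sumr; apply: eq_bigr => i _; rewrite Qprod_rcons.
Qed.

Lemma YsumS_head x n v : Ysum x n.+1 v =
  \sum_i wgt (x v) i * Ysum x n (rcons v i).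
Proof.
rewrite /Ysum (sum_tuple_cons _ (Qprod x v)); apply: eq_bigr => i _.
by rewrite mulr_sumr.
Qed.

Lemma Ysum_ge0 x n v : (forall u i, 0 <= wgt (x u) i) -> 0 <= Ysum x n v.
Proof. by move=> x0; apply: sumr_ge0 => w _; exact: Qprod_ge0. Qed.

Lemma measurable_coord i :
  measurable_fun setT (fun x : weighted I R => x i : (bool * R)%type).
Proof.
move=> _ B mB; rewrite setTI; apply: sub_sigma_algebra.
by exists i, B.
Qed.

Lemma measurable_wgt i : measurable_fun setT (fun x : weighted I R => wgt x i).
Proof. exact: measurableT_comp (measurable_coord i). Qed.

Lemma measurable_cpt i : measurable_fun setT (fun x : weighted I R => cpt x i).
Proof. exact: measurableT_comp (measurable_coord i). Qed.

End word_sums.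

Section cascade_moments.
Context d (Omega : measurableType d) (R : realType) (P : probability Omega R).
Context (I : pointedFinType) (Z : seq I -> Omega -> weighted I R).
Hypothesis mZ : forall u, measurable_fun setT (Z u).
Hypothesis indZ : mutually_independent P Z.
Hypothesis Z0 : forall u om i, 0 <= wgt (Z u om) i.
Implicit Types (u w : seq I) (S : set (seq I)) (f : Omega -> R) (phi : R -> R).

Let W u i om : R := wgt (Z u om) i.
Let q w om : R := Qprod (fun u => Z u om) [::] w.
Let Y n om : R := Ysum (fun u => Z u om) n [::].

Hypothesis L1W : forall u i, L1 P (W u i).
Hypothesis mean1 : forall u, \sum_i Ex P (W u i) = 1.

Local Notation wrt S := (meas_wrt (events_of Z S)).

(** What depends on [others w] only is independent of the weights at [w]. This covers [Q(w)], which
    reads strict prefixes, and [Q(w')] with the weights at [w'] for any other word [w'] of the same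
    length. *)
Definition others (w : seq I) : set (seq I) := [set u | u <> w].
(** The sigma-algebras of these sets are the filtration of the martingale [Y]. *)
Definition shorter (n : nat) : set (seq I) := [set u | (size u < n)%N].

Lemma wrt_weight S u i phi : S u -> measurable_fun setT phi ->
  wrt S (fun om => phi (wgt (Z u om) i)).
Proof.
move=> Su mphi; apply: measurableT_comp => //.
apply: (@measurableT_comp _ _ _ _ _ _ (fun x : weighted I R => wgt x i)).
  exact: measurable_wgt.
exact: wrt_var.
Qed.

Lemma wrt_Qprod S w : (forall k, (k < size w)%N -> S (take k w)) ->
  wrt S (fun om => Qprod (fun u => Z u om) [::] w).
Proof.
elim/last_ind: w => [|w i ih] Sw; first exact: measurable_cst.
apply: (eq_wrt (fun om => esym (Qprod_rcons (fun u => Z u om) [::] w i))).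
apply: measurable_funM.
  apply: ih => k kw; have := Sw k; rewrite size_rcons ltnS => /(_ (ltnW kw)).
  by rewrite -cats1 takel_cat// ltnW.
apply: (@wrt_weight S w i id) => //=.
have := Sw (size w); rewrite size_rcons ltnS => /(_ (leqnn _)).
by rewrite -cats1 takel_cat// take_size.
Qed.

Lemma shorter_others n w : size w = n -> shorter n `<=` others w.
Proof. by move=> sw u /= + uw; rewrite /shorter uw /= sw ltnn. Qed.

Lemma wrt_Qprod_shorter w : wrt (shorter (size w)) (q w).
Proof. by apply: wrt_Qprod => k kw; rewrite /shorter /= size_takel// ltnW. Qed.

Lemma Ex_weight w f i phi : wrt (others w) f -> L1 P f ->
  measurable_fun setT phi -> L1 P (fun om => phi (wgt (Z w om) i)) ->
  Ex P (fun om => f om * phi (wgt (Z w om) i)) =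
  Ex P f * Ex P (fun om => phi (wgt (Z w om) i)).
Proof.
move=> mf If mphi Iphi.
apply: (Ex_mul mZ indZ (S1 := others w) (S2 := [set w])) => //.
exact: wrt_weight.
Qed.

Lemma L1_weight w f i phi : wrt (others w) f -> L1 P f ->
  measurable_fun setT phi -> L1 P (fun om => phi (wgt (Z w om) i)) ->
  L1 P (fun om => f om * phi (wgt (Z w om) i)).
Proof.
move=> mf If mphi Iphi.
apply: (L1_mul mZ indZ (S1 := others w) (S2 := [set w])) => //.
exact: wrt_weight.
Qed.

Lemma L1_Qprod w : L1 P (q w).
Proof.
elim/last_ind: w => [|w i ih]; first exact: L1_cst.
apply: eq_L1 (L1_weight (i := i) _ ih (@measurable_id _ _ setT) (L1W w i)).
  by move=> om; rewrite /q Qprod_rcons.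
exact: (wrt_mono (shorter_others (erefl _)) (@wrt_Qprod_shorter w)).
Qed.

Lemma L1_Ysum n : L1 P (Y n).
Proof. by apply: L1_sum => w _; exact: L1_Qprod. Qed.

Lemma wrt_Ysum n : wrt (shorter n) (Y n).
Proof.
apply: wrt_sum => w.
by have := @wrt_Qprod_shorter w; rewrite size_tuple.
Qed.

(** Testing against the events of the filtration stands in for conditional expectation. For [w] of
    length [n], [q w * \1_A] is independent of the weights at [w], whose means add up to 1. *)
Lemma Ysum_martingale n (A : set Omega) : <<s events_of Z (shorter n) >> A ->
  Ex P (fun om => Y n.+1 om * \1_A om) = Ex P (fun om => Y n om * \1_A om).
Proof.
move=> sA; have mA := sigma_events_measurable mZ sA.
have L w : size w = n -> wrt (others w) (fun om => q w om * \1_A om).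
  move=> sw; apply: (wrt_mono (S1 := shorter n)); first exact: shorter_others.
  apply: measurable_funM; first by rewrite -sw; exact: wrt_Qprod_shorter.
  exact: measurable_indic.
rewrite (@eq_Ex _ _ _ P _ (fun om => \sum_(w : n.-tuple I) \sum_i
    (q w om * \1_A om) * W w i om)); last first.
  move=> om; rewrite /Y YsumS mulr_suml; apply: eq_bigr => w _.
  rewrite mulrAC mulr_sumr; exact: eq_bigr.
rewrite [RHS](@eq_Ex _ _ _ P _ (fun om => \sum_(w : n.-tuple I) q w om * \1_A om));
  last by move=> om; rewrite /Y mulr_suml.
have Lq (w : n.-tuple I) : L1 P (fun om => q w om * \1_A om).
  exact: L1_mul_indic (L1_Qprod w).
have Lw (w : n.-tuple I) i : L1 P (fun om => (q w om * \1_A om) * W w i om).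
  apply: (L1_weight _ (Lq w) (@measurable_id _ _ setT) (L1W w i)).
  by apply: L; rewrite size_tuple.
rewrite !Ex_sum//; last by move=> w _; exact: L1_sum.
apply: eq_bigr => w _; rewrite Ex_sum//.
under eq_bigr => i _.
  rewrite (Ex_weight _ (Lq w) (@measurable_id _ _ setT) (L1W w i)); last first.
    by apply: L; rewrite size_tuple.
  over.
by rewrite -mulr_sumr mean1 mulr1.
Qed.

Lemma Ex_Ysum n : Ex P (Y n) = 1.
Proof.
elim: n => [|n ih].
  by rewrite (@eq_Ex _ _ _ P _ (fun=> 1)) ?Ex_cst// => om; rewrite /Y Ysum0.
rewrite -ih; have := @Ysum_martingale n setT; rewrite indicT => h.
have e m : Ex P (Y m) = Ex P (fun om => Y m om * cst 1 om).
  by apply: eq_Ex => om; rewrite mulr1.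
by rewrite !e h//; exact: (@measurableT _ (g_sigma_algebraType (events_of Z (shorter n)))).
Qed.

End cascade_moments.

(** * Truncated second moment *)

Section truncated_cascade.
Context d (Omega : measurableType d) (R : realType) (P : probability Omega R).
Context (I : pointedFinType) (Z : seq I -> Omega -> weighted I R).
Hypothesis mZ : forall u, measurable_fun setT (Z u).
Hypothesis indZ : mutually_independent P Z.
Hypothesis Z0 : forall u om i, 0 <= wgt (Z u om) i.
Variables (h tau b : nat -> R).
Implicit Types (u w : seq I) (i : I) (om : Omega) (S : set (seq I)).

Let W u i om : R := wgt (Z u om) i.
Let q w om : R := Qprod (fun u => Z u om) [::] w.
Let Y n om : R := Ysum (fun u => Z u om) n [::].

Hypothesis L1W : forall u i, L1 P (W u i).
Hypothesis L1W1 : forall u i, L1 P (fun om => W u i om * ln (W u i om)).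
Hypothesis L1W2 : forall u i, L1 P (fun om => W u i om * ln (W u i om) ^+ 2).
Hypothesis mean1 : forall u, \sum_i Ex P (W u i) = 1.
Hypothesis meanh : forall u,
  \sum_i Ex P (fun om => W u i om * ln (W u i om)) = - h (size u).
Hypothesis meantau : forall u,
  \sum_i Ex P (fun om => W u i om * ln (W u i om) ^+ 2) = tau (size u).
Hypothesis b0 : forall k, 0 < b k.
Hypothesis bS : forall k, b k <= b k.+1.

Local Notation wrt S := (meas_wrt (events_of Z S)).

(** Minus the size-biased mean of [ln Q(w)] at length [k], so that [dev] is the centred logarithm.
    Where [Q(w) = 0] the value of [dev] is meaningless, but [trunc] vanishes there. *)
Definition cumul (k : nat) : R := \sum_(j < k) h j.

Definition dev w om : R := ln (q w om) + cumul (size w).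

(* [trunc (rev w)] is [Q(w)] if every prefix of [w] satisfies [|dev| < b], and
   [0] otherwise. *)
Fixpoint trunc (r : seq I) om : R :=
  if r is i :: r' then
    if `|dev (rev r) om| < b (size r) then trunc r' om * W (rev r') i om else 0
  else 1.

Let g w om : R := trunc (rev w) om.

Let g_rcons w i om : g (rcons w i) om =
  if `|dev (rcons w i) om| < b (size w).+1 then g w om * W w i om else 0.
Proof.
by rewrite /g rev_rcons /= rev_cons revK size_rev.
Qed.

Let g_eq w om : g w om = 0 \/ g w om = q w om.
Proof.
elim/last_ind: w => [|w i ih]; first by right.
rewrite g_rcons; case: ifPn => _; last by left.
case: ih => ->; first by left; rewrite mul0r.
by right; rewrite /q Qprod_rcons.
Qed.

Let q_ge0 w om : 0 <= q w om.
Proof. by apply: Qprod_ge0 => *; exact: Z0. Qed.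

Let g_ge0 w om : 0 <= g w om.
Proof. by have [->|->] := g_eq w om. Qed.

Let g_leq w om : g w om <= q w om.
Proof. by have [->|->] := g_eq w om. Qed.

Let g_dev w om : g w om != 0 -> `|dev w om| < b (size w).
Proof.
case/lastP: w => [|w i].
  by move=> _; rewrite /dev /q /= ln1 /cumul big_ord0 addr0 normr0.
by rewrite g_rcons size_rcons; case: ifPn => //; rewrite eqxx.
Qed.

(** Inside the tube [ln Q] is capped by [b - cumul]. Boundedness makes the products of [g] and [dev]
    integrable without further moments, and the explicit cap is what makes the variance of [incr]
    decay. *)
Let g_ub w om : g w om <= expR (b (size w) - cumul (size w)).
Proof.
have [->|g0] := eqVneq (g w om) 0; first exact: expR_ge0.
have qg : g w om = q w om by case: (g_eq w om) g0 => ->; rewrite ?eqxx.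
have q0 : 0 < q w om by rewrite lt0r q_ge0 -qg g0.
rewrite qg -[leLHS](lnK _)//; rewrite ler_expR.
have /ltr_normlW := g_dev g0; rewrite /dev; lra.
Qed.

Let wrt_g (S : set (seq I)) w : (forall k, (k < size w)%N -> S (take k w)) -> wrt S (g w).
Proof.
elim/last_ind: w => [|w i ih] Sw; first exact: measurable_cst.
apply: (eq_wrt (fun om => esym (g_rcons w i om))).
have Sw' k : (k < size w)%N -> S (take k w).
  move=> kw; have := Sw k; rewrite size_rcons ltnS => /(_ (ltnW kw)).
  by rewrite -cats1 takel_cat// ltnW.
have Sww : S w.
  have := Sw (size w); rewrite size_rcons ltnS => /(_ (leqnn _)).
  by rewrite -cats1 takel_cat// take_size.
apply: measurable_fun_ifT.
- apply: measurable_fun_ltr; last exact: measurable_cst.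
  apply: measurableT_comp => //; apply: measurable_funD; last exact: measurable_cst.
  apply: measurableT_comp; first exact: measurable_ln.
  exact: wrt_Qprod.
- apply: wrtM; first exact: ih.
  exact: (@wrt_weight _ _ _ _ _ S w i id).
- exact: measurable_cst.
Qed.

Let wrt_dev (S : set (seq I)) w : (forall k, (k < size w)%N -> S (take k w)) -> wrt S (dev w).
Proof.
move=> Sw; apply: measurable_funD; last exact: measurable_cst.
apply: measurableT_comp; first exact: measurable_ln.
exact: wrt_Qprod.
Qed.

Let prefix_other w w' : size w' = size w ->
  forall k, (k < size w)%N -> others w' (take k w).
Proof.
move=> sw k kw /= e; move/(congr1 size): e; rewrite size_takel 1?ltnW// => e.
by rewrite e sw ltnn in kw.
Qed.

Let wrt_g_other w : wrt (others w) (g w).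
Proof. by apply: wrt_g; exact: prefix_other. Qed.

Let wrt_dev_other w : wrt (others w) (dev w).
Proof. by apply: wrt_dev; exact: prefix_other. Qed.

Let gdev_ub p w om : `|g w om * dev w om ^+ p| <=
  expR (b (size w) - cumul (size w)) * b (size w) ^+ p.
Proof.
have [->|g0] := eqVneq (g w om) 0.
  by rewrite mul0r normr0 mulr_ge0 ?expR_ge0// exprn_ge0// ltW.
rewrite normrM normrX ler_pM// ?exprn_ge0//; first by rewrite ger0_norm.
by rewrite lerXn2r ?nnegrE// ltW//; exact: g_dev.
Qed.

Let wrt_gdev p w : wrt (others w) (fun om => g w om * dev w om ^+ p).
Proof.
apply: wrtM; first exact: wrt_g_other.
by apply: measurable_funX; exact: wrt_dev_other.
Qed.

Let L1_gdev p w : L1 P (fun om => g w om * dev w om ^+ p).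
Proof.
apply: L1_bounded (gdev_ub p w).
exact: (wrt_measurable mZ (@wrt_gdev p w)).
Qed.

Let L1_g w : L1 P (g w).
Proof. by apply: eq_L1 (L1_gdev 0 w) => om; rewrite expr0 mulr1. Qed.

(** The mass passed from [w] to its child [i] that drops out because the child is the first to leave
    the tube. *)
Let loss w i om : R := g w om * W w i om - g (rcons w i) om.

Let loss_ge0 w i om : 0 <= loss w i om.
Proof.
rewrite /loss g_rcons; case: ifPn => _; first by rewrite subrr.
by rewrite subr0 mulr_ge0// Z0.
Qed.

Let L1_gW w i : L1 P (fun om => g w om * W w i om).
Proof.
exact: (L1_weight mZ indZ (@wrt_g_other w) (L1_g w)
  (@measurable_id _ _ setT) (L1W w i)).
Qed.

Let L1_loss w i : L1 P (loss w i).
Proof. by apply: L1B; [exact: L1_gW|exact: L1_g]. Qed.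

(** Pointwise Chebyshev: either the child stays in the tube and nothing is lost, or it leaves, and
    then [dev ^+ 2 >= b ^+ 2] pays for all of its mass. *)
Let loss_step w i om :
  loss w i om + g (rcons w i) om * dev (rcons w i) om ^+ 2 / b (size w).+1 ^+ 2 <=
  (g w om * W w i om * (dev w om + ln (W w i om) + h (size w)) ^+ 2)
    / b (size w).+1 ^+ 2.
Proof.
set n := size w; rewrite /loss g_rcons -/n.
have bb : 0 < b n.+1 ^+ 2 by rewrite exprn_gt0.
(* Both sides vanish when the product is 0. Otherwise [q w] and [W] are positive, so logarithms add
   and the convention [ln 0 = 0] never interferes. *)
have [gW0|gWn0] := eqVneq (g w om * W w i om) 0.
  by rewrite gW0; case: ifP => _; rewrite ?subr0 !mul0r ?addr0.
have /andP[g0 W0] : (g w om != 0) && (W w i om != 0) by rewrite -negb_or -mulf_eq0.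
have Wp : 0 < W w i om by rewrite lt0r W0 Z0.
have qp : 0 < q w om.
  by case: (g_eq w om) g0 => [->|<- g0]; [rewrite eqxx|rewrite lt0r g0 g_ge0].
have -> : dev w om + ln (W w i om) + h n = dev (rcons w i) om.
  rewrite /dev size_rcons /cumul big_ord_recr /= -/n /q Qprod_rcons cat0s.
  rewrite lnM ?posrE//; ring.
have gWp : 0 <= g w om * W w i om by rewrite mulr_ge0// ltW.
case: ifPn => [_|]; first by rewrite subrr add0r.
rewrite -leNgt => bd; rewrite subr0 !mul0r addr0 -mulrA ler_peMr//.
rewrite ler_pdivlMr// mul1r -[leRHS]real_normK ?num_real//.
by rewrite lerXn2r ?nnegrE// ltW.
Qed.

Let stepf w i om := g w om * W w i om * (dev w om + ln (W w i om) + h (size w)) ^+ 2.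

(** When the square is expanded, the terms linear in [dev] cancel because the weighted logarithms
    have mean [- h]. What is left besides [dev ^+ 2] is the variance [tau - h ^+ 2], bounded by
    [tau]. *)
Let Ex_stepf w : (forall i, L1 P (stepf w i)) /\
  \sum_i Ex P (stepf w i) <=
  Ex P (fun om => g w om * dev w om ^+ 2) + tau (size w) * Ex P (g w).
Proof.
set n := size w.
have mln1 : measurable_fun setT (fun x : R => x * ln x).
  by apply: measurable_funM => //; exact: measurable_ln.
have mln2 : measurable_fun setT (fun x : R => x * ln x ^+ 2).
  by apply: measurable_funM => //; apply: measurable_funX; exact: measurable_ln.
pose E p := Ex P (fun om => g w om * dev w om ^+ p).
pose e1 i := Ex P (fun om => W w i om * ln (W w i om)).
pose e2 i := Ex P (fun om => W w i om * ln (W w i om) ^+ 2).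
pose F p i om := g w om * dev w om ^+ p * W w i om.
pose F1 p i om := g w om * dev w om ^+ p * (W w i om * ln (W w i om)).
pose F2 p i om := g w om * dev w om ^+ p * (W w i om * ln (W w i om) ^+ 2).
have Ew p i : Ex P (F p i) = E p * Ex P (W w i) :=
  Ex_weight mZ indZ (@wrt_gdev p w) (L1_gdev p w) (@measurable_id _ _ setT) (L1W w i).
have Lw p i : L1 P (F p i) :=
  L1_weight mZ indZ (@wrt_gdev p w) (L1_gdev p w) (@measurable_id _ _ setT) (L1W w i).
have Ew1 p i : Ex P (F1 p i) = E p * e1 i :=
  Ex_weight mZ indZ (@wrt_gdev p w) (L1_gdev p w) mln1 (L1W1 w i).
have Lw1 p i : L1 P (F1 p i) :=
  L1_weight mZ indZ (@wrt_gdev p w) (L1_gdev p w) mln1 (L1W1 w i).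
have Ew2 p i : Ex P (F2 p i) = E p * e2 i :=
  Ex_weight mZ indZ (@wrt_gdev p w) (L1_gdev p w) mln2 (L1W2 w i).
have Lw2 p i : L1 P (F2 p i) :=
  L1_weight mZ indZ (@wrt_gdev p w) (L1_gdev p w) mln2 (L1W2 w i).
have Eg : Ex P (g w) = E 0%N.
  by apply: eq_Ex => om; rewrite expr0 mulr1.
pose G i om := (F 2%N i om + 2 * h n * F 1%N i om + h n ^+ 2 * F 0%N i om) +
  (2 * F1 1%N i om + 2 * h n * F1 0%N i om + F2 0%N i om).
have sG i : G i =1 stepf w i.
  by move=> om; rewrite /G /stepf /F /F1 /F2 /W -/n; ring.
have LG1 i : L1 P (fun om => F 2%N i om + 2 * h n * F 1%N i om).
  by apply: L1D => //; apply: L1Z.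
have LG2 i : L1 P (fun om => F 2%N i om + 2 * h n * F 1%N i om + h n ^+ 2 * F 0%N i om).
  by apply: L1D => //; apply: L1Z.
have LG3 i : L1 P (fun om => 2 * F1 1%N i om + 2 * h n * F1 0%N i om).
  by apply: L1D; apply: L1Z.
have LG4 i : L1 P (fun om => 2 * F1 1%N i om + 2 * h n * F1 0%N i om + F2 0%N i om).
  exact: L1D.
have step i : Ex P (stepf w i) =
    (E 2%N * Ex P (W w i) + 2 * h n * (E 1%N * Ex P (W w i)) +
     h n ^+ 2 * (E 0%N * Ex P (W w i))) +
    (2 * (E 1%N * e1 i) + 2 * h n * (E 0%N * e1 i) + E 0%N * e2 i).
  rewrite -(eq_Ex _ (sG i)) /G (ExD (LG2 i) (LG4 i)) (ExD (LG1 i)); last exact: L1Z.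
  rewrite (ExD (Lw _ _)); last exact: L1Z.
  rewrite (ExD (LG3 i)) // ExD; [|exact: L1Z|exact: L1Z].
  by rewrite !ExZ// !Ew !Ew1 Ew2.
split=> [i|]; first by apply: eq_L1 (sG i) _; exact: L1D.
under eq_bigr do rewrite step.
rewrite !big_split /= -!mulr_sumr mean1 meanh meantau -/n Eg -/(E 2%N).
have : 0 <= E 0%N by apply: Ex_ge0 => om; rewrite expr0 mulr1.
move: (E 0%N) (E 1%N) (E 2%N) => x0 x1 x2 x00.
have : 0 <= h n ^+ 2 * x0 by rewrite mulr_ge0// sqr_ge0.
move=> hx; rewrite -subr_ge0.
apply: le_trans hx _; rewrite le_eqVlt; apply/orP; left; apply/eqP; ring.
Qed.

Definition lost_mass k om := \sum_(w : k.-tuple I) \sum_i loss w i om.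
Definition trunc_mass k om := \sum_(w : k.-tuple I) g w om.

(** Potential of the Hajek-Renyi argument: dividing by the current [b k ^+ 2] lets the losses of
    successive levels telescope. *)
Let A k := \sum_(w : k.-tuple I) Ex P (fun om => g w om * dev w om ^+ 2) / b k ^+ 2.

Lemma L1_lost_mass k : L1 P (lost_mass k).
Proof. by apply: L1_sum => w _; apply: L1_sum => i _; exact: L1_loss. Qed.

Lemma L1_trunc_mass k : L1 P (trunc_mass k).
Proof. by apply: L1_sum => w _; exact: L1_g. Qed.

Lemma trunc_mass_le k om : trunc_mass k om <= Y k om.
Proof. by apply: ler_sum => w _; exact: g_leq. Qed.

Lemma tau_ge0 k : 0 <= tau k.
Proof.
rewrite -(size_nseq k (point : I)) -meantau; apply: sumr_ge0 => i _.
by apply: Ex_ge0 => om; rewrite mulr_ge0 ?sqr_ge0// Z0.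
Qed.

Lemma trunc_mass_Ex_le1 k : Ex P (trunc_mass k) <= 1.
Proof.
rewrite -(Ex_Ysum mZ indZ L1W mean1 k); apply: Ex_le.
- exact: L1_trunc_mass.
- exact: L1_Ysum.
- exact: trunc_mass_le.
Qed.

(* Hajek-Renyi: a word leaving the tube at level [k.+1] has [dev ^+ 2 >= b k.+1 ^+ 2],
   and [dev] is a martingale along words under the size-biased law. *)
Let A_step k : Ex P (lost_mass k) + A k.+1 <= A k + tau k / b k.+1 ^+ 2.
Proof.
have bb n : 0 < b n ^+ 2 by rewrite exprn_gt0.
have -> : A k.+1 = \sum_(w : k.-tuple I) \sum_i
    Ex P (fun om => g (rcons w i) om * dev (rcons w i) om ^+ 2) / b k.+1 ^+ 2.
  by rewrite /A (sum_tuple_rcons _ (fun w =>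
    Ex P (fun om => g w om * dev w om ^+ 2) / b k.+1 ^+ 2)).
rewrite Ex_sum => [|w _]; last by apply: L1_sum => i _; exact: L1_loss.
under eq_bigr do rewrite (Ex_sum _ (fun i _ => L1_loss _ i)).
rewrite -big_split /=.
apply: (@le_trans _ _ (\sum_(w : k.-tuple I) (Ex P (fun om => g w om * dev w om ^+ 2)
   + tau k * Ex P (g w)) / b k.+1 ^+ 2)); last first.
  under eq_bigr do rewrite mulrDl.
  rewrite big_split /= lerD//.
    rewrite /A; apply: ler_sum => w _; rewrite ler_wpM2l//.
      by apply: Ex_ge0 => om; rewrite mulr_ge0 ?sqr_ge0.
    by rewrite lef_pV2 ?posrE// lerXn2r ?nnegrE// ltW.
  rewrite -mulr_suml -mulr_sumr ler_wpM2r ?invr_ge0 ?(ltW (bb k.+1))//.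
  rewrite -Ex_sum => [|w _]; last exact: L1_g.
    by rewrite ler_piMr ?tau_ge0// trunc_mass_Ex_le1.
apply: ler_sum => w _.
have sw : size w = k by rewrite size_tuple.
have [Ls Es] := Ex_stepf w; rewrite sw in Es.
apply: le_trans (ler_wpM2r _ Es); last by rewrite invr_ge0 ltW.
rewrite mulr_suml -big_split /=; apply: ler_sum => i _.
rewrite ![_ / b k.+1 ^+ 2]mulrC -!ExZ//.
rewrite -ExD//; last exact: L1Z.
apply: Ex_le => [||om]; [by apply: L1D => //; exact: L1Z|exact: L1Z|].
by rewrite ![b k.+1 ^- 2 * _]mulrC /stepf sw; have := loss_step w i om; rewrite sw.
Qed.

Lemma lost_mass_bound n : \sum_(k < n) Ex P (lost_mass k) <=
  \sum_(k < n) tau k / b k.+1 ^+ 2.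
Proof.
have A0 : A 0 = 0.
  rewrite /A (sum_tuple0 (fun w => Ex P (fun om => g w om * dev w om ^+ 2) / b 0 ^+ 2)).
  rewrite (@eq_Ex _ _ _ P _ (fun=> 0)) ?Ex_cst ?mul0r// => om.
  by rewrite /dev /q /= ln1 /cumul big_ord0 addr0 expr0n mulr0.
have : \sum_(k < n) Ex P (lost_mass k) + A n <= \sum_(k < n) tau k / b k.+1 ^+ 2.
  elim: n => [|n ih]; first by rewrite !big_ord0 A0 addr0.
  by rewrite !big_ord_recr /=; have := A_step n; lra.
apply: le_trans; rewrite lerDl; apply: sumr_ge0 => w _.
by apply: divr_ge0; [apply: Ex_ge0 => om; rewrite mulr_ge0// sqr_ge0|rewrite exprn_ge0// ltW].
Qed.

(** The threshold balances two needs. Above it [ln W >= b k.+1], so the discarded weights cost at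
    most [tau k / b k.+1 ^+ 2], the same price as leaving the tube; below it the square of the sum
    of the weights is at most [#|I|] times the threshold times that sum. *)
Definition cut (k : nat) (x : R) : R := if x <= expR (b k.+1) then x else 0.

Lemma measurable_cut k : measurable_fun setT (cut k).
Proof.
apply: measurable_fun_ifT => //.
by apply: measurable_fun_ler => //; exact: measurable_cst.
Qed.

Let cut_ge0 k u i om : 0 <= cut k (W u i om).
Proof. by rewrite /cut; case: ifP => // _; exact: Z0. Qed.

Let cut_le k u i om : cut k (W u i om) <= W u i om.
Proof. by rewrite /cut; case: ifP => // _; exact: Z0. Qed.

Let L1_cut k u i : L1 P (fun om => cut k (W u i om)).
Proof.
apply: (L1_le _ (L1W u i)) => [|om].
  apply: measurableT_comp; first exact: measurable_cut.
  exact: L1_measurable (L1W u i).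
by rewrite ger0_norm.
Qed.

Let cut_tail k u i om :
  W u i om - cut k (W u i om) <= (W u i om * ln (W u i om) ^+ 2) / b k.+1 ^+ 2.
Proof.
have bb : 0 < b k.+1 ^+ 2 by rewrite exprn_gt0.
have W0 : 0 <= W u i om by exact: Z0.
rewrite /cut; case: ifPn => [_|].
  by rewrite subrr mulr_ge0 ?invr_ge0 ?(ltW bb)// mulr_ge0 ?sqr_ge0.
rewrite -ltNge subr0 => bW; rewrite -mulrA ler_peMr// ler_pdivlMr// mul1r.
have bl : b k.+1 <= ln (W u i om).
  rewrite -[leLHS]expRK ler_ln ?posrE ?expR_gt0 ?(ltW bW)//.
  by rewrite (lt_trans _ bW) ?expR_gt0.
by rewrite lerXn2r ?nnegrE// ?(le_trans _ bl) ?ltW.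
Qed.

Let mcut k u : R := \sum_i Ex P (fun om => cut k (W u i om)).

Let mcut_tail k u : size u = k -> 1 - mcut k u <= tau k / b k.+1 ^+ 2.
Proof.
move=> su; rewrite -(mean1 u) -[in tau k]su -meantau -sumrB mulr_suml.
apply: ler_sum => i _; rewrite -ExB// mulrC -ExZ//; apply: Ex_le => [||om].
- exact: L1B.
- exact: L1Z.
- by rewrite [leRHS]mulrC; exact: cut_tail.
Qed.

Let mcut_le1 k u : mcut k u <= 1.
Proof. by rewrite -(mean1 u); apply: ler_sum => i _; apply: Ex_le. Qed.

(** Centring by the mean [mcut] of the cut weights makes the contributions of distinct words
    orthogonal; [resid] collects what this leaves out of the step of [trunc_mass]. *)
Definition incr k om := \sum_(w : k.-tuple I)
  g w om * (\sum_i cut k (W w i om) - mcut k w).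

Let L1_gcut k (w : seq I) i : L1 P (fun om => g w om * cut k (W w i om)).
Proof.
exact: (L1_weight mZ indZ (@wrt_g_other w) (L1_g w) (@measurable_cut k) (L1_cut k w i)).
Qed.

Let L1_incr1 k (w : seq I) :
  L1 P (fun om => g w om * (\sum_i cut k (W w i om) - mcut k w)).
Proof.
apply: (eq_L1 _ (L1B (L1_sum _ (fun i _ => L1_gcut k w i)) (L1Z (mcut k w) (L1_g w)))).
by move=> om /=; rewrite mulrBr mulr_sumr [mcut k w * _]mulrC.
Qed.

Lemma L1_incr k : L1 P (incr k).
Proof. by apply: L1_sum => w _; exact: L1_incr1. Qed.

Let resid k om := trunc_mass k.+1 om - trunc_mass k om - incr k om.

Let L1_resid k : L1 P (resid k).
Proof.
apply: L1B; last exact: L1_incr.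
by apply: L1B; exact: L1_trunc_mass.
Qed.

Let tail k (w : seq I) om : R := \sum_i (W w i om - cut k (W w i om)).

Let trunc_massS k om : trunc_mass k.+1 om =
  \sum_(w : k.-tuple I) g w om * \sum_i W w i om - lost_mass k om.
Proof.
rewrite /trunc_mass (sum_tuple_rcons _ (fun w => g w om)) /lost_mass -sumrB.
apply: eq_bigr => w _; rewrite mulr_sumr -sumrB; apply: eq_bigr => i _.
by rewrite /loss opprB addrC subrK.
Qed.

Let resid_norm k om : `|resid k om| <=
  \sum_(w : k.-tuple I) g w om * (tail k w om + (1 - mcut k w)) + lost_mass k om.
Proof.
have -> : resid k om = \sum_(w : k.-tuple I)
    g w om * (tail k w om - (1 - mcut k w)) - lost_mass k om.
  rewrite /resid trunc_massS.
  suff -> : \sum_(w : k.-tuple I) g w om * (tail k w om - (1 - mcut k w)) =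
    \sum_(w : k.-tuple I) g w om * \sum_i W w i om - trunc_mass k om - incr k om by ring.
  rewrite /incr /trunc_mass -!sumrB; apply: eq_bigr => w _.
  by rewrite /tail sumrB; ring.
have l0 : 0 <= lost_mass k om.
  by apply: sumr_ge0 => w _; apply: sumr_ge0 => i _; exact: loss_ge0.
rewrite (le_trans (ler_normB _ _))// (ger0_norm l0) lerD2r.
rewrite (le_trans (ler_norm_sum _ _ _))//; apply: ler_sum => w _.
rewrite normrM (ger0_norm (g_ge0 _ _)) ler_wpM2l// (le_trans (ler_normB _ _))//.
rewrite !ger0_norm// ?subr_ge0 ?mcut_le1//.
by apply: sumr_ge0 => i _; rewrite subr_ge0.
Qed.

Let Ex_trunc_massS k :
  Ex P (trunc_mass k.+1) = Ex P (trunc_mass k) - Ex P (lost_mass k).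
Proof.
pose F om := \sum_(w : k.-tuple I) \sum_i g w om * W w i om.
have LF : L1 P F by apply: L1_sum => w _; apply: L1_sum => i _; exact: L1_gW.
rewrite (@eq_Ex _ _ _ P _ (fun om => F om - lost_mass k om)); last first.
  by move=> om; rewrite trunc_massS /F; under eq_bigr do rewrite mulr_sumr.
rewrite ExB//; last exact: L1_lost_mass.
congr (_ - _); rewrite /F Ex_sum => [|w _]; last by apply: L1_sum => i _; exact: L1_gW.
rewrite /trunc_mass Ex_sum => [|w _]; last exact: L1_g.
apply: eq_bigr => w _; rewrite Ex_sum => [|i _]; last exact: L1_gW.
under eq_bigr => i _.
  rewrite (Ex_weight mZ indZ (@wrt_g_other w) (L1_g w) (@measurable_id _ _ setT) (L1W w i)).
  over.
by rewrite -mulr_sumr mean1 mulr1.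
Qed.

Let trunc_mass0 om : trunc_mass 0 om = 1.
Proof. by rewrite /trunc_mass (sum_tuple0 (fun w => g w om)). Qed.

Let Ex_trunc_mass n : 1 - Ex P (trunc_mass n) = \sum_(k < n) Ex P (lost_mass k).
Proof.
elim: n => [|n ih].
  by rewrite big_ord0 (eq_Ex _ trunc_mass0) Ex_cst subrr.
by rewrite big_ord_recr /= -ih Ex_trunc_massS; ring.
Qed.

(** The factor 2 counts the discarded large weights and, separately, the shift [1 - mcut] of the
    mean that they cause; each costs [tau / b ^+ 2]. The last term is the mass that leaves the
    tube. *)
Let Ex_resid k : Ex P (fun om => `|resid k om|) <=
  2 * (tau k / b k.+1 ^+ 2) + Ex P (lost_mass k).
Proof.
pose F om := \sum_(w : k.-tuple I) \sum_i
  (g w om * W w i om - g w om * cut k (W w i om)) +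
  \sum_(w : k.-tuple I) (1 - mcut k w) * g w om.
have LF1 : L1 P (fun om => \sum_(w : k.-tuple I) \sum_i
  (g w om * W w i om - g w om * cut k (W w i om))).
  apply: L1_sum => w _; apply: L1_sum => i _; apply: L1B.
    exact: L1_gW.
  exact: L1_gcut.
have LF2 : L1 P (fun om => \sum_(w : k.-tuple I) (1 - mcut k w) * g w om).
  by apply: L1_sum => w _; apply: L1Z; exact: L1_g.
have LF : L1 P F by exact: L1D.
apply: (@le_trans _ _ (Ex P (fun om => F om + lost_mass k om))).
  apply: Ex_le => [||om].
  - exact: L1_norm.
  - by apply: L1D => //; exact: L1_lost_mass.
  rewrite (le_trans (resid_norm k om))// lerD2r /F -big_split/=.
  apply: ler_sum => w _; rewrite mulrDr /tail mulr_sumr [_ * (1 - _)]mulrC.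
  by rewrite lerD2r; apply: ler_sum => i _; rewrite mulrBr.
rewrite ExD//; last exact: L1_lost_mass.
rewrite lerD2r /F ExD// Ex_sum => [|w _]; last first.
  by apply: L1_sum => i _; apply: L1B; [exact: L1_gW|exact: L1_gcut].
rewrite Ex_sum => [|w _]; last by apply: L1Z; exact: L1_g.
rewrite -big_split /=.
apply: (@le_trans _ _ (\sum_(w : k.-tuple I) 2 * (tau k / b k.+1 ^+ 2) * Ex P (g w))).
  apply: ler_sum => w _; have sw : size w = k by rewrite size_tuple.
  rewrite ExZ; last exact: L1_g.
  rewrite Ex_sum => [|i _]; last by apply: L1B; [exact: L1_gW|exact: L1_gcut].
  have -> : \sum_i Ex P (fun om => g w om * W w i om - g w om * cut k (W w i om)) =
     Ex P (g w) * (1 - mcut k w).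
    rewrite -(mean1 w) -sumrB mulr_sumr; apply: eq_bigr => i _.
    rewrite ExB; [|exact: L1_gW|exact: L1_gcut].
    rewrite (Ex_weight mZ indZ (@wrt_g_other w) (L1_g w) (@measurable_id _ _ setT) (L1W w i)).
    rewrite (Ex_weight mZ indZ (@wrt_g_other w) (L1_g w) (@measurable_cut k) (L1_cut k w i)).
    by rewrite mulrBr.
  rewrite [Ex P _ * _]mulrC -mulrDl ler_wpM2r//; first by apply: Ex_ge0.
  by have := mcut_tail sw; lra.
rewrite -mulr_sumr -Ex_sum => [|w _]; last exact: L1_g.
rewrite ler_piMr ?trunc_mass_Ex_le1// mulr_ge0// divr_ge0 ?tau_ge0//.
by rewrite exprn_ge0// ltW.
Qed.

(** The constant 4 adds up as follows: 1 for [Y n - trunc_mass n], whose mean is the total lost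
    mass, then 2 and 1 for the two terms bounding the residuals. *)
Lemma Ysum_approx n :
  Ex P (fun om => `|Y n om - (1 + \sum_(k < n) incr k om)|) <=
  4 * \sum_(k < n) tau k / b k.+1 ^+ 2.
Proof.
have tel om : trunc_mass n om = 1 + \sum_(k < n) incr k om + \sum_(k < n) resid k om.
  elim: n => [|n ih]; first by rewrite !big_ord0 trunc_mass0 !addr0.
  by rewrite !big_ord_recr /= /resid ih; ring.
have LY := L1_Ysum mZ indZ L1W n; rewrite -/(Y n) in LY.
have LN : L1 P (fun om => \sum_(k < n) `|resid k om|).
  by apply: L1_sum => k _; exact: L1_norm.
have LD : L1 P (fun om => Y n om - trunc_mass n om).
  by apply: L1B => //; exact: L1_trunc_mass.
apply: (@le_trans _ _ (Ex P (fun om =>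
   (Y n om - trunc_mass n om) + \sum_(k < n) `|resid k om|))).
  apply: Ex_le => [||om].
  - apply: L1_norm; apply: L1B => //; apply: L1D; first exact: L1_cst.
    by apply: L1_sum => k _; exact: L1_incr.
  - exact: L1D.
  have -> : Y n om - (1 + \sum_(k < n) incr k om) =
     (Y n om - trunc_mass n om) + \sum_(k < n) resid k om by rewrite tel; ring.
  rewrite (le_trans (ler_normD _ _))// lerD//.
    by rewrite ger0_norm// subr_ge0 trunc_mass_le.
  exact: ler_norm_sum.
rewrite ExD// ExB//; last exact: L1_trunc_mass.
rewrite (Ex_Ysum mZ indZ L1W mean1) Ex_trunc_mass Ex_sum => [|k _]; last exact: L1_norm.
have : \sum_(k < n) Ex P (fun om => `|resid k om|) <=
   \sum_(k < n) (2 * (tau k / b k.+1 ^+ 2) + Ex P (lost_mass k)).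
  by apply: ler_sum => k _; exact: Ex_resid.
rewrite big_split /= -mulr_sumr.
by have := lost_mass_bound n; lra.
Qed.

Let cutdev k w om : R := \sum_i cut k (W w i om) - mcut k w.

Let B k : R := #|I|%:R * expR (b k.+1).

Let cutsum_le k w om : \sum_i cut k (W w i om) <= B k.
Proof.
rewrite (le_trans (ler_sum _ (G := fun=> expR (b k.+1)) _))//; last first.
  by rewrite sumr_const cardT -cardE /B mulr_natl.
by move=> i _; rewrite /cut; case: ifP => // _; exact: expR_ge0.
Qed.

Let mcut_ge0 k w : 0 <= mcut k w.
Proof. by apply: sumr_ge0 => i _; exact: Ex_ge0. Qed.

Let wrt_cutdev k w : wrt [set w] (cutdev k w).
Proof.
apply: measurable_funB; last exact: measurable_cst.
apply: wrt_sum => i; apply: wrt_weight => //; exact: measurable_cut.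
Qed.

Let cutdev_ub k w om : `|cutdev k w om| <= B k + 1.
Proof.
have s0 : 0 <= \sum_i cut k (W w i om) by apply: sumr_ge0.
rewrite (le_trans (ler_normB _ _))// !ger0_norm//.
by rewrite lerD ?mcut_le1.
Qed.

Let L1_cutdev k w : L1 P (cutdev k w).
Proof. exact: L1_bounded (wrt_measurable mZ (@wrt_cutdev k w)) (cutdev_ub k w). Qed.

Let L1_cutsum k w : L1 P (fun om => \sum_i cut k (W w i om)).
Proof. exact: L1_sum. Qed.

Let Ex_cutdev k w : Ex P (cutdev k w) = 0.
Proof.
rewrite ExB//; last exact: L1_cst.
by rewrite Ex_cst Ex_sum// subrr.
Qed.

Let L1_cutdev2 k w : L1 P (fun om => cutdev k w om ^+ 2).
Proof.
apply: (@L1_bounded _ _ _ P _ ((B k + 1) ^+ 2)) => [|om].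
  by apply: measurable_funX; exact: L1_measurable (L1_cutdev k w).
by rewrite normrX lerXn2r ?nnegrE// (le_trans _ (cutdev_ub k w om)).
Qed.

Let Ex_cutdev2 k w : Ex P (fun om => cutdev k w om ^+ 2) <= B k.
Proof.
have B0 : 0 <= B k by rewrite mulr_ge0 ?expR_ge0.
(* For [0 <= s <= B] one has [s ^+ 2 <= B s], hence [(s - m) ^+ 2 <= c s + m ^+ 2]; the mean of the
   right side is [B m - m ^+ 2 <= B], since [0 <= m <= 1]. *)
pose c := (B k - 2 * mcut k w).
have Lc : L1 P (fun om => c * \sum_i cut k (W w i om)) by apply: L1Z.
apply: (@le_trans _ _ (Ex P (fun om => c * (\sum_i cut k (W w i om)) + mcut k w ^+ 2))).
  apply: Ex_le => // [|om]; first by apply: L1D => //; exact: L1_cst.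
  have s0 : 0 <= \sum_i cut k (W w i om) by apply: sumr_ge0.
  have := cutsum_le k w om; rewrite /cutdev /c.
  move: (\sum_i cut k (W w i om)) s0 (mcut k w) (B k) => s s0 m B1 sB; nra.
rewrite ExD//; last exact: L1_cst.
rewrite Ex_cst ExZ// Ex_sum// -/(mcut k w) /c.
have := mcut_le1 k w; have := mcut_ge0 k w; move: (mcut k w) B0 => m; nra.
Qed.

Let term_ub k (w : k.-tuple I) om : `|g w om * cutdev k w om| <=
  expR (b k - cumul k) * (B k + 1).
Proof.
rewrite normrM ler_pM// ?cutdev_ub// ger0_norm//.
by have := g_ub w om; rewrite size_tuple.
Qed.

Let m_term k (w : k.-tuple I) : measurable_fun setT (fun om => g w om * cutdev k w om).
Proof. by apply: measurable_funM; exact: L1_measurable. Qed.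

Lemma L1_incr2 k : L1 P (fun om => incr k om ^+ 2).
Proof.
pose M := \sum_(w : k.-tuple I) expR (b k - cumul k) * (B k + 1).
apply: (@L1_bounded _ _ _ P _ (M ^+ 2)) => [|om].
  by apply: measurable_funX; exact: L1_measurable (L1_incr k).
have inM : `|incr k om| <= M.
  by rewrite (le_trans (ler_norm_sum _ _ _))//; apply: ler_sum => w _; exact: term_ub.
by rewrite normrX lerXn2r ?nnegrE// (le_trans _ inM).
Qed.

(* Off-diagonal terms vanish: for [w' != w] of the same length, [cutdev k w'] is
   centred and independent of the other factors. *)
Lemma Ex_incr2 k : Ex P (fun om => incr k om ^+ 2) <=
  #|I|%:R * expR (b k + b k.+1 - cumul k).
Proof.
pose a (w : k.-tuple I) om := g w om * cutdev k w om.
have La (w w' : k.-tuple I) : L1 P (fun om => a w om * a w' om).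
  apply: (@L1_bounded _ _ _ P _ ((expR (b k - cumul k) * (B k + 1)) ^+ 2)) => [|om].
    by apply: measurable_funM; exact: m_term.
  by rewrite normrM expr2 ler_pM//; exact: term_ub.
rewrite (@eq_Ex _ _ _ P _ (fun om => \sum_(w : k.-tuple I) \sum_(w' : k.-tuple I) a w om * a w' om)); last first.
  move=> om; rewrite /incr expr2 mulr_suml; apply: eq_bigr => w _.
  by rewrite mulr_sumr.
rewrite Ex_sum => [|w _]; last by apply: L1_sum => w' _.
(* On the diagonal one factor [g] is replaced by its upper bound and the other keeps its mean: the
   means sum to at most 1, so the number of words never enters. *)
apply: (@le_trans _ _ (\sum_(w : k.-tuple I) Ex P (g w) * (#|I|%:R * expR (b k + b k.+1 - cumul k)))); last first.
  rewrite -mulr_suml -Ex_sum => [|w _]; last exact: L1_g.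
  by rewrite ler_piMl ?trunc_mass_Ex_le1// mulr_ge0// expR_ge0.
apply: ler_sum => w _; rewrite Ex_sum//.
have gub om : g w om <= expR (b k - cumul k).
  by have := g_ub w om; rewrite size_tuple.
have Lg2 : L1 P (fun om => g w om ^+ 2).
  apply: (L1_le _ (L1Z (expR (b k - cumul k)) (L1_g w))) => [|om].
    by apply: measurable_funX; exact: L1_measurable.
  by rewrite ger0_norm ?sqr_ge0// expr2 ler_wpM2r.
rewrite (bigD1 w)//= big1 ?addr0 => [|w' w'w]; last first.
  rewrite (@eq_Ex _ _ _ P _ (fun om => (a w om * g w' om) * cutdev k w' om)); last first.
    by move=> om; rewrite /a; ring.
  have sww : size w = size w' by rewrite !size_tuple.
  have nw : val w <> val w' by move=> /val_inj e; rewrite e eqxx in w'w.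
  have wo : [set val w] `<=` others w' by move=> u ->.
  rewrite (Ex_mul mZ indZ (S1 := others w') (S2 := [set val w'])) => //.
  - by rewrite Ex_cutdev mulr0.
  - apply: wrtM; last exact: wrt_g_other.
    apply: wrtM; last exact: (wrt_mono wo (@wrt_cutdev k w)).
    apply: wrt_g; exact: prefix_other (esym sww).
  - apply: (@L1_bounded _ _ _ P _ (expR (b k - cumul k) * (B k + 1) * expR (b k - cumul k))) => [|om].
      by apply: measurable_funM; [exact: m_term|exact: L1_measurable].
    rewrite normrM ler_pM ?term_ub// ger0_norm//.
    by have := g_ub w' om; rewrite size_tuple.
rewrite (@eq_Ex _ _ _ P _ (fun om => g w om ^+ 2 * cutdev k w om ^+ 2)); last first.
  by move=> om; rewrite /a; ring.
rewrite (Ex_mul mZ indZ (S1 := others w) (S2 := [set val w])) => //; last 2 first.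
  by apply: measurable_funX; exact: wrt_g_other.
  by apply: measurable_funX; exact: wrt_cutdev.
have -> : #|I|%:R * expR (b k + b k.+1 - cumul k) = expR (b k - cumul k) * B k.
  rewrite /B (_ : b k + b k.+1 - cumul k = (b k - cumul k) + b k.+1); last by ring.
  by rewrite expRD; ring.
rewrite mulrA ler_pM// ?Ex_ge0// => [om|om|]; [exact: sqr_ge0|exact: sqr_ge0|].
rewrite mulrC -ExZ//; apply: Ex_le => // [|om]; first exact: L1Z.
by rewrite expr2 ler_wpM2r.
Qed.

End truncated_cascade.

(** * Doob's inequality and almost sure convergence *)

Section maximal_convergence.
Context d (Omega : measurableType d) (R : realType) (P : probability Omega R).
Variable Y : nat -> Omega -> R.
Hypothesis L1Y : forall n, L1 P (Y n).

Definition oscillation n m (lambda : R) : set Omega :=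
  [set om | exists2 k, (n <= k <= m)%N & lambda <= `|Y k om - Y n om|].

Hypothesis maximal : forall n m (lambda : R), (n <= m)%N -> 0 < lambda ->
  (lambda%:E * P (oscillation n m lambda) <=
   (Ex P (fun om => `|Y m om - Y n om|))%:E)%E.
Hypothesis cauchyL1 : forall e : R, 0 < e -> exists N, forall n m,
  (N <= n)%N -> (N <= m)%N -> Ex P (fun om => `|Y n om - Y m om|) <= e.

Let mY n : measurable_fun setT (Y n). Proof. exact: L1_measurable. Qed.

Let far k n lambda : set Omega := [set om | lambda <= `|Y k om - Y n om|].

Let m_far k n lambda : measurable (far k n lambda).
Proof.
have mf : measurable_fun setT (fun om => lambda <= `|Y k om - Y n om|).
  apply: measurable_fun_ler; first exact: measurable_cst.
  by apply: measurableT_comp => //; exact: measurable_funB.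
by rewrite -[X in measurable X]setTI; exact: (mf measurableT [set true]).
Qed.

Lemma measurable_oscillation n m lambda : measurable (oscillation n m lambda).
Proof.
have -> : oscillation n m lambda = \bigcup_k
    (if (n <= k <= m)%N then far k n lambda else set0).
  apply/seteqP; split => om /=.
    by move=> [k nkm h]; exists k => //; rewrite nkm.
  by move=> [k _]; case: ifPn => // nkm h; exists k.
by apply: bigcupT_measurable => k; case: ifP.
Qed.

Let osc n lambda := \bigcup_m oscillation n m lambda.

(** The maximal inequality as [m] grows: the events increase to [osc n lambda], while the right-hand
    side stays below [e]. *)
Let P_osc n lambda (e : R) : 0 < lambda ->
  (forall m, (n <= m)%N -> Ex P (fun om => `|Y n om - Y m om|) <= e) ->
  (lambda%:E * P (osc n lambda) <= e%:E)%E.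
Proof.
move=> l0 He.
have e0 : 0 <= e by apply: le_trans (He n (leqnn n)); exact: Ex_ge0.
have cv : P \o (fun m => oscillation n m lambda) @ \oo --> P (osc n lambda).
  apply: nondecreasing_cvg_mu.
  - by move=> m; exact: measurable_oscillation.
  - by apply: bigcupT_measurable => m; exact: measurable_oscillation.
  - move=> m m' mm'; apply/subsetPset => om [k /andP[nk km] h].
    by exists k => //; rewrite nk (leq_trans km).
rewrite muleC -lee_pdivlMr//; apply: (cvge_to_le cv) => //.
exists n => // m /= nm; rewrite lee_pdivlMr// muleC.
apply: le_trans (maximal nm l0) _; rewrite lee_fin.
by apply: le_trans (He m nm); rewrite (eq_Ex _ (fun om => distrC (Y m om) (Y n om))).
Qed.

(** Off this set the sequence is Cauchy. It is a measurable event, not merely a subset of a null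
    set, so functions can be redefined on it. *)
Let bad := \bigcup_p \bigcap_n osc n p.+1%:R^-1.

Let m_bad : measurable bad.
Proof.
apply: bigcupT_measurable => p; apply: bigcapT_measurable => n.
by apply: bigcupT_measurable => m; exact: measurable_oscillation.
Qed.

Let P_bad : P bad = 0%E.
Proof.
apply: (measure_negligible m_bad); apply: negligible_bigcup => p.
set A := \bigcap_n _.
have mA : measurable A.
  by apply: bigcapT_measurable => n; apply: bigcupT_measurable => m;
    exact: measurable_oscillation.
have l0 : 0 < p.+1%:R^-1 :> R by rewrite invr_gt0.
exists A; split => //; apply/eqP; rewrite eq_le measure_ge0 andbT; apply/lee_addgt0Pr => e e0.
rewrite add0e.
have [N HN] := cauchyL1 (mulr_gt0 l0 e0).
have h := P_osc l0 (fun m (Nm : (N <= m)%N) => HN N m (leqnn N) Nm).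
have : (p.+1%:R^-1%:E * P A <= (p.+1%:R^-1 * e)%:E)%E.
  apply: le_trans h; rewrite lee_pmul2l//; apply: le_measure; rewrite ?inE//.
    by apply: bigcupT_measurable => m; exact: measurable_oscillation.
  by move=> om /(_ N I).
by rewrite EFinM lee_pmul2l.
Qed.

Let cvg_good om : ~ bad om -> cvgn (Y ^~ om).
Proof.
move=> nb; apply: cauchy_cvg; apply: cauchy_exP => e e0.
have [p pe] : exists p : nat, p.+1%:R^-1 < e.
  exists (Num.truncn e^-1); rewrite invf_plt ?posrE//; exact: truncnS_gt.
have [n hn] : exists n, ~ osc n p.+1%:R^-1 om.
  apply: contrapT => h; apply: nb; exists p => // n _.
  by apply: contrapT => h'; apply: h; exists n.
exists (Y n om); exists n => // k /= nk.
rewrite -ball_normE /ball_/= distrC; apply: le_lt_trans pe; rewrite leNgt; apply/negP => h.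
by apply: hn; exists k => //; exists k; [rewrite nk leqnn|exact: ltW].
Qed.

(** With the value 0 on [bad], this is the limit at every point of the measurable [Yg], hence
    measurable; [limn] alone has no meaning where the sequence diverges. *)
Definition limit_version om : R := if om \in bad then 0 else limn (Y ^~ om).

Let Yg n om := Y n om * \1_(~` bad) om.

Let cvg_Yg om : Yg ^~ om @ \oo --> limit_version om.
Proof.
rewrite /limit_version /Yg; case: ifPn => [|] ob.
  rewrite indicE in_setC ob /=.
  by under eq_fun do rewrite mulr0; exact: cvg_cst.
rewrite indicE in_setC ob /=.
under eq_fun do rewrite mulr1; apply: cvg_good.
by move: ob; rewrite notin_setE.
Qed.

Let m_Yg n : measurable_fun setT (Yg n).
Proof. by apply: measurable_funM => //; apply: measurable_indic; exact: measurableC. Qed.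

Lemma measurable_limit_version : measurable_fun setT limit_version.
Proof.
apply/measurable_EFinP; apply: (emeasurable_fun_cvg (fun n => EFin \o Yg n)) => [n|om _].
  exact/measurable_EFinP.
by apply: cvg_EFin; [exact: nearW|exact: cvg_Yg].
Qed.

Lemma ae_cvg_limit_version : {ae P, forall om, Y ^~ om @ \oo --> limit_version om}.
Proof.
exists bad; split => // om /= h; apply: contrapT => nb; apply: h.
rewrite /limit_version memNset//; exact: cvg_good.
Qed.

Let LYg n : L1 P (Yg n).
Proof. by apply: L1_mul_indic; [exact: measurableC|]. Qed.

(** Fatou in [m] carries the L^1 Cauchy bound over to the limit; the finite integral of the
    difference then makes the limit integrable. *)
Lemma limit_version_L1 n (e : R) :
  (forall m, (n <= m)%N -> Ex P (fun om => `|Y n om - Y m om|) <= e) ->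
  L1 P limit_version /\ Ex P (fun om => `|Y n om - limit_version om|) <= e.
Proof.
move=> He.
have mD m : measurable_fun setT (fun om => `|Yg n om - Yg m om|).
  by apply: measurableT_comp => //; exact: measurable_funB.
have mL : measurable_fun setT (fun om => `|Yg n om - limit_version om|).
  apply: measurableT_comp => //; apply: measurable_funB => //.
  exact: measurable_limit_version.
have b1 : (\int[P]_om `|Yg n om - limit_version om|%:E <= e%:E)%E.
  apply: (@le_trans _ _ (\int[P]_om limn_einf (fun m => `|Yg n om - Yg m om|%:E))%E).
    rewrite le_eqVlt; apply/orP; left; apply/eqP; apply: eq_integral => om _.
    have cv : (fun m => `|Yg n om - Yg m om|%:E) @ \oo -->
              `|Yg n om - limit_version om|%:E.
      apply: cvg_EFin; first exact: nearW.
      by apply: cvg_norm; apply: cvgB; [exact: cvg_cst|exact: cvg_Yg].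
    rewrite is_cvg_limn_einfE; last by apply/cvg_ex; eexists; exact: cv.
    exact/esym/cvg_lim.
  apply: le_trans (@fatou _ _ _ P setT measurableT (fun m om => `|Yg n om - Yg m om|%:E) _ _) _ => //.
    by move=> m; exact/measurable_EFinP.
  rewrite limn_einf_lim; apply: lime_le; first exact: is_cvg_einfs.
  exists n => // m /= nm; apply: ereal_inf_le; exists (\int[P]_om `|Yg n om - Yg m om|%:E)%E.
    by exists m => //=.
  rewrite ExE; last by apply: L1_norm; apply: L1B.
  rewrite lee_fin; apply: le_trans (He m nm); apply: Ex_le.
  - by apply: L1_norm; apply: L1B.
  - by apply: L1_norm; apply: L1B.
  move=> om; rewrite /Yg -mulrBl normrM ler_piMr// indicE ger0_norm//.
  by rewrite lern1 leq_b1.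
have ID : L1 P (fun om => Yg n om - limit_version om).
  apply/integrableP; split.
    apply/measurable_EFinP; apply: measurable_funB => //.
    exact: measurable_limit_version.
  by apply: le_lt_trans b1 _; rewrite ltry.
have IL : L1 P limit_version.
  apply: (eq_L1 _ (L1B (LYg n) ID)) => om; ring.
split => //; rewrite -lee_fin -ExE; last by apply: L1_norm; apply: L1B.
apply: le_trans b1; rewrite le_eqVlt; apply/orP; left; apply/eqP.
apply: ge0_ae_eq_integral => //.
- by apply/measurable_EFinP; apply: measurableT_comp => //; apply: measurable_funB => //;
    exact: measurable_limit_version.
- exact/measurable_EFinP.
- exists bad; split => // om /= h; apply: contrapT => nb; apply: h => _.
  by rewrite /Yg indicE mem_set// mulr1.
Qed.

End maximal_convergence.

(** * Doob's maximal inequality for the total mass martingale *)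

Section doob.
Context d (Omega : measurableType d) (R : realType) (P : probability Omega R).
Context (I : pointedFinType) (Z : seq I -> Omega -> weighted I R).
Hypothesis mZ : forall u, measurable_fun setT (Z u).
Hypothesis indZ : mutually_independent P Z.
Hypothesis L1W : forall u i, L1 P (fun om => wgt (Z u om) i).
Hypothesis mean1 : forall u, \sum_i Ex P (fun om => wgt (Z u om) i) = 1.

Let Y n om : R := Ysum (fun u => Z u om) n [::].

Notation sigma n := (<<s events_of Z (shorter n) >>).

Let L1Y n : L1 P (Y n). Proof. exact: L1_Ysum. Qed.

Let sigmaS n A : sigma n A -> sigma n.+1 A.
Proof. by apply: sigma_events_mono => u /= h; exact: ltnW. Qed.

Let m_sigma n A : sigma n A -> measurable A.
Proof. exact: sigma_events_measurable. Qed.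

Let wY j m : (j <= m)%N -> meas_wrt (events_of Z (shorter m)) (Y j).
Proof.
move=> jm; have sub : shorter (I := I) j `<=` shorter m.
  by move=> u uj; exact: leq_trans jm.
exact: (wrt_mono sub (@wrt_Ysum _ _ _ _ Z j)).
Qed.

Let sigma_dist n k m lambda : (n <= m)%N -> (k <= m)%N ->
  sigma m [set om | lambda <= `|Y k om - Y n om|].
Proof.
move=> nm km.
have mf : meas_wrt (events_of Z (shorter m)) (fun om => lambda <= `|Y k om - Y n om|).
  apply: measurable_fun_ler; first exact: measurable_cst.
  apply: measurableT_comp => //; apply: measurable_funB; exact: wY.
exact: (wrt_pre (B := [set true]) mf).
Qed.

Let sigmaU n A B : sigma n A -> sigma n B -> sigma n (A `|` B).
Proof. exact: (@measurableU _ (g_sigma_algebraType (events_of Z (shorter n)))). Qed.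

Let sigmaD n A B : sigma n A -> sigma n B -> sigma n (A `\` B).
Proof. exact: (@measurableD _ (g_sigma_algebraType (events_of Z (shorter n)))). Qed.

Let sigmaI n A B : sigma n A -> sigma n B -> sigma n (A `&` B).
Proof. exact: (@measurableI _ (g_sigma_algebraType (events_of Z (shorter n)))). Qed.

Let LA n k A : measurable A -> L1 P (fun om => (Y n om - Y k om) * \1_A om).
Proof. by move=> mA; apply: L1_mul_indic => //; exact: L1B. Qed.

(** Cutting [A] according to the sign of [Y k - Y n], an event known at level [k], removes the
    absolute value; the martingale property applies on each piece, and the absolute value is put
    back as an upper bound. *)
Let submartingale n k A : (n <= k)%N -> sigma k A ->
  Ex P (fun om => `|Y k om - Y n om| * \1_A om) <=
  Ex P (fun om => `|Y k.+1 om - Y n om| * \1_A om).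
Proof.
move=> nk sA.
pose B := [set om | 0 <= Y k om - Y n om].
have sB : sigma k B.
  have mf : meas_wrt (events_of Z (shorter k)) (fun om => 0 <= Y k om - Y n om).
    apply: measurable_fun_ler; first exact: measurable_cst.
    by apply: measurable_funB; exact: wY.
  exact: (wrt_pre (B := [set true]) mf).
have step C : sigma k C -> Ex P (fun om => (Y k om - Y n om) * \1_C om) =
    Ex P (fun om => (Y k.+1 om - Y n om) * \1_C om).
  move=> sC; have mC := m_sigma sC.
  rewrite (@eq_Ex _ _ _ P _ (fun om => Y k om * \1_C om - Y n om * \1_C om)); last first.
    by move=> om; rewrite mulrBl.
  rewrite [RHS](@eq_Ex _ _ _ P _ (fun om => Y k.+1 om * \1_C om - Y n om * \1_C om));
    last by move=> om; rewrite mulrBl.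
  by rewrite !ExB ?(Ysum_martingale mZ indZ L1W mean1 sC)//; exact: L1_mul_indic.
have sAB := sigmaI sA sB; have sAD := sigmaD sA sB.
have split om : \1_A om = \1_(A `&` B) om + \1_(A `\` B) om :> R.
  rewrite !indicE in_setI in_setD; case: (om \in A); case: (om \in B) => //=.
  - by rewrite addr0.
  - by rewrite add0r.
  - by rewrite addr0.
  - by rewrite addr0.
rewrite (@eq_Ex _ _ _ P _ (fun om => (Y k om - Y n om) * \1_(A `&` B) om -
    (Y k om - Y n om) * \1_(A `\` B) om)); last first.
  move=> om; rewrite split !indicE in_setI in_setD.
  have [oB|oB] := boolP (om \in B).
    have h : 0 <= Y k om - Y n om by move: oB; rewrite inE.
    by rewrite ger0_norm// andbF addr0 mulr0 subr0.
  have h : Y k om - Y n om < 0.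
    by rewrite ltNge; apply/negP => h; move/negP: oB; apply; rewrite inE.
  by rewrite ltr0_norm// andbF add0r mulr0 sub0r mulNr.
rewrite ExB; [|exact: LA (m_sigma sAB)|exact: LA (m_sigma sAD)].
rewrite (step _ sAB) (step _ sAD).
rewrite -ExB; [|exact: LA (m_sigma sAB)|exact: LA (m_sigma sAD)].
apply: Ex_le => [||om].
- by apply: L1B; [exact: LA (m_sigma sAB)|exact: LA (m_sigma sAD)].
- by apply: L1_mul_indic; [exact: m_sigma sA|apply: L1_norm; exact: L1B].
rewrite split mulrDr; apply: lerD; first by rewrite ler_wpM2r// ler_norm.
by rewrite -mulNr ler_wpM2r// -normrN ler_norm.
Qed.

(** Induction on [m]. On the old event [O] the submartingale property raises the bound to level
    [m.+1]; the new part [F] minus [O] is where the threshold is first reached at [m.+1], and there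
    the distance is at least [lambda] by definition. *)
Lemma Ysum_maximal n m lambda : (n <= m)%N -> 0 < lambda ->
  (lambda%:E * P (oscillation Y n m lambda) <=
   (Ex P (fun om => `|Y m om - Y n om|))%:E)%E.
Proof.
move=> nm l0.
have mO := measurable_oscillation L1Y.
(* The induction needs the stronger form localized on the oscillation event, together with the fact
   that this event is known at level [m]. *)
suff [sO H] : sigma m (oscillation Y n m lambda) /\
    lambda * Ex P \1_(oscillation Y n m lambda) <=
    Ex P (fun om => `|Y m om - Y n om| * \1_(oscillation Y n m lambda) om).
  have -> : P (oscillation Y n m lambda) = (Ex P \1_(oscillation Y n m lambda))%:E.
    by rewrite Ex_indic// fineK// fin_num_measure.
  rewrite -EFinM lee_fin (le_trans H)//; apply: Ex_le.
  - by apply: L1_mul_indic => //; apply: L1_norm; exact: L1B.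
  - by apply: L1_norm; exact: L1B.
  - by move=> om; rewrite ler_piMr// indicE lern1 leq_b1.
have far0 om : `|Y n om - Y n om| = 0 by rewrite subrr normr0.
elim: m nm => [|m ih] nm.
  move: nm; rewrite leqn0 => /eqP n0.
  have -> : oscillation Y n 0 lambda = set0.
    apply/seteqP; split => // om [k]; rewrite n0 leqn0 => /eqP -> /=.
    by rewrite subrr normr0 leNgt l0.
  split; first exact: (@measurable0 _ (g_sigma_algebraType (events_of Z (shorter 0)))).
  rewrite indic0 (_ : Ex P (cst 0) = 0); last exact: Ex_cst.
  by rewrite mulr0; apply: Ex_ge0 => om; rewrite mulr0.
move: nm; rewrite leq_eqVlt => /predU1P[nm|nm].
  have -> : oscillation Y n m.+1 lambda = set0.
    apply/seteqP; split => // om [k]; rewrite nm -eqn_leq => /eqP <- /=.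
    by rewrite subrr normr0 leNgt l0.
  split; first exact: (@measurable0 _ (g_sigma_algebraType (events_of Z (shorter m.+1)))).
  rewrite indic0 (_ : Ex P (cst 0) = 0); last exact: Ex_cst.
  by rewrite mulr0; apply: Ex_ge0 => om; rewrite mulr0.
have {ih}[sO H] := ih nm.
set O := oscillation Y n m lambda in sO H *.
set F := [set om | lambda <= `|Y m.+1 om - Y n om|].
have sF : sigma m.+1 F by apply: sigma_dist => //; exact: leqW.
have sO' := sigmaS sO.
have sFO := sigmaD sF sO'.
have OE : oscillation Y n m.+1 lambda = O `|` (F `\` O).
  rewrite setDE setUIr setUv setIT; apply/seteqP; split => om /=.
    move=> [k /andP[nk]]; rewrite leq_eqVlt => /predU1P[->|km] h; first by right.
    by left; exists k => //; rewrite nk.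
  move=> [[k /andP[nk km] h]|h].
    by exists k => //; rewrite nk leqW.
  by exists m.+1 => //; rewrite leqnn leqW.
split; first by rewrite OE; exact: sigmaU.
have ind om : \1_(oscillation Y n m.+1 lambda) om = \1_O om + \1_(F `\` O) om :> R.
  rewrite OE !indicE in_setU in_setD; case: (om \in O); case: (om \in F) => //=;
  by rewrite ?addr0 ?add0r.
have mOO : measurable O by exact: m_sigma sO.
have mFO := m_sigma sFO.
rewrite (eq_Ex _ ind) ExD; [|exact: L1_indic|exact: L1_indic].
rewrite [leRHS](@eq_Ex _ _ _ P _ (fun om => `|Y m.+1 om - Y n om| * \1_O om +
   `|Y m.+1 om - Y n om| * \1_(F `\` O) om)); last by move=> om; rewrite ind mulrDr.
have LN A : measurable A -> L1 P (fun om => `|Y m.+1 om - Y n om| * \1_A om).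
  by move=> mA; apply: L1_mul_indic => //; apply: L1_norm; exact: L1B.
rewrite ExD; [|exact: LN|exact: LN].
rewrite mulrDr lerD//.
  by apply: le_trans H _; apply: submartingale.
rewrite -ExZ; last exact: L1_indic.
apply: Ex_le => [||om]; [by apply: L1Z; exact: L1_indic|exact: LN|].
rewrite indicE in_setD; case: (boolP (om \in F)) => oF; last by rewrite /= !mulr0.
by rewrite ler_wpM2r//; move: oF; rewrite inE.
Qed.

End doob.

(** * Uniform estimates on subtrees *)

Lemma geometric_partial_sum (R : realFieldType) (rho : R) n m : 0 <= rho -> rho < 1 ->
  \sum_(n <= k < m) rho ^+ k <= rho ^+ n / (1 - rho).
Proof.
move=> r0 r1; have d0 : 0 < 1 - rho by rewrite subr_gt0.
have [nm|/ltnW mn] := leqP n m; last first.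
  by rewrite big_geq// mulr_ge0 ?exprn_ge0// invr_ge0 ltW.
have tel : (1 - rho) * \sum_(n <= k < m) rho ^+ k = rho ^+ n - rho ^+ m.
  have := telescope_sumr (fun k => - rho ^+ k) nm.
  rewrite opprK addrC => <-; rewrite mulr_sumr.
  by apply: eq_bigr => k _; rewrite exprS; ring.
by rewrite ler_pdivlMr// mulrC tel gerBl exprn_ge0.
Qed.

Lemma mutually_independent_shift d (Omega : measurableType d) (R : realType)
    (P : probability Omega R) (A : choiceType) d' (T : measurableType d')
    (X : seq A -> Omega -> T) v :
  mutually_independent P X -> mutually_independent P (fun u => X (v ++ u)).
Proof.
move=> ind s B us mB.
have inj : injective (fun u : seq A => v ++ u).
  by move=> u1 u2 /eqP; rewrite eqseq_cat// eqxx => /eqP.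
pose B' w := B (drop (size v) w).
have B'E u : B' (v ++ u) = B u by rewrite /B' drop_size_cat.
have := ind (map (fun u => v ++ u) s) B'; rewrite map_inj_uniq//.
move=> /(_ us) h; rewrite [RHS](_ : _ = \prod_(u <- map (fun u => v ++ u) s)
   P (X u @^-1` B' u))%E; last by rewrite big_map; apply: eq_bigr => u _; rewrite B'E.
rewrite -h => [|_ /mapP[u us' ->]]; last by rewrite B'E; exact: mB.
congr (P _); apply/seteqP; split => om H.
  by move=> _ /= /mapP[u us' ->]; rewrite B'E; exact: H.
by move=> u /= us'; rewrite -B'E; apply: (H (v ++ u)); exact: map_f.
Qed.

Section environment.
Context d (Omega : measurableType d) (R : realType) (P : probability Omega R).
Context (I : pointedFinType) (V : seq I -> Omega -> weighted I R).
Hypothesis mV : forall u, measurable_fun setT (V u).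
Hypothesis indV : mutually_independent P V.
Hypothesis V0 : forall u om i, 0 <= wgt (V u om) i.
Variables (h tau : nat -> R).
Implicit Types (u v w : seq I) (i : I) (om : Omega).

Let W u i om : R := wgt (V u om) i.
Let Y v n om : R := Ysum (fun u => V u om) n v.

Hypothesis L1W : forall u i, L1 P (W u i).
Hypothesis L1W1 : forall u i, L1 P (fun om => W u i om * ln (W u i om)).
Hypothesis L1W2 : forall u i, L1 P (fun om => W u i om * ln (W u i om) ^+ 2).
Hypothesis mean1 : forall u, \sum_i Ex P (W u i) = 1.
Hypothesis meanh : forall u,
  \sum_i Ex P (fun om => W u i om * ln (W u i om)) = - h (size u).
Hypothesis meantau : forall u,
  \sum_i Ex P (fun om => W u i om * ln (W u i om) ^+ 2) = tau (size u).

Hypothesis tau_tail : forall e : R, 0 < e -> exists J, forall n m, (J <= n)%N ->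
  \sum_(n <= j < m) tau j / j.+1%:R ^+ 2 <= e.
Variables (c C0 lm : R).
Hypothesis c0 : 0 < c.
Hypothesis entropy_lb : forall k, 3 * c * k%:R - C0 <= \sum_(j < k) h j.
Hypothesis entropy_ub : forall j, h j <= lm.

Let tau_nneg k : 0 <= tau k.
Proof.
rewrite -(size_nseq k (point : I)) -meantau; apply: sumr_ge0 => i _.
by apply: Ex_ge0 => om; rewrite mulr_ge0 ?sqr_ge0// V0.
Qed.

Section subtree.
Variable v : seq I.
Variable A : R.
Let l := size v.
Hypothesis bl : 0 < A + c * l%:R.
Let Z u := V (v ++ u).
Let hl k := h (l + k)%N.
Let taul k := tau (l + k)%N.
(** With entropy slope [3 c], the exponent [b k + b k.+1 - cumul] in the variance behaves like
    [2 c k - 3 c k], which leaves the decay [- c k]. *)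
Let b k : R := A + c * (l + k)%:R.

Let b0 k : 0 < b k.
Proof.
by rewrite (lt_le_trans bl)// /b lerD2l ler_wpM2l ?(ltW c0)// ler_nat leq_addr.
Qed.

Let bS k : b k <= b k.+1.
Proof. by rewrite /b lerD2l ler_wpM2l ?(ltW c0)// ler_nat addnS. Qed.

Definition increment : nat -> Omega -> R := incr P Z hl b.

Let YE n om : Y v n om = Ysum (fun u => Z u om) n [::].
Proof. exact: Ysum_shift. Qed.

Let mZ u : measurable_fun setT (Z u). Proof. exact: mV. Qed.
Let indZ : mutually_independent P Z. Proof. exact: mutually_independent_shift. Qed.
Let Z0 u om i : 0 <= wgt (Z u om) i. Proof. exact: V0. Qed.
Let meanhl u : \sum_i Ex P (fun om => wgt (Z u om) i * ln (wgt (Z u om) i)) = - hl (size u).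
Proof. by rewrite meanh size_cat. Qed.
Let meantaul u :
  \sum_i Ex P (fun om => wgt (Z u om) i * ln (wgt (Z u om) i) ^+ 2) = taul (size u).
Proof. by rewrite meantau size_cat. Qed.

Lemma L1_Ysum_at n : L1 P (Y v n).
Proof.
apply: (eq_L1 (fun om => esym (YE n om))).
exact: (L1_Ysum mZ indZ (fun u i => L1W (v ++ u) i)).
Qed.

Lemma Ex_Ysum_at n : Ex P (Y v n) = 1.
Proof.
rewrite (eq_Ex P (YE n)).
exact: (Ex_Ysum mZ indZ (fun u i => L1W (v ++ u) i) (fun u => mean1 (v ++ u))).
Qed.

Lemma L1_increment k : L1 P (increment k).
Proof. exact: (L1_incr mZ indZ Z0 hl (fun u i => L1W (v ++ u) i) b0). Qed.

Lemma L1_increment2 k : L1 P (fun om => increment k om ^+ 2).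
Proof.
exact: (L1_incr2 mZ indZ Z0 hl (fun u i => L1W (v ++ u) i)
  (fun u => mean1 (v ++ u)) b0).
Qed.

Lemma Ysum_approx_at n :
  Ex P (fun om => `|Y v n om - (1 + \sum_(k < n) increment k om)|) <=
  4 * \sum_(l <= j < l + n) tau j / (A + c * j.+1%:R) ^+ 2.
Proof.
have := Ysum_approx mZ indZ Z0 (fun u i => L1W (v ++ u) i)
  (fun u i => L1W1 (v ++ u) i) (fun u i => L1W2 (v ++ u) i)
  (fun u => mean1 (v ++ u)) meanhl meantaul b0 bS n.
have -> : \sum_(k < n) taul k / b k.+1 ^+ 2 =
    \sum_(l <= j < l + n) tau j / (A + c * j.+1%:R) ^+ 2.
  rewrite -{1}[l]add0n [(l + n)%N]addnC big_addn addnK big_mkord.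
  by apply: eq_bigr => k _; rewrite /taul /b addnS addnC.
by under eq_Ex do rewrite -YE.
Qed.

(** The entropy available below [v] is the total up to generation [l + k] minus that of the first
    [l] generations. The latter may be as large as [l * lm], which is the price of starting at
    generation [l]. *)
Lemma Ex_increment2 k : Ex P (fun om => increment k om ^+ 2) <=
  #|I|%:R * expR (2 * A + c + C0 + l%:R * lm) * expR (- (c * (l + k)%:R)).
Proof.
apply: le_trans (Ex_incr2 mZ indZ Z0 hl (fun u i => L1W (v ++ u) i)
  (fun u => mean1 (v ++ u)) b0 k) _.
rewrite -mulrA ler_wpM2l// -expRD ler_expR.
have e1 : cumul hl k = \sum_(j < l + k) h j - \sum_(j < l) h j.
  by rewrite big_split_ord /= [X in X - _]addrC addrK.
have e2 : \sum_(j < l) h j <= l%:R * lm.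
  rewrite mulr_natl -[leRHS](_ : \sum_(j < l) lm = _); last first.
    by rewrite sumr_const card_ord.
  by apply: ler_sum => j _; exact: entropy_ub.
have := entropy_lb (l + k); rewrite e1 /b addnS -natr1; lra.
Qed.

End subtree.

(** The half rate: the variance of the [k]-th increment decays like [rho ^+ k] squared. *)
Let rho : R := expR (- (c / 2)).
Let rho0 : 0 <= rho. Proof. exact: expR_ge0. Qed.
Let rho1 : rho < 1.
Proof. by rewrite /rho -expR0 ltr_expR oppr_lt0 divr_gt0. Qed.
Let rhoX k : rho ^+ k = expR (- (c * k%:R / 2)).
Proof. by rewrite /rho -expRM_natr; congr expR; field. Qed.

(** For a fixed tube the approximation error is merely bounded. A large [A] makes it small uniformly
    in the level, after which only the geometrically small increments separate two levels. *)
Lemma Ysum_L1_cauchy v (e : R) : 0 < e -> exists N, forall n m,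
  (N <= n)%N -> (N <= m)%N -> Ex P (fun om => `|Y v n om - Y v m om|) <= e.
Proof.
move=> e0; set l := size v.
(* Budget: [4 * (e / 32)] for each of the two approximations and [e / 2] for the increments. Of
   [e / 32], one half covers the generations from [J] on, where the denominators are at least
   [(c (j + 1)) ^ 2]. *)
have ce : 0 < c ^+ 2 / 64 * e by rewrite mulr_gt0// divr_gt0 ?exprn_gt0.
have [J HJ] := tau_tail ce.
pose T := \sum_(j < J) tau j.
have T0 : 0 <= T by apply: sumr_ge0.
(* The other half covers the first [J] generations: the denominators are at least [A ^+ 2 >= A], and
   [T / A <= e / 64]. *)
pose A := 1 + 64 * T / e.
have A1 : 1 <= A by rewrite lerDl divr_ge0 ?(ltW e0)// mulr_ge0.
have A0 : 0 <= A by rewrite (le_trans _ A1).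
have bl : 0 < A + c * l%:R.
  by rewrite ltr_pwDl ?(lt_le_trans _ A1)// mulr_ge0 ?(ltW c0).
have Ac j : 0 < A + c * j.+1%:R.
  by rewrite ltr_pwDl ?(lt_le_trans _ A1)// mulr_ge0 ?(ltW c0).
have small n m : \sum_(n <= j < m) tau j / (A + c * j.+1%:R) ^+ 2 <= e / 32.
  apply: (@le_trans _ _ (\sum_(0 <= j < maxn J m) tau j / (A + c * j.+1%:R) ^+ 2)).
    have [nm|mn] := leqP n m; last first.
      rewrite big_geq ?(ltnW mn)//; apply: sumr_ge0 => j _.
      by rewrite divr_ge0// sqr_ge0.
    have nJ : (n <= maxn J m)%N by rewrite (leq_trans nm) ?leq_maxr.
    rewrite [leRHS](big_cat_nat (leq0n n) nJ) /=.
    rewrite [X in _ <= _ + X](big_cat_nat nm (leq_maxr J m)) /=.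
    rewrite addrCA lerDl addr_ge0//; apply: sumr_ge0 => j _;
    by rewrite divr_ge0// sqr_ge0.
  rewrite (big_cat_nat (n := J)) ?leq_maxl//=.
  have -> : e / 32 = e / 64 + e / 64 by field.
  apply: lerD.
    apply: (@le_trans _ _ (\sum_(0 <= j < J) tau j / A)).
      apply: ler_sum => j _; rewrite ler_wpM2l// lef_pV2 ?posrE ?exprn_gt0//; last first.
        exact: lt_le_trans A1.
      have : A <= A + c * j.+1%:R by rewrite lerDl mulr_ge0 ?(ltW c0).
      move: (A + _) => B AB; nra.
    rewrite -mulr_suml big_mkord -/T ler_pdivrMr ?(lt_le_trans _ A1)//.
    rewrite /A mulrDr mulr1 (_ : e / 64 * (64 * T / e) = T); last by field; rewrite gt_eqF.
    by rewrite lerDr divr_ge0// ltW.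
  apply: (@le_trans _ _ (\sum_(J <= j < maxn J m) (tau j / j.+1%:R ^+ 2) / c ^+ 2)).
    apply: ler_sum => j _; rewrite -mulrA -invfM ler_wpM2l// lef_pV2 ?posrE ?exprn_gt0 ?mulr_gt0 ?exprn_gt0//.
    rewrite -exprMn lerXn2r ?nnegrE ?mulr_ge0 ?(ltW c0)// ?(ltW (Ac j))//.
    by rewrite mulrC lerDr.
  rewrite -mulr_suml ler_pdivrMr ?exprn_gt0//.
  by apply: le_trans (HJ J _ (leqnn J)) _; rewrite le_eqVlt; apply/orP; left; apply/eqP; field.
(* [K] grows with [A], hence as [e] decreases, but it is fixed before [N] is chosen. *)
pose K := #|I|%:R * expR (2 * A + c + C0 + l%:R * lm).
have K0 : 0 <= K by rewrite mulr_ge0// expR_ge0.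
pose D := increment v A.
have LD k : L1 P (D k) by exact: L1_increment.
have ED k : Ex P (fun om => `|D k om|) <= (1 + K) * rho ^+ k.
  (* The inequality [x <= r + x ^+ 2 / r] with [r = rho ^+ k] takes the place of Cauchy-Schwarz. *)
  apply: (@le_trans _ _ (Ex P (fun om => rho ^+ k + (rho ^+ k)^-1 * D k om ^+ 2))).
    have rk : 0 < rho ^+ k by rewrite exprn_gt0// expR_gt0.
    apply: Ex_le => [||om].
    - exact: L1_norm.
    - apply: L1D; first exact: L1_cst.
      by apply: L1Z; exact: L1_increment2.
    rewrite -real_normK ?num_real// -subr_ge0.
    move: (normr_ge0 (D k om)); move: (`|D k om|) (rho ^+ k) rk => x r r0 x0.
    rewrite -(pmulr_rge0 _ r0) mulrBr mulrDr mulrA mulfV ?gt_eqF// mul1r; nra.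
  rewrite ExD; [|exact: L1_cst|by apply: L1Z; exact: L1_increment2].
  rewrite Ex_cst mulrDl mul1r lerD2l ExZ; last exact: L1_increment2.
  rewrite ler_pdivrMl; last by rewrite exprn_gt0// expR_gt0.
  apply: le_trans (Ex_increment2 bl k) _; rewrite -/l -/K mulrCA ler_wpM2l//.
  rewrite rhoX -expRD ler_expR natrD.
  have : 0 <= c * l%:R by rewrite mulr_ge0 ?(ltW c0).
  lra.
pose G := (1 + K) / (1 - rho).
have G0 : 0 <= G by apply: divr_ge0; [rewrite addr_ge0|rewrite subr_ge0 ltW].
have [N HN] : exists N, forall n, (N <= n)%N -> G * rho ^+ n <= e / 2.
  have : (fun n => G * rho ^+ n) @ \oo --> (0 : R).
    by apply: cvg_geometric; rewrite ger0_norm.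
  move/cvgrPdist_le => /(_ (e / 2)); rewrite divr_gt0// => /(_ isT)[N _ HN].
  exists N => n Nn; have := HN n Nn; rewrite /= sub0r normrN ger0_norm//.
  by rewrite mulr_ge0// exprn_ge0.
exists N; suff H n m : (N <= n)%N -> (n <= m)%N ->
    Ex P (fun om => `|Y v n om - Y v m om|) <= e.
  move=> n m Nn Nm; have [nm|/ltnW mn] := leqP n m; first exact: H.
  by rewrite (eq_Ex _ (fun om => distrC (Y v n om) (Y v m om))); exact: H.
move=> Nn nm.
pose M k om := 1 + \sum_(j < k) D j om.
have LM k : L1 P (M k).
  by apply: L1D; [exact: L1_cst|apply: L1_sum => j _; exact: LD].
have LYM k : L1 P (fun om => `|Y v k om - M k om|).
  by apply: L1_norm; apply: L1B => //; exact: L1_Ysum_at.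
have LS : L1 P (fun om => \sum_(n <= j < m) `|D j om|).
  by apply: L1_sum => j _; exact: L1_norm.
apply: (@le_trans _ _ (Ex P (fun om => (`|Y v n om - M n om| + `|Y v m om - M m om|)
    + \sum_(n <= j < m) `|D j om|))).
  apply: Ex_le => [||om].
  - by apply: L1_norm; apply: L1B; exact: L1_Ysum_at.
  - by apply: L1D => //; apply: L1D.
  have -> : Y v n om - Y v m om = (Y v n om - M n om) - (Y v m om - M m om) -
      \sum_(n <= j < m) D j om.
    have -> : M m om = M n om + \sum_(n <= j < m) D j om.
      by rewrite /M -!(big_mkord xpredT (fun j => D j om)) (big_cat_nat (n := n)) //= addrA.
    ring.
  rewrite (le_trans (ler_normB _ _))// lerD ?ler_norm_sum//.
  exact: ler_normB.
rewrite ExD ?ExD//; last exact: L1D.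
have eY k : Ex P (fun om => `|Y v k om - M k om|) <= e / 8.
  apply: le_trans (Ysum_approx_at bl k) _.
  by have := small l (l + k)%N; lra.
have eS : Ex P (fun om => \sum_(n <= j < m) `|D j om|) <= e / 2.
  rewrite Ex_sum => [|j _]; last exact: L1_norm.
  apply: (@le_trans _ _ (\sum_(n <= j < m) (1 + K) * rho ^+ j)).
    by apply: ler_sum => j _; exact: ED.
  apply: le_trans (HN n Nn); rewrite -mulr_sumr /G -mulrA ler_wpM2l ?addr_ge0//.
  by rewrite mulrC; exact: geometric_partial_sum.
have := eY n; have := eY m; lra.
Qed.

(** An event of tiny probability cannot carry more than about half of the mass, and at generation
    [l] tiny means small compared with [expR (lm - c) ^- l]. Applied to the event that [Y(v)] does
    not vanish, this bounds its probability from below. *)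
Lemma Ysum_mass_event : exists l0 : nat, exists2 M : R, 0 <= M &
  forall v n (E : set Omega), (l0 <= size v)%N -> measurable E ->
  Ex P (fun om => Y v n om * \1_E om) <=
  1 / 2 + fine (P E) * (1 + M * expR (lm - c) ^+ size v).
Proof.
(* With [A = 0] the approximation error is [4 / c ^+ 2] times a tail of the series, hence at most
   [1 / 4]. *)
have ce : 0 < c ^+ 2 / 16 by rewrite divr_gt0 ?exprn_gt0.
have [J HJ] := tau_tail ce.
pose G := (1 - rho)^-1.
have G0 : 0 < G by rewrite invr_gt0 subr_gt0.
pose C1 := #|I|%:R * expR (c + C0).
have C10 : 0 <= C1 by rewrite mulr_ge0// expR_ge0.
(* Chosen so that [C1 / M * G <= 1 / 4]; with the approximation error this makes up the [1 / 2]. *)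
pose M := 1 + 4 * (C1 * G).
have M1 : 1 <= M by rewrite lerDl mulr_ge0// mulr_ge0// ltW.
have M0 : 0 < M by exact: lt_le_trans M1.
(* The 1 keeps the tube [c * l] of positive width when [A = 0]; [J] puts the whole subtree in the
   tail of the series. *)
exists (maxn 1 J), (M * G) => [|v n E lv mE]; first by rewrite mulr_ge0// ltW.
set l := size v in lv *.
have lJ : (J <= l)%N by rewrite (leq_trans _ lv)// leq_maxr.
have l1 : (0 < l)%N by rewrite (leq_trans _ lv)// leq_maxl.
have bl : 0 < 0 + c * l%:R by rewrite add0r mulr_gt0// ltr0n.
set Th := expR (lm - c) ^+ l.
have Th0 : 0 < Th by rewrite exprn_gt0// expR_gt0.
have ThE : Th = expR (l%:R * lm - c * l%:R).
  by rewrite /Th -expRM_natr; congr expR; ring.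
pose D := increment v 0.
have LD k : L1 P (D k) by exact: (L1_increment bl).
have LD2 k : L1 P (fun om => D k om ^+ 2) by exact: (L1_increment2 bl).
pose p := fine (P E).
have p0 : 0 <= p by rewrite fine_ge0.
have ED2 k : Ex P (fun om => D k om ^+ 2) <= C1 * Th * rho ^+ k * rho ^+ k.
  apply: le_trans (Ex_increment2 bl k) _; rewrite -/l le_eqVlt; apply/orP; left.
  apply/eqP; rewrite /C1 ThE rhoX -!mulrA -!expRD; congr (_ * expR _).
  by rewrite natrD; field.
have ED k : Ex P (fun om => `|D k om| * \1_E om) <=
    (M * Th * p + C1 / M) * rho ^+ k.
  have rk : 0 < rho ^+ k by rewrite exprn_gt0// expR_gt0.
  (* In [x 1_E <= la 1_E + x ^+ 2 / la] the factor [Th] of [la] cancels the one in the variance, so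
     only the term multiplied by [P E] grows with the generation. *)
  pose la := M * Th * rho ^+ k.
  have la0 : 0 < la by rewrite !mulr_gt0.
  apply: (@le_trans _ _ (Ex P (fun om => la * \1_E om + la^-1 * D k om ^+ 2))).
    apply: Ex_le => [||om].
    - by apply: L1_mul_indic => //; exact: L1_norm.
    - by apply: L1D; apply: L1Z => //; exact: L1_indic.
    rewrite -real_normK ?num_real// -subr_ge0.
    move: (normr_ge0 (D k om)); move: (`|D k om|) => x x0.
    have i01 : \1_E om = 0 :> R \/ \1_E om = 1 :> R.
      by rewrite indicE; case: (_ \in _); [right|left].
    rewrite -(pmulr_rge0 _ la0) mulrBr mulrDr [la * (la^-1 * _)]mulrA mulfV ?gt_eqF// mul1r.
    by case: i01 => ->; nra.
  rewrite ExD; [|by apply: L1Z; exact: L1_indic|exact: L1Z].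
  rewrite !ExZ//; last exact: L1_indic.
  rewrite Ex_indic// -/p mulrDl lerD//; first by rewrite /la; nra.
  rewrite ler_pdivrMl// (le_trans (ED2 k))// /la le_eqVlt; apply/orP; left; apply/eqP.
  by field; rewrite gt_eqF.
have LY := L1_Ysum_at v n.
have LM : L1 P (fun om => 1 + \sum_(j < n) D j om).
  by apply: L1D; [exact: L1_cst|apply: L1_sum].
have LYM : L1 P (fun om => `|Y v n om - (1 + \sum_(j < n) D j om)|).
  by apply: L1_norm; apply: L1B.
have LDE : L1 P (fun om => \sum_(j < n) `|D j om| * \1_E om).
  by apply: L1_sum => j _; apply: L1_mul_indic => //; exact: L1_norm.
apply: (@le_trans _ _ (Ex P (fun om => `|Y v n om - (1 + \sum_(j < n) D j om)| +
   (\1_E om + \sum_(j < n) `|D j om| * \1_E om)))).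
  apply: Ex_le => [||om].
  - exact: L1_mul_indic.
  - by apply: L1D => //; apply: L1D => //; exact: L1_indic.
  rewrite indicE; case: (om \in E) => /=; last first.
    rewrite mulr0 add0r addr_ge0//; apply: sumr_ge0 => j _; rewrite mulr0//.
  under [X in _ <= _ + (_ + X)]eq_bigr do rewrite mulr1.
  rewrite mulr1 -{1}[Y v n om](subrK (1 + \sum_(j < n) D j om)) lerD ?ler_norm//.
  by rewrite lerD2l; apply: ler_sum => j _; exact: ler_norm.
rewrite ExD//; last by apply: L1D => //; exact: L1_indic.
rewrite ExD//; last exact: L1_indic.
have a1 : Ex P (fun om => `|Y v n om - (1 + \sum_(j < n) D j om)|) <= 1 / 4.
  apply: le_trans (Ysum_approx_at bl n) _; rewrite -/l.
  have -> : \sum_(l <= j < l + n) tau j / (0 + c * j.+1%:R) ^+ 2 =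
    (\sum_(l <= j < l + n) tau j / j.+1%:R ^+ 2) / c ^+ 2.
    rewrite mulr_suml; apply: eq_bigr => j _; rewrite add0r exprMn invfM; ring.
  have : (\sum_(l <= j < l + n) tau j / j.+1%:R ^+ 2) / c ^+ 2 <= 1 / 16.
    rewrite ler_pdivrMr ?exprn_gt0//; apply: le_trans (HJ l _ lJ) _; lra.
  lra.
have a2 : Ex P (fun om => \sum_(j < n) `|D j om| * \1_E om) <=
    (M * Th * p + C1 / M) * G.
  rewrite Ex_sum => [|j _]; last by apply: L1_mul_indic => //; exact: L1_norm.
  apply: (@le_trans _ _ (\sum_(j < n) (M * Th * p + C1 / M) * rho ^+ j)).
    by apply: ler_sum => j _; exact: ED.
  rewrite -mulr_sumr ler_wpM2l//.
    by rewrite addr_ge0 ?divr_ge0 ?(ltW M0)// !mulr_ge0 ?(ltW M0) ?(ltW Th0).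
  rewrite -(big_mkord xpredT (fun j => rho ^+ j)).
  by apply: le_trans (geometric_partial_sum _ _ _ _) _ => //; rewrite expr0 div1r.
have a3 : C1 / M * G <= 1 / 4.
  by rewrite mulrAC ler_pdivrMr// /M; move: (C1 * G) => x; lra.
rewrite Ex_indic// -/p.
move: a1 a2 a3; rewrite mulrDl.
rewrite (_ : M * Th * p * G = p * (M * G * Th)); last by ring.
lra.
Qed.

End environment.

(** * Limit mass of a subtree and the event that it vanishes *)

Section limit_mass.
Context d (Omega : measurableType d) (R : realType) (P : probability Omega R).
Context (I : pointedFinType) (V : seq I -> Omega -> weighted I R).
Hypothesis mV : forall u, measurable_fun setT (V u).
Hypothesis indV : mutually_independent P V.
Hypothesis V0 : forall u om i, 0 <= wgt (V u om) i.
Implicit Types (u v w : seq I) (i : I) (om : Omega).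

Let W u i om : R := wgt (V u om) i.
Let Y v n om : R := Ysum (fun u => V u om) n v.

Hypothesis L1W : forall u i, L1 P (W u i).
Hypothesis mean1 : forall u, \sum_i Ex P (W u i) = 1.
Hypothesis cauchyY : forall v (e : R), 0 < e -> exists N, forall n m,
  (N <= n)%N -> (N <= m)%N -> Ex P (fun om => `|Y v n om - Y v m om|) <= e.

Let L1Y v n : L1 P (Y v n). Proof. exact: L1_Ysum_at. Qed.

Let Y0 v n om : 0 <= Y v n om.
Proof. by apply: Ysum_ge0 => *; exact: V0. Qed.

Lemma Ysum_maximal_at v n m (lambda : R) : (n <= m)%N -> 0 < lambda ->
  (lambda%:E * P (oscillation (Y v) n m lambda) <=
   (Ex P (fun om => `|Y v m om - Y v n om|))%:E)%E.
Proof.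
have -> : Y v = fun n om => Ysum (fun u => V (v ++ u) om) n [::].
  by apply/funext => k; apply/funext => om; exact: Ysum_shift.
apply: Ysum_maximal => [u|//|u i|u]; [exact: mV| |exact: L1W|exact: mean1].
exact: mutually_independent_shift.
Qed.

Definition Ylimit v : Omega -> R := limit_version (Y v).

Lemma ae_cvg_Ylimit v : {ae P, forall om, Y v ^~ om @ \oo --> Ylimit v om}.
Proof.
apply: ae_cvg_limit_version; [exact: L1Y|exact: Ysum_maximal_at|exact: cauchyY].
Qed.

Lemma L1_Ylimit v : L1 P (Ylimit v).
Proof.
have [N HN] := cauchyY v ltr01.
exact: (limit_version_L1 (L1Y v) (@Ysum_maximal_at v) (cauchyY v)
  (fun m Nm => HN N m (leqnn N) Nm)).1.
Qed.

Lemma Ylimit_cvgL1 v (e : R) : 0 < e -> exists N, forall n, (N <= n)%N ->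
  Ex P (fun om => `|Y v n om - Ylimit v om|) <= e.
Proof.
move=> e0; have [N HN] := cauchyY v e0; exists N => n Nn.
exact: (limit_version_L1 (L1Y v) (@Ysum_maximal_at v) (cauchyY v)
  (fun m nm => HN n m Nn (leq_trans Nn nm))).2.
Qed.

Lemma Ex_Ylimit v : Ex P (Ylimit v) = 1.
Proof.
apply/eqP; rewrite -subr_eq0 -normr_le0; apply/ler_addgt0Pr => e e0; rewrite add0r.
have [N HN] := Ylimit_cvgL1 v e0; apply: le_trans (HN N (leqnn N)).
rewrite -(Ex_Ysum_at mV indV L1W mean1 v N) -ExB; [|exact: L1_Ylimit|exact: L1Y].
rewrite [leRHS](eq_Ex P (fun om => distrC (Y v N om) (Ylimit v om))).
by apply: Ex_norm; apply: L1B; [exact: L1_Ylimit|exact: L1Y].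
Qed.

Definition descendants v : set (seq I) := [set u | exists w, u = v ++ w].

Lemma wrt_Ysum_descendants v n :
  meas_wrt (events_of V (descendants v)) (Y v n).
Proof.
apply: wrt_sum => w; apply: (eq_wrt (f := fun om =>
  Qprod (fun u => V (v ++ u) om) [::] w)).
  by move=> om; rewrite -[in RHS](cats0 v) Qprod_shift.
have : meas_wrt (events_of (fun u => V (v ++ u)) setT)
    (fun om => Qprod (fun u => V (v ++ u) om) [::] w).
  exact: wrt_Qprod.
move=> mf _ B mB; rewrite setTI.
suff : <<s events_of (fun u => V (v ++ u)) setT >> `<=`
    <<s events_of V (descendants v) >> by apply; rewrite -[_ @^-1` _]setTI; exact: mf.
apply: smallest_sub; first exact: smallest_sigma_algebra.
move=> _ [u _ [C mC ->]]; apply: sub_sigma_algebra.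
by exists (v ++ u); [exists u|exists C].
Qed.

(** Convergence of [Y_n(v)] to 0 spelled out by countable operations, so that the event lies exactly
    in the sigma-algebra of the subtree of [v] and events of sibling subtrees are independent. *)
Definition dying v : set Omega := \bigcap_p \bigcup_N \bigcap_n
  [set om | ((N <= n)%N -> Y v n om < p.+1%:R^-1)].

Lemma sigma_dying v : <<s events_of V (descendants v) >> (dying v).
Proof.
pose T := g_sigma_algebraType (events_of V (descendants v)).
apply: (@bigcapT_measurable _ T) => p; apply: (@bigcupT_measurable _ T) => N.
apply: (@bigcapT_measurable _ T) => n.
have [Nn|nN] := leqP N n; last first.
  rewrite (_ : [set om | _] = setT); first exact: (@measurableT _ T).
  by apply/seteqP; split.
rewrite (_ : [set om | _] = [set om | Y v n om < p.+1%:R^-1]); last first.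
  by apply/seteqP; split => om //= h; exact: h.
have mf : meas_wrt (events_of V (descendants v)) (fun om => Y v n om < p.+1%:R^-1).
  by apply: measurable_fun_ltr; [exact: wrt_Ysum_descendants|exact: measurable_cst].
exact: (wrt_pre (B := [set true]) mf).
Qed.

Lemma measurable_dying v : measurable (dying v).
Proof. exact: (sigma_events_measurable mV (@sigma_dying v)). Qed.

Lemma dyingP v om : dying v om <-> Y v ^~ om @ \oo --> (0 : R).
Proof.
split=> [h|/cvgrPdist_lt h p _].
  apply/cvgrPdist_lt => e e0.
  have [N _ HN] := h (Num.truncn e^-1) Logic.I; exists N => // n /= Nn.
  rewrite sub0r normrN ger0_norm//; apply: lt_trans (HN n Logic.I Nn) _.
  by rewrite invf_plt ?posrE//; exact: truncnS_gt.
have [|N _ HN] := h p.+1%:R^-1; first by rewrite invr_gt0.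
exists N => // n _ /= Nn; have := HN n Nn; rewrite /= sub0r normrN ger0_norm//.
Qed.

(** Splitting at the first letter gives [Y_(n+1)(v) >= W_i Y_n(v i)] at every point, so no
    exceptional set appears. *)
Lemma dying_children v i om : 0 < W v i om -> dying v om -> dying (rcons v i) om.
Proof.
move=> Wp /dyingP h; apply/dyingP.
have h1 : (fun n => Y v n.+1 om) @ \oo --> (0 : R).
  by rewrite (cvg_shiftS (Y v ^~ om)).
have h2 : (fun n => (W v i om)^-1 * Y v n.+1 om) @ \oo --> (0 : R).
  by rewrite -(mulr0 (W v i om)^-1); apply: cvgM => //; exact: cvg_cst.
apply: (squeeze_cvgr _ (cvg_cst 0) h2); apply: nearW => n; rewrite Y0/=.
rewrite ler_pdivlMl// /Y YsumS_head (bigD1 i)//= lerDl.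
by apply: sumr_ge0 => j _; rewrite mulr_ge0 ?V0//; exact: Y0.
Qed.

Variables (l0 : nat) (M Th : R).
Hypothesis mass_event : forall v n (E : set Omega), (l0 <= size v)%N -> measurable E ->
  Ex P (fun om => Y v n om * \1_E om) <= 1 / 2 + fine (P E) * (1 + M * Th ^+ size v).

(** The limit is 0 on [dying v], so by L^1 convergence the unit mean of [Y_N] sits, up to [e], on
    the complement; [mass_event] for that complement concludes. *)
Lemma dying_prob v : (l0 <= size v)%N ->
  1 / 2 <= (1 - fine (P (dying v))) * (1 + M * Th ^+ size v).
Proof.
move=> lv; have mD := measurable_dying v; have mDC := measurableC mD.
have pC : fine (P (~` dying v)) = 1 - fine (P (dying v)).
  by rewrite probability_setC// fineB// fin_num_measure.
rewrite -pC; apply/ler_addgt0Pr => e e0.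
have [N HN] := Ylimit_cvgL1 v e0.
have {HN}LN := HN N (leqnn N).
have := @mass_event v N _ lv mDC.
have LL := L1_Ylimit v.
have Z : Ex P (fun om => Ylimit v om * \1_(dying v) om) = 0.
  have LLD : L1 P (fun om => Ylimit v om * \1_(dying v) om) by apply: L1_mul_indic.
  apply/EFin_inj; rewrite -ExE//.
  rewrite (@ae_eq_integral _ _ _ P setT (cst 0%E))//.
    by rewrite integral0.
    by apply/measurable_EFinP; exact: L1_measurable LLD.
  apply: filterS (ae_cvg_Ylimit v) => om cv _ /=.
  rewrite indicE; case: (boolP (om \in _)); last by rewrite mulr0.
  rewrite inE => /dyingP cv0; congr (_%:E).
  by rewrite (cvg_unique _ cv cv0) // mul0r.
have d1 : Ex P (fun om => Y v N om * \1_(dying v) om) <= e.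
  rewrite -[leLHS]subr0 -Z -ExB; [|exact: L1_mul_indic|exact: L1_mul_indic].
  apply: le_trans LN; apply: Ex_le => [||om].
  - by apply: L1B; exact: L1_mul_indic.
  - by apply: L1_norm; exact: L1B.
  rewrite -mulrBl (le_trans (ler_norm _))// normrM ler_piMr//.
  by rewrite indicE ger0_norm// lern1 leq_b1.
have d2 : Ex P (fun om => Y v N om * \1_(dying v) om) +
   Ex P (fun om => Y v N om * \1_(~` dying v) om) = 1.
  rewrite -ExD; [|exact: L1_mul_indic|exact: L1_mul_indic].
  rewrite -(Ex_Ysum_at mV indV L1W mean1 v N); apply: eq_Ex => om.
  by rewrite -mulrDr !indicE in_setC; case: (om \in _); rewrite ?addr0 ?add0r mulr1.
by move: d1 d2; lra.
Qed.

End limit_mass.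

(** * Extinction *)

Section generating_function.
Context {R : realType} {I : finType}.
Variable law : {set I} -> R.
Hypothesis law0 : forall J, 0 <= law J.
Hypothesis law1 : \sum_J law J = 1.
Implicit Types (x y s q : R).

Definition genfun x : R := \sum_J law J * x ^+ #|J|.
Definition offspring_mean : R := \sum_J law J * #|J|%:R.

Lemma genfun_le x y : 0 <= x -> x <= y -> genfun x <= genfun y.
Proof.
move=> x0 xy; apply: ler_sum => J _; rewrite ler_wpM2l// lerXn2r ?nnegrE//.
exact: le_trans xy.
Qed.

Lemma genfun_ge0 x : 0 <= x -> 0 <= genfun x.
Proof. by move=> x0; apply: sumr_ge0 => J _; rewrite mulr_ge0// exprn_ge0. Qed.

Let convex_exp (t q y : R) k : 0 <= q -> q <= y -> 0 <= t <= 1 ->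
  ((1 - t) * q + t * y) ^+ k <= (1 - t) * q ^+ k + t * y ^+ k.
Proof.
move=> q0 qy /andP[t0 t1].
have y0 : 0 <= y by exact: le_trans qy.
elim: k => [|k ih]; first by rewrite !expr0; lra.
have qyk : q ^+ k <= y ^+ k by rewrite lerXn2r.
have b0 : 0 <= (1 - t) * q + t * y.
  by rewrite addr_ge0// mulr_ge0// subr_ge0.
rewrite exprS (le_trans (ler_wpM2l b0 ih))// !exprS -subr_ge0.
move: (q ^+ k) (y ^+ k) qyk => a b ab.
have -> : (1 - t) * (q * a) + t * (y * b) -
   ((1 - t) * q + t * y) * ((1 - t) * a + t * b) =
   ((1 - t) * t) * ((y - q) * (b - a)) by ring.
by rewrite !mulr_ge0// subr_ge0.
Qed.

Lemma genfun_convex (t q y : R) : 0 <= q -> q <= y -> 0 <= t <= 1 ->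
  genfun ((1 - t) * q + t * y) <= (1 - t) * genfun q + t * genfun y.
Proof.
move=> q0 qy t01; rewrite /genfun !mulr_sumr -big_split/=; apply: ler_sum => J _.
rewrite [(1 - t) * (law J * _)]mulrCA [t * (law J * _)]mulrCA -mulrDr ler_wpM2l//.
exact: convex_exp.
Qed.

(** Second-order expansion at 1: the slope is the mean offspring number, and [#|J| <= #|I|] gives a
    crude constant for the quadratic remainder. *)
Lemma genfun_near1 s : 0 <= s -> s <= 1 ->
  genfun (1 - s) <= 1 - (offspring_mean - #|I|%:R ^+ 2 * s) * s.
Proof.
move=> s0 s1.
have expk k : (1 - s) ^+ k <= 1 - k%:R * s + k%:R ^+ 2 * s ^+ 2.
  elim: k => [|k ih]; first by rewrite expr0; lra.
  have d0 : 0 <= 1 - s by rewrite subr_ge0.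
  rewrite exprS (le_trans (ler_wpM2l d0 ih))// -natr1.
  have : 0 <= k%:R :> R by [].
  move: (k%:R : R) => K K0; rewrite -subr_ge0.
  have -> : 1 - (K + 1) * s + (K + 1) ^+ 2 * s ^+ 2 -
    (1 - s) * (1 - K * s + K ^+ 2 * s ^+ 2) =
    (K + 1) * s ^+ 2 + K ^+ 2 * s ^+ 3 by ring.
  by rewrite addr_ge0// mulr_ge0 ?exprn_ge0// addr_ge0.
apply: (@le_trans _ _ (\sum_J (law J - law J * #|J|%:R * s +
    law J * (#|I|%:R ^+ 2 * s ^+ 2)))).
  apply: ler_sum => J _.
  rewrite -mulrA -{2}[law J]mulr1 -mulrBr -mulrDr ler_wpM2l// (le_trans (expk _))//.
  rewrite lerD2l ler_wpM2r ?sqr_ge0// lerXn2r ?nnegrE// ler_nat max_card//.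
rewrite big_split /= sumrB -!mulr_suml law1 -/offspring_mean.
by rewrite le_eqVlt; apply/orP; left; apply/eqP; ring.
Qed.

(* If [q < p 0] then, by convexity, [p] increases to [1], and near [1] the slope
   of [genfun] forces [1 - p l] to decay faster than any [c * Th ^- l]. *)
Lemma genfun_iterates_le (p : nat -> R) (q K Th : R) (l0 : nat) :
  1 < offspring_mean -> 0 <= q <= 1 -> genfun q <= q ->
  (forall l, 0 <= p l <= 1) -> (forall l, p l <= genfun (p l.+1)) ->
  0 <= K -> 0 <= Th -> Th < offspring_mean ->
  (forall l, (l0 <= l)%N -> 1 / 2 <= (1 - p l) * (1 + K * Th ^+ l)) ->
  p 0%N <= q.
Proof.
move=> m1 /andP[q0 q1] gq p01 pg K0 Th0 Thm low; rewrite leNgt; apply/negP => qp.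
set m := offspring_mean in m1 Thm *.
(* [Th] may be below 1; [B] absorbs the constant 1 in [1 + K * Th ^+ l]. The rate [th] is then
   placed strictly between [B] and [m]. *)
pose B := Num.max 1 Th.
have B1 : 1 <= B by rewrite le_max lexx.
have ThB : Th <= B by rewrite le_max lexx orbT.
have Bm : B < m by rewrite gt_max m1.
pose th := (B + m) / 2.
have Bth : B < th by rewrite /th; lra.
have thm : th < m by rewrite /th; lra.
have th1 : 1 < th by exact: le_lt_trans Bth.
pose r2 : R := #|I|%:R ^+ 2.
have r20 : 0 <= r2 by rewrite exprn_ge0.
(* So small that the quadratic remainder costs at most [m - th]: on [[1 - s0, 1]] the distance of
   [genfun] to 1 is at least [th] times that of its argument. *)
pose s0 : R := Num.min (1 / 2) ((m - th) / (r2 + 1)).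
have r21 : 0 < r2 + 1 by rewrite ltr_wpDl.
have s0p : 0 < s0 by rewrite lt_min divr_gt0//= divr_gt0// subr_gt0.
have s0h : s0 <= 1 / 2 by rewrite ge_min lexx.
have s0r : r2 * s0 <= m - th.
  have : s0 <= (m - th) / (r2 + 1) by rewrite ge_min lexx orbT.
  by rewrite ler_pdivlMr//; move: (s0) s0p => s sp; lra.
have near s : 0 <= s -> s <= s0 -> genfun (1 - s) <= 1 - th * s.
  move=> sp ss; apply: le_trans (genfun_near1 sp _) _; first by lra.
  rewrite -/r2 -/m lerD2l lerN2 ler_wpM2r//.
  by have := ler_wpM2l r20 ss; lra.
pose y := 1 - s0.
pose a := p 0%N.
(* Below [y], [genfun] lies under the chord from [q] to [y], whose gap to the diagonal at [y] is at
   least [(th - 1) * s0]. At a point beyond [a] this leaves a gain of at least [kap] per step. *)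
pose kap := (th - 1) * s0 * (a - q).
have kap0 : 0 < kap by rewrite !mulr_gt0// subr_gt0.
have step l : a <= p l -> p l <= p l.+1 /\
    ((y <= p l.+1 /\ th * (1 - p l.+1) <= 1 - p l) \/ p l + kap <= p l.+1).
  move=> al; have zx := pg l; move: (p01 l.+1) (p01 l) => /andP[x0 x1] /andP[z0 z1].
  move: (p l.+1) (p l) al zx x0 x1 z0 z1 => x z az zx x0 x1 z0 z1.
  have qx : q < x.
    rewrite ltNge; apply/negP => xq.
    have := genfun_le x0 xq; rewrite -/a in qp; lra.
  have [yx|xy] := leP y x.
    have := near (1 - x); rewrite subKr => /(_ _ _)h.
    have {}h : genfun x <= 1 - th * (1 - x) by apply: h; rewrite /y in yx; lra.
    have h2 : th * (1 - x) <= 1 - z by lra.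
    have h3 : 1 - x <= th * (1 - x) by rewrite ler_peMl// ?(ltW th1)// subr_ge0.
    by split; [lra|left].
  have yq : 0 < y - q by lra.
  pose t := (x - q) / (y - q).
  have t01 : 0 <= t <= 1.
    apply/andP; split; first by rewrite divr_ge0// ?ltW// subr_gt0.
    by rewrite ler_pdivrMr//; lra.
  have xE : x = (1 - t) * q + t * y.
    have : t * (y - q) = x - q by rewrite /t mulfVK// gt_eqF.
    by move: (t) => u hu; rewrite mulrBl mul1r -addrA [- _ + _]addrC -mulrBr hu; ring.
  have qy : q <= y by lra.
  have gx := genfun_convex q0 qy t01; rewrite -xE in gx.
  have gy : genfun y <= 1 - th * s0 by apply: near => //; exact: ltW.
  have /andP[t0 t1] := t01.
  have gx2 : genfun x <= x - t * ((th - 1) * s0).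
    apply: le_trans gx _; rewrite [X in _ <= X - _]xE.
    have := ler_wpM2l t0 gy; have : (1 - t) * genfun q <= (1 - t) * q.
      by rewrite ler_wpM2l// subr_ge0.
    rewrite /y; nra.
  have k0 : 0 < (th - 1) * s0 by rewrite mulr_gt0// subr_gt0.
  have zx' : z <= x.
    have : 0 <= t * ((th - 1) * s0) by rewrite mulr_ge0// ltW.
    lra.
  have ta : a - q <= t.
    rewrite ler_pdivlMr//.
    have : (a - q) * (y - q) <= (a - q) * 1.
      by rewrite ler_wpM2l//; rewrite /y -/a in qp *; lra.
    lra.
  split=> //; right.
  have : kap <= t * ((th - 1) * s0) by rewrite /kap mulrC ler_wpM2r// ltW.
  lra.
have mono l : a <= p l.
  elim: l => [|l ih]; first exact: lexx.
  by have [h _] := step l ih; exact: le_trans h.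
have mono2 l : p l <= p l.+1 by have [] := step l (mono l).
(* Gains of [kap] cannot go on forever in a sequence bounded by 1, so [p] passes [y]; from there on
   [1 - p] shrinks by [th] at each step. *)
have [l1 Hl1] : exists l1, y <= p l1.
  apply: contrapT => no.
  have grow k : a + k%:R * kap <= p k.
    elim: k => [|k ih]; first by rewrite mul0r addr0.
    have [_ [[h _]|h]] := step k (mono k); first by exfalso; apply: no; exists k.+1.
    by rewrite -natr1; lra.
  have := grow (Num.truncn kap^-1).+1.
  have := truncnS_gt kap^-1; rewrite -(ltr_pM2r kap0) mulVf ?gt_eqF//.
  have := p01 (Num.truncn kap^-1).+1 => /andP[_ h1].
  have := p01 0%N => /andP[h0 _]; rewrite -/a in h0; lra.
have above k : y <= p (l1 + k)%N.
  elim: k => [|k ih]; first by rewrite addn0.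
  by rewrite addnS (le_trans ih).
have dec k : th * (1 - p (l1 + k).+1) <= 1 - p (l1 + k)%N.
  have zx := pg (l1 + k)%N; have := above k.+1; rewrite addnS => yx.
  have /andP[x0 x1] := p01 (l1 + k).+1.
  have := near (1 - p (l1 + k).+1); rewrite subKr => h.
  by have := h; rewrite /y in yx; lra.
have pow k : th ^+ k * (1 - p (l1 + k)%N) <= 1.
  elim: k => [|k ih].
    by rewrite expr0 mul1r addn0; have /andP[h _] := p01 l1; lra.
  rewrite addnS exprSr -mulrA (le_trans _ ih)// ler_wpM2l//.
  by rewrite exprn_ge0// ltW// (lt_trans _ th1).
pose K' := K * B ^+ l1.
have BB k : 1 + K * Th ^+ (l1 + k) <= (1 + K') * B ^+ k.
  rewrite mulrDl mul1r lerD//; first by rewrite exprn_ege1.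
  by rewrite /K' -mulrA -exprD ler_wpM2l// lerXn2r ?nnegrE// (le_trans _ B1).
have B0 : 0 < B by exact: lt_le_trans B1.
have K'0 : 0 <= K' by rewrite mulr_ge0// exprn_ge0// ltW.
have bound k : (l0 <= l1 + k)%N -> (th / B) ^+ k <= 2 * (1 + K').
  move=> lk; rewrite expr_div_n ler_pdivrMr ?exprn_gt0//.
  have h1 := low _ lk.
  have s1 : 0 <= 1 - p (l1 + k)%N by have /andP[_ h] := p01 (l1 + k)%N; lra.
  have h2 := ler_wpM2l s1 (BB k).
  have thk : 0 <= th ^+ k by rewrite exprn_ge0// ltW// (lt_trans _ th1).
  have h3 : th ^+ k * (1 / 2) <= th ^+ k * (1 - p (l1 + k)%N) * ((1 + K') * B ^+ k).
    by rewrite -mulrA ler_wpM2l// (le_trans h1).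
  have c0 : 0 <= (1 + K') * B ^+ k by rewrite mulr_ge0 ?exprn_ge0// ?(ltW B0)// addr_ge0.
  have h4 := ler_wpM2r c0 (pow k).
  by move: h3 h4; rewrite mul1r; lra.
(* By Bernoulli the powers of [th / B > 1] are unbounded, against [bound]. *)
pose del := th / B - 1.
have del0 : 0 < del by rewrite subr_gt0 ltr_pdivlMr// mul1r.
have bern k : 1 + k%:R * del <= (th / B) ^+ k.
  elim: k => [|k ih]; first by rewrite expr0 mul0r addr0.
  have e : th / B = 1 + del by rewrite /del; ring.
  have hk : (1 + k%:R * del) * (1 + del) <= (th / B) ^+ k * (1 + del).
    by rewrite ler_wpM2r// addr_ge0// ltW.
  rewrite exprSr [X in _ <= _ * X]e -natr1; apply: le_trans hk.
  have : 0 <= k%:R * (del * del) by rewrite !mulr_ge0// ltW.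
  lra.
pose N := (l0 + (Num.truncn (2 * (1 + K') / del)).+1)%N.
have := le_trans (bern N) (bound N _); rewrite (leq_trans _ (leq_addl _ _)) ?leq_addr//.
move=> /(_ isT).
have := truncnS_gt (2 * (1 + K') / del); rewrite ltr_pdivrMr//.
have : (Num.truncn (2 * (1 + K') / del)).+1%:R * del <= N%:R * del.
  by rewrite ler_wpM2r ?(ltW del0)// ler_nat leq_addl.
lra.
Qed.

End generating_function.

Lemma ae_countable d (Omega : measurableType d) (R : realType)
    (P : probability Omega R) (A : countType) (Q : A -> Omega -> Prop) :
  (forall u, {ae P, forall om, Q u om}) -> {ae P, forall om, forall u, Q u om}.
Proof.
move=> H; apply: (@negligibleS _ _ _ _
    (\bigcup_n (if unpickle n is Some u then ~` [set om | Q u om] else set0))).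
  move=> om /= /existsNP[u Hu]; exists (pickle u) => //=.
  by rewrite pickleK.
apply: negligible_bigcup => n; case: (unpickle n) => [u|]; first exact: H.
exact: negligible_set0.
Qed.

(** * Extinction of the offspring tree and vanishing of the mass *)

Section extinction.
Context d (Omega : measurableType d) (R : realType) (P : probability Omega R).
Context (I : pointedFinType) (V : seq I -> Omega -> weighted I R).
Hypothesis mV : forall u, measurable_fun setT (V u).
Hypothesis indV : mutually_independent P V.
Implicit Types (u v w : seq I) (i j : I) (om : Omega) (J : {set I}).

Definition offspring v om : {set I} := [set i | cpt (V v om) i]%SET.

Notation pr A := (Ex P \1_A).

Variable law : {set I} -> R.
Hypothesis law_offspring : forall v J,
  pr [set om | offspring v om = J] = law J.

Local Notation wrt S := (meas_wrt (events_of V S)).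
Local Notation sigma S := (<<s events_of V S >>).

Let child_inj v i j w w' : rcons v i ++ w = rcons v j ++ w' -> i = j.
Proof. by rewrite !cat_rcons => /eqP; rewrite eqseq_cat// eqxx => /eqP[]. Qed.

Let wrt_indic (S : set (seq I)) A : sigma S A -> wrt S (\1_A : Omega -> R).
Proof. by move=> sA; exact: measurable_indic. Qed.

Let progeny v (s : seq I) : set (seq I) :=
  [set u | exists2 i, i \in s & descendants (rcons v i) u].

Let Ex_prod v (A : I -> set Omega) s : uniq s ->
  (forall i, sigma (descendants (rcons v i)) (A i)) ->
  [/\ wrt (progeny v s) (fun om => \prod_(i <- s) \1_(A i) om : R),
      L1 P (fun om => \prod_(i <- s) \1_(A i) om) &
      Ex P (fun om => \prod_(i <- s) \1_(A i) om) = \prod_(i <- s) pr (A i)].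
Proof.
move=> + sA; elim: s => [_|i s ih /= /andP[is_ us]].
  rewrite big_nil; split.
  - apply: (eq_wrt (f := fun=> (1 : R))) => [om|]; first by rewrite big_nil.
    exact: measurable_cst.
  - by apply: (eq_L1 _ (L1_cst P 1)) => om; rewrite big_nil.
  - by rewrite -[RHS](Ex_cst P 1); apply: eq_Ex => om; rewrite big_nil.
have [w1 l1 e1] := ih us.
have wA : wrt (descendants (rcons v i)) (\1_(A i) : Omega -> R) by exact: wrt_indic.
have lA : L1 P (\1_(A i) : Omega -> R).
  by apply: L1_indic; exact: (sigma_events_measurable mV (sA i)).
have dis u : descendants (rcons v i) u -> ~ progeny v s u.
  move=> [w ->] [j js [w' /child_inj ij]]; move: is_; rewrite ij js//.
split.
- apply: (eq_wrt (fun om => esym (big_cons _ _ i s _ _))) => /=.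
  apply: wrtM.
    by apply: wrt_mono wA => u hu; exists i => //; exact: mem_head.
  apply: wrt_mono w1 => u [j js hu]; exists j => //.
  by rewrite inE js orbT.
- apply: (eq_L1 (fun om => esym (big_cons _ _ i s _ _))) => /=.
  exact: (L1_mul mV indV dis wA w1 lA l1).
- rewrite big_cons -e1 -(Ex_mul mV indV dis wA w1 lA l1).
  by apply: eq_Ex => om; rewrite big_cons.
Qed.

Let sigma_offspring v J : sigma [set v] [set om | offspring v om = J].
Proof.
apply: (@measurable_pattern _ (g_sigma_algebraType (events_of V [set v])) I
  (fun i om => cpt (V v om) i)) => i.
apply: (@measurableT_comp _ _ _ _ _ _ (fun x : weighted I R => cpt x i)).
  exact: measurable_cpt.
exact: wrt_var.
Qed.

(** Branching property: once the offspring set [J] at [v] is fixed, the condition concerns disjoint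
    subtrees, which are independent of each other and of the variable at [v]. *)
Lemma offspring_prob v (A : I -> set Omega) :
  (forall i, sigma (descendants (rcons v i)) (A i)) ->
  pr [set om | forall i, cpt (V v om) i -> A i om] =
  \sum_J law J * \prod_(i in J) pr (A i).
Proof.
move=> sA.
rewrite (@eq_Ex _ _ _ P _ (fun om => \sum_J
   \1_[set om | offspring v om = J] om * \prod_(i <- enum J) \1_(A i) om)); last first.
  move=> om; rewrite (bigD1 (offspring v om))//= [X in _ = _ + X]big1 ?addr0 => [|J nJ]; last first.
    by rewrite indicE memNset ?mul0r//= => e; rewrite e eqxx in nJ.
  have -> : \1_[set om0 | offspring v om0 = offspring v om] om = 1 :> R.
    by rewrite indicE mem_set.
  rewrite mul1r big_enum/= indicE.
  have [oA|nA] := boolP (om \in [set om | forall i, cpt (V v om) i -> A i om]).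
    rewrite big1// => i; rewrite inE => ci; rewrite indicE mem_set//.
    by move: oA; rewrite inE => /(_ i ci).
  have /existsNP[i /not_implyP[ci nAi]] :
      ~ forall i, cpt (V v om) i -> A i om by move: nA; rewrite notin_setE.
  by rewrite (bigD1 i) ?inE//= indicE memNset// mul0r.
have dis u : [set v] u -> ~ (\bigcup_(J : {set I}) progeny v (enum J)) u.
  move=> -> [J _ [i _ [w /(congr1 size)]]].
  by rewrite size_cat size_rcons addSn => /eqP; rewrite -[X in X == _]addn0 -addnS eqn_add2l.
have wI J : wrt [set v] (\1_[set om | offspring v om = J] : Omega -> R).
  by apply: wrt_indic; exact: sigma_offspring.
have lI J : L1 P (\1_[set om | offspring v om = J] : Omega -> R).
  by apply: L1_indic; exact: (sigma_events_measurable mV (@sigma_offspring v J)).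
have wA J : wrt (\bigcup_(J : {set I}) progeny v (enum J))
    (fun om => \prod_(i <- enum J) \1_(A i) om : R).
  have [w1 _ _] := Ex_prod (enum_uniq J) sA.
  by apply: wrt_mono w1 => u hu; exists J.
have lA J : L1 P (fun om => \prod_(i <- enum J) \1_(A i) om).
  by have [_ l1 _] := Ex_prod (enum_uniq J) sA.
rewrite Ex_sum => [|J _]; last exact: (L1_mul mV indV dis (wI J) (wA J) (lI J) (lA J)).
apply: eq_bigr => J _.
rewrite (Ex_mul mV indV dis (wI J) (wA J) (lI J) (lA J)) law_offspring.
by have [_ _ ->] := Ex_prod (enum_uniq J) sA; rewrite big_enum.
Qed.

Fixpoint extinct n v : set Omega :=
  if n is n'.+1 then [set om | forall i, cpt (V v om) i -> extinct n' (rcons v i) om]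
  else set0.

Let descendants_rcons v i : descendants (rcons v i) `<=` descendants v.
Proof. by move=> u [w ->]; exists (i :: w); rewrite cat_rcons. Qed.

Lemma sigma_extinct n v : sigma (descendants v) (extinct n v).
Proof.
pose T v := g_sigma_algebraType (events_of V (descendants v)).
elim: n v => [|n ih] v /=; first exact: (@measurable0 _ (T v)).
have -> : [set om | forall i, cpt (V v om) i -> extinct n (rcons v i) om] =
   \bigcap_(i in [set` enum I]) (~` [set om | cpt (V v om) i] `|` extinct n (rcons v i)).
  apply/seteqP; split => om /= h.
    move=> i _; have [ci|/negP ci] := boolP (cpt (V v om) i); last by left.
    by right; exact: h.
  by move=> i ci; have := h i; rewrite /= mem_enum => /(_ isT)[|].
apply: (@fin_bigcap_measurable _ (T v)) => // i _.
apply: (@measurableU _ (T v)).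
  apply: (@measurableC _ (T v)).
  have mf : wrt (descendants v) (fun om => cpt (V v om) i).
    apply: (@measurableT_comp _ _ _ _ _ _ (fun x : weighted I R => cpt x i)).
      exact: measurable_cpt.
    by apply: wrt_var; exists [::]; rewrite cats0.
  exact: (wrt_pre (B := [set true]) mf).
exact: (sigma_events_mono (@descendants_rcons v i) (ih (rcons v i))).
Qed.

Lemma measurable_extinct n v : measurable (extinct n v).
Proof. exact: (sigma_events_measurable mV (@sigma_extinct n v)). Qed.

Lemma extinct_prob n v : pr (extinct n v) = iter n (genfun law) 0.
Proof.
elim: n v => [|n ih] v /=.
  by rewrite -(Ex_cst P 0); apply: eq_Ex => om; rewrite indic0.
rewrite offspring_prob; last by move=> i; exact: sigma_extinct.
apply: eq_bigr => J _; congr (_ * _).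
by under eq_bigr do rewrite ih; rewrite prodr_const.
Qed.

Lemma extinctS n v : extinct n v `<=` extinct n.+1 v.
Proof. by elim: n v => [|n ih] v om //= h i /h; exact: ih. Qed.

Lemma extinct_le n m v : (n <= m)%N -> extinct n v `<=` extinct m v.
Proof.
move=> /subnK <-; elim: (m - n)%N => // k ih om h.
by rewrite addSn; apply: extinctS; exact: ih.
Qed.

Definition extinction v := \bigcup_n extinct n v.

Lemma measurable_extinction v : measurable (extinction v).
Proof. by apply: bigcupT_measurable => n; exact: measurable_extinct. Qed.

Let cvg_extinct v :
  (fun n => (iter n (genfun law) 0)%:E) @ \oo --> P (extinction v).
Proof.
have -> : (fun n => (iter n (genfun law) 0)%:E) = P \o (fun n => extinct n v).
  apply/funext => n /=; rewrite -(extinct_prob n v) Ex_indic ?fineK//.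
    by rewrite fin_num_measure//; exact: measurable_extinct.
  exact: measurable_extinct.
apply: nondecreasing_cvg_mu.
- by move=> n; exact: measurable_extinct.
- exact: measurable_extinction.
- by move=> n m nm; apply/subsetPset; exact: extinct_le.
Qed.

(** Unlike the weights, the offspring have the same law at every vertex, so both probabilities are
    limits of the same iterates of [genfun]. *)
Lemma extinction_prob v w : pr (extinction v) = pr (extinction w).
Proof.
rewrite !Ex_indic; [|exact: measurable_extinction..].
by congr fine; exact: (cvg_unique _ (@cvg_extinct v) (@cvg_extinct w)).
Qed.

Lemma extinctionE v :
  extinction v = [set om | forall i, cpt (V v om) i -> extinction (rcons v i) om].
Proof.
apply/seteqP; split => om.
  move=> [[//|n] _ h] i ci; exists n => //; exact: h.
move=> h; pose N i := if pselect (cpt (V v om) i) is left ci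
  then projT1 (cid2 (h i ci)) else 0%N.
(* There are finitely many children, so one depth serves them all. *)
exists (\max_i N i).+1 => // i ci; apply: (@extinct_le (N i)).
  exact: leq_bigmax.
by rewrite /N; case: pselect => // c'; case: (cid2 (h i c')).
Qed.

Lemma extinction_fixpoint v : genfun law (pr (extinction v)) = pr (extinction v).
Proof.
rewrite [in RHS]extinctionE offspring_prob.
  apply: eq_bigr => J _; congr (_ * _).
  under eq_bigr do rewrite (extinction_prob _ v).
  by rewrite prodr_const.
move=> i; apply: (@bigcupT_measurable _
  (g_sigma_algebraType (events_of V (descendants (rcons v i))))) => n.
exact: sigma_extinct.
Qed.

Lemma extinct_not_surviving om (s : nat -> I) n k :
  surviving (fun u => V u om) s -> ~ extinct n (mkseq s k) om.
Proof.
move=> ss; elim: n k => [|n ih] k //= h; apply: (ih k.+1).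
rewrite /mkseq -addn1 iotaD map_cat cats1 add0n; apply: h; exact: ss.
Qed.

Let pr_le_ae A B : measurable A -> measurable B ->
  {ae P, forall om, A om -> B om} -> pr A <= pr B.
Proof.
move=> mA mB AB; rewrite -lee_fin -!ExE; [|exact: L1_indic..].
apply: ae_ge0_le_integral => //.
- by apply/measurable_EFinP; exact: measurable_indic.
- by apply/measurable_EFinP; exact: measurable_indic.
apply: filterS AB => om h _; rewrite lee_fin !indicE.
have [|//] := boolP (om \in A); rewrite inE => /h Bo.
by rewrite mem_set.
Qed.

Hypothesis V0 : forall u om i, 0 <= wgt (V u om) i.
Hypothesis pos_cpt : {ae P, forall om, forall u i,
  0 < wgt (V u om) i -> cpt (V u om) i}.
Hypothesis cpt_pos : {ae P, forall om, forall u i,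
  cpt (V u om) i -> 0 < wgt (V u om) i}.

Let dying v := dying V v.

Lemma extinct_dying om : (forall u i, 0 < wgt (V u om) i -> cpt (V u om) i) ->
  forall n v, extinct n v om -> dying v om.
Proof.
move=> H n v h; apply/(dyingP V0).
suff Z k : (n <= k)%N -> Ysum (fun u => V u om) k v = 0.
  apply/cvgrPdist_le => e e0; exists n => // k /= nk.
  by rewrite Z// subrr normr0 ltW.
elim: n v h k => [|n ih] v h k //; case: k => // k nk.
rewrite YsumS_head big1// => i _.
have [->|W0] := eqVneq (wgt (V v om) i) 0; first by rewrite mul0r.
by rewrite (ih (rcons v i))// ?mulr0//; apply: h; apply: H; rewrite lt0r W0 V0.
Qed.

Variables (l0 : nat) (M Th : R).
Hypothesis M0 : 0 <= M.
Hypothesis Th0 : 0 <= Th.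
Hypothesis dying_lb : forall v, (l0 <= size v)%N ->
  1 / 2 <= (1 - fine (P (dying v))) * (1 + M * Th ^+ size v).
Hypothesis mean_gt1 : 1 < offspring_mean law.
Hypothesis Th_mean : Th < offspring_mean law.

Let mD v : measurable (dying v). Proof. exact: measurable_dying. Qed.

Let pr01 A : measurable A -> 0 <= pr A <= 1.
Proof.
move=> mA; apply/andP; split; first by apply: Ex_ge0 => om; rewrite indicE.
rewrite -[leRHS](Ex_cst P 1); apply: Ex_le => [||om].
- exact: L1_indic.
- exact: L1_cst.
- by rewrite indicE lern1 leq_b1.
Qed.

Let law_ge0 J : 0 <= law J.
Proof. by rewrite -(law_offspring [::]); apply: Ex_ge0 => om; rewrite indicE. Qed.

Let law_sum : \sum_J law J = 1.
Proof.
have <- : pr [set om | forall i, cpt (V [::] om) i -> setT om] = 1.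
  rewrite -[RHS](Ex_cst P 1); apply: eq_Ex => om.
  by rewrite indicE mem_set.
rewrite offspring_prob => [|i]; last first.
  exact: (@measurableT _ (g_sigma_algebraType (events_of V (descendants (rcons [::] i))))).
apply: eq_bigr => J _; rewrite big1 ?mulr1// => i _.
by rewrite -[RHS](Ex_cst P 1); apply: eq_Ex => om; rewrite indicT.
Qed.

(** Almost surely a retained child has positive weight, so when the mass of [v] dies, that of every
    retained child does. This is an inclusion up to a null set, hence only an inequality. *)
Let dying_step v :
  pr (dying v) <= \sum_J law J * \prod_(i in J) pr (dying (rcons v i)).
Proof.
rewrite -(offspring_prob (v := v) (A := fun i => dying (rcons v i))); last first.
  by move=> i; exact: sigma_dying.
have sE : [set om | forall i, cpt (V v om) i -> dying (rcons v i) om] =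
   \bigcap_(i in [set` enum I]) (~` [set om | cpt (V v om) i] `|` dying (rcons v i)).
  apply/seteqP; split => om /= h.
    move=> i _; have [ci|/negP ci] := boolP (cpt (V v om) i); last by left.
    by right; exact: h.
  by move=> i ci; have := h i; rewrite /= mem_enum => /(_ isT)[|].
apply: pr_le_ae => //.
  rewrite sE; apply: fin_bigcap_measurable => // i _; apply: measurableU => //.
  apply: measurableC.
  have mf : measurable_fun setT (fun om => cpt (V v om) i).
    exact: measurableT_comp (measurable_cpt i) (mV v).
  by rewrite -[X in measurable X]setTI; exact: (mf measurableT [set true]).
apply: filterS cpt_pos => om H dv i ci.
by apply: dying_children dv => //; exact: H.
Qed.

(** Taking for [p l] the maximum over the vertices [l] generations below [v] gives a scalar
    recursion without comparing the laws of [Y] at these vertices. The lower bound passes to [p l]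
    because the maximum is attained. *)
Lemma dying_le_extinction v : pr (dying v) <= pr (extinction v).
Proof.
pose F w := pr (dying (v ++ w)).
pose p l := \big[Num.max/0]_(w : l.-tuple I) F w.
have F01 w : 0 <= F w <= 1 by exact: pr01.
have p01 l : 0 <= p l <= 1.
  apply/andP; split; first exact: bigmax_ge_id.
  by apply: bigmax_le => // w _; have /andP[] := F01 w.
have Fp l (w : l.-tuple I) : F w <= p l by exact: le_bigmax.
have -> : pr (dying v) = F [::] by rewrite /F cats0.
apply: le_trans (Fp 0%N [tuple]) _.
apply: (genfun_iterates_le law_ge0 law_sum (K := M * Th ^+ size v) (Th := Th) (l0 := l0)) => //.
- by apply: pr01; exact: measurable_extinction.
- by rewrite extinction_fixpoint.
- move=> l; apply: bigmax_le; first by apply: genfun_ge0 => //; have /andP[] := p01 l.+1.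
  move=> w _; apply: le_trans (dying_step _) _; apply: ler_sum => J _.
  rewrite ler_wpM2l// -prodr_const; apply: ler_prod => i _.
  have /andP[h0 _] := F01 (rcons w i).
  by rewrite rcons_cat -/(F (rcons w i)) h0; exact: (Fp l.+1 [tuple of rcons w i]).
- by rewrite mulr_ge0// exprn_ge0.
move=> l ll.
have [w _ pw] : exists2 w : l.-tuple I, true & p l = F w.
  have [||w _ e] := @eq_bigmax _ _ (l.-tuple I) 0 (nseq_tuple l point) xpredT F.
  - by [].
  - by move=> w _; have /andP[] := F01 w.
  - by exists w.
have sw : size (v ++ w) = (size v + l)%N by rewrite size_cat size_tuple.
have := @dying_lb (v ++ w); rewrite sw (leq_trans ll) ?leq_addl// => /(_ isT).
by rewrite -mulrA -exprD pw /F Ex_indic.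
Qed.

(** Extinction entails dying almost surely, and dying is not the more probable of the two: the
    difference is null. *)
Lemma dying_extinction v : {ae P, forall om, dying v om -> extinction v om}.
Proof.
have mE := measurable_extinction v.
exists (dying v `\` extinction v); split.
- exact: measurableD.
- apply/eqP; rewrite eq_le measure_ge0 andbT.
  have fin A : measurable A -> P A = (pr A)%:E.
    by move=> mA; rewrite Ex_indic// fineK// fin_num_measure.
  rewrite fin ?lee_fin; last exact: measurableD.
  have ED : pr (extinction v) <= pr (dying v `&` extinction v).
    apply: pr_le_ae => //; first exact: measurableI.
    apply: filterS pos_cpt => om H [n _ h]; split; last by exists n.
    exact: extinct_dying H _ _ h.
  have split : pr (dying v) = pr (dying v `&` extinction v) + pr (dying v `\` extinction v).
    rewrite -ExD; [|by apply: L1_indic; exact: measurableI|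
      by apply: L1_indic; exact: measurableD].
    apply: eq_Ex => om; rewrite !indicE in_setI in_setD.
    by case: (om \in dying v); case: (om \in extinction v); rewrite /= ?addr0 ?add0r.
  by have := dying_le_extinction v; lra.
- by move=> om /= /not_implyP.
Qed.

End extinction.

(** * Topological support *)

Section coding_map.
Context {R : realType} {d : nat} {I : pointedFinType}.
Variables (a : I -> 'rV[R]_d) (t : I -> 'cV[R]_d).
Hypothesis a_lt1 : forall i k, 0 < `|a i 0 k| < 1.
Hypothesis cube_stable : forall i, ifs_map a t i @` closed_cube `<=` closed_cube.
Implicit Types (s : nat -> I) (w : seq I) (y z : 'cV[R]_d).

Let f := ifs_map a t.

Definition contraction_ratio : R :=
  \big[Num.max/0]_(p : I * 'I_d) `|a p.1 0 p.2|.
Let rho := contraction_ratio.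

Let rho_ge0 : 0 <= rho. Proof. exact: bigmax_ge_id. Qed.

Let rho_lt1 : rho < 1.
Proof. by apply: bigmax_lt => // p _; have /andP[] := a_lt1 p.1 p.2. Qed.

Let a_le i k : `|a i 0 k| <= rho.
Proof. exact: (le_bigmax 0 (fun p : I * 'I_d => `|a p.1 0 p.2|) (i, k)). Qed.

Let rho_small (e : R) : 0 < e -> exists n, rho ^+ n < e.
Proof.
move=> e0; have : (fun n => 1 * rho ^+ n) @ \oo --> (0 : R).
  by apply: cvg_geometric; rewrite ger0_norm.
move/cvgrPdist_lt => /(_ e e0)[N _ HN]; exists N; have := HN N (leqnn N).
by rewrite /= sub0r normrN mul1r ger0_norm// exprn_ge0.
Qed.

Let fE i y k : f i y k 0 = a i 0 k * y k 0 + t i k 0.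
Proof. by rewrite /f /ifs_map mul_diag_mx !mxE. Qed.

Let foldr_contract w y z k :
  `|foldr f y w k 0 - foldr f z w k 0| <= rho ^+ size w * `|y k 0 - z k 0|.
Proof.
elim: w => [|i w ih] /=; first by rewrite expr0 mul1r.
rewrite !fE (_ : _ - _ = a i 0 k * (foldr f y w k 0 - foldr f z w k 0)); last by ring.
by rewrite normrM exprS -mulrA ler_pM.
Qed.

Let foldr_cube w y : closed_cube y -> closed_cube (foldr f y w).
Proof. by move=> cy; elim: w => //= i w ih; apply: cube_stable; exists (foldr f y w). Qed.

Let cube0 : closed_cube (0 : 'cV[R]_d).
Proof. by move=> k; rewrite mxE lexx ler01. Qed.

Let cod n s := foldr f 0 (mkseq s n).

Let cube_dist y z k : closed_cube y -> closed_cube z -> `|y k 0 - z k 0| <= 1.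
Proof.
move=> /(_ k)/andP[y0 y1] /(_ k)/andP[z0 z1].
by rewrite ler_norml; apply/andP; split; lra.
Qed.

Let cod_cauchy s n m k : (n <= m)%N -> `|cod n s k 0 - cod m s k 0| <= rho ^+ n.
Proof.
move=> /subnKC <-; rewrite /cod.
have -> : mkseq s (n + (m - n)) = mkseq s n ++ map s (iota n (m - n)).
  by rewrite /mkseq iotaD map_cat add0n.
rewrite foldr_cat; apply: le_trans (foldr_contract _ _ _ _) _.
rewrite size_mkseq ler_piMr ?exprn_ge0//; apply: cube_dist => //.
exact: foldr_cube.
Qed.

Let is_cvg_cod s : cvgn (cod ^~ s).
Proof.
apply: cauchy_cvg; apply: cauchy_exP => e e0.
have [n hn] := rho_small e0; exists (cod n s); exists n => // m /= nm.
split=> // k j; rewrite (ord1 j) -ball_normE /ball_/=.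
exact: le_lt_trans (cod_cauchy _ _ nm) hn.
Qed.

Let coding_dist s n k : `|coding a t s k 0 - cod n s k 0| <= rho ^+ n.
Proof.
have cv : cod ^~ s @ \oo --> coding a t s by exact: is_cvg_cod.
apply/ler_addgt0Pr => e e0.
have : \forall m \near \oo, ball (coding a t s) e (cod m s).
  by apply: cv; apply/nbhs_ballP; exists e.
move=> [N _ HN]; have := HN (maxn N n); rewrite /= leq_maxl => /(_ isT)[_ /(_ k 0)].
rewrite -ball_normE /ball_/= => h1.
have h2 := @cod_cauchy s n (maxn N n) k (leq_maxr _ _).
rewrite (_ : _ - _ = (coding a t s k 0 - cod (maxn N n) s k 0) -
  (cod n s k 0 - cod (maxn N n) s k 0)); last by ring.
by rewrite (le_trans (ler_normB _ _))//; lra.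
Qed.

Lemma coding_prefix s s' n k : mkseq s n = mkseq s' n ->
  `|coding a t s k 0 - coding a t s' k 0| <= 2 * rho ^+ n.
Proof.
move=> e; have h1 := coding_dist s n k; have h2 := coding_dist s' n k.
rewrite /cod -e -/(cod n s) distrC in h2.
rewrite (_ : _ - _ = (coding a t s k 0 - cod n s k 0) + (cod n s k 0 - coding a t s' k 0)).
  by rewrite (le_trans (ler_normD _ _))//; lra.
by ring.
Qed.

Lemma coding_nbhs s (U : set 'cV[R]_d) : nbhs (coding a t s) U ->
  exists n, forall s', mkseq s' n = mkseq s n -> U (coding a t s').
Proof.
move=> /nbhs_ballP[e e0 eU].
have [n hn] := rho_small (divr_gt0 e0 (ltr0n R 2)).
exists n => s' es; apply: eU; split=> // k j; rewrite (ord1 j) -ball_normE /ball_/=.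
apply: le_lt_trans (coding_prefix k (esym es)) _.
by rewrite mulrC -ltr_pdivlMr.
Qed.

Lemma mem_cylinder s n : cylinder (mkseq s n) s.
Proof. by rewrite /cylinder /= size_mkseq. Qed.

Lemma measurable_cylinder w : measurable (cylinder w : set (codes I)).
Proof. by apply: sub_sigma_algebra; exists w. Qed.

(** Since the coding map is continuous along prefixes, the preimage is the union of the cylinders it
    contains. There are countably many words, hence measurability for the sigma-algebra of the
    cylinders. *)
Lemma coding_preimage_open (U : set 'cV[R]_d) : open U ->
  coding a t @^-1` U = \bigcup_n (if unpickle n is Some w then
    (if `[<cylinder w `<=` coding a t @^-1` U>] then cylinder w else set0) else set0).
Proof.
move=> oU; apply/seteqP; split => s.
  move=> Us; have [n hn] := @coding_nbhs s U (open_nbhs_nbhs (conj oU Us)).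
  exists (pickle (mkseq s n)) => //; rewrite pickleK.
  case: asboolP => [_|[]]; first exact: mem_cylinder.
  by move=> s'; rewrite /cylinder /= size_mkseq => /hn.
move=> [n _]; case: (unpickle n : option (seq I)) => // w; case: asboolP => // h; exact: h.
Qed.

Lemma measurable_coding_preimage (U : set 'cV[R]_d) : open U ->
  measurable (coding a t @^-1` U : set (codes I)).
Proof.
move=> oU; rewrite coding_preimage_open//.
have mo (o : option (seq I)) : measurable ((if o is Some w then
    (if `[<cylinder w `<=` coding a t @^-1` U>] then cylinder w else set0)
    else set0) : set (codes I)).
  case: o => [w|]; last exact: measurable0.
  by case: asboolP => _; [exact: measurable_cylinder|exact: measurable0].
by apply: (@bigcupT_measurable _ (codes I)) => n; exact: (mo (Some _)).
Qed.

Section support.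
Variable x : seq I -> weighted I R.
Variable nu : {measure set (codes I) -> \bar R}.
Hypothesis x0 : forall u i, 0 <= wgt (x u) i.
Hypothesis nuE : forall w, nu (cylinder w) = (Qprod x [::] w * Ylim x w)%:E.
Hypothesis x_pos : forall u i, 0 < wgt (x u) i <-> cpt (x u) i.
Hypothesis Y_pos : forall s n, surviving x s -> 0 < Ylim x (mkseq s n).

Let mkseq_rcons s n : mkseq s n.+1 = rcons (mkseq s n) (s n).
Proof. by rewrite /mkseq -[n.+1]addn1 iotaD map_cat cats1. Qed.

Let Qprod_surviving s n : surviving x s -> 0 < Qprod x [::] (mkseq s n).
Proof.
move=> ss; elim: n => [|n ih]; first by [].
by rewrite mkseq_rcons Qprod_rcons mulr_gt0//; apply/x_pos; exact: ss.
Qed.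

Let Qprod_dead s m n : ~ cpt (x (mkseq s m)) (s m) -> (m < n)%N ->
  Qprod x [::] (mkseq s n) = 0.
Proof.
move=> dead; elim: n => // n ih; rewrite ltnS leq_eqVlt mkseq_rcons Qprod_rcons.
case/predU1P => [<-|/ih ->]; last by rewrite mul0r.
have -> : wgt (x (mkseq s m)) (s m) = 0; last by rewrite mulr0.
by apply/eqP; rewrite eq_le x0 andbT leNgt; apply/negP => /x_pos.
Qed.

(* Koenig's lemma along words whose surviving cylinders accumulate at [y]. *)
Lemma limit_set_closed y :
  (forall U, nbhs y U -> exists2 s, surviving x s & U (coding a t s)) ->
  random_limit_set a t x y.
Proof.
move=> Hy.
pose acc w := forall U, nbhs y U ->
  exists s, [/\ surviving x s, mkseq s (size w) = w & U (coding a t s)].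
have acc_step w : acc w -> exists i, acc (rcons w i).
  move=> aw; apply: contrapT => /forallNP h.
  (* Otherwise each letter has a neighbourhood of [y] that it misses, and their finite intersection
     contradicts [acc w]. *)
  have /choice[U HU] : forall i, exists U : set 'cV[R]_d, nbhs y U /\
      forall s, surviving x s -> mkseq s (size w).+1 = rcons w i -> ~ U (coding a t s).
    move=> i; have /existsNP[U /not_implyP[yU no]] := h i; exists U; split => // s ss es Us.
    by apply: no; exists s; split => //; rewrite size_rcons.
  have [|s [ss es Us]] := aw [set z | forall i, U i z].
    by apply: (@filter_forall _ I U (nbhs y)) => i; have [] := HU i.
  have [_] := HU (s (size w)); apply; [exact: ss| |exact: Us].
  by rewrite mkseq_rcons es.
have /choice[g Hg] : forall w, exists i, acc w -> acc (rcons w i).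
  move=> w; have [aw|naw] := pselect (acc w); last by exists point.
  by have [i hi] := acc_step w aw; exists i.
pose word := fix word n := if n is n'.+1 then rcons (word n') (g (word n')) else [::].
have acc_word n : acc (word n).
  elim: n => [|n ih] /=; last exact: Hg.
  by move=> U /Hy[s ss Us]; exists s.
pose s n := g (word n).
have wordE n : mkseq s n = word n.
  by elim: n => // n ih; rewrite mkseq_rcons ih.
have sword n : size (word n) = n by rewrite -wordE size_mkseq.
exists s.
  move=> m; have [s' [ss' es' _]] := acc_word m.+1 setT filterT.
  rewrite sword -wordE !mkseq_rcons in es'.
  by have [<- <-] := rcons_inj es'; exact: ss'.
apply/matrixP => k j; rewrite (ord1 j); apply/eqP; rewrite -subr_eq0 -normr_le0.
apply/ler_addgt0Pr => e e0; rewrite add0r.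
have e2 : 0 < e / 2 by rewrite divr_gt0.
have [n hn] := rho_small (divr_gt0 e2 (ltr0n R 2)).
have [|s' [_ es' [_ /(_ k 0)]]] := acc_word n (ball y (e / 2)).
  by apply/nbhs_ballP; exists (e / 2).
rewrite -ball_normE /ball_/= => h1.
rewrite sword -wordE in es'.
have h2 := coding_prefix k (esym es').
rewrite (_ : _ - _ = (coding a t s k 0 - coding a t s' k 0) -
  (y k 0 - coding a t s' k 0)); last by ring.
by rewrite (le_trans (ler_normB _ _))//; lra.
Qed.

(** A code that does not survive has a prefix with [Q = 0], so the non-surviving codes lie in
    countably many null cylinders, and an open set of positive mass meets the limit set; closedness
    gives one inclusion. For the other, every prefix of a surviving code has positive [Q] and
    positive limit mass. *)
Lemma support_limit_set :
  measure_support (projected_measure a t nu) = random_limit_set a t x.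
Proof.
apply/seteqP; split => y.
  move=> sy; apply: limit_set_closed => U0; rewrite nbhsE => -[U [oU Uy] UU0].
  apply: contrapT => no.
  have none s : U (coding a t s) -> ~ surviving x s.
    by move=> Us ss; apply: no; exists s => //; exact: UU0.
  have := sy U oU Uy; rewrite /projected_measure /pushforward.
  suff -> : nu (coding a t @^-1` U) = 0%E by rewrite ltxx.
  apply: (measure_negligible (measurable_coding_preimage oU)).
  apply: (@negligibleS _ _ _ nu (\bigcup_n (if unpickle n is Some w then
     (if Qprod x [::] w == 0 then cylinder w else set0) else set0))).
    move=> s Us; have /existsNP[m dead] := none s Us.
    exists (pickle (mkseq s m.+1)) => //; rewrite pickleK (Qprod_dead dead)// eqxx.
    exact: mem_cylinder.
  apply: negligible_bigcup => n.
  suff mo w : nu.-negligible (if Qprod x [::] w == 0 then cylinder w else set0).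
    exact: mo.
  case: ifP => [/eqP Q0|_]; last exact: negligible_set0.
  exists (cylinder w); split => //; first exact: measurable_cylinder.
  by rewrite nuE Q0 mul0r.
move=> [s ss <-] U oU Us.
have [n hn] := @coding_nbhs s U (open_nbhs_nbhs (conj oU Us)).
rewrite /projected_measure /pushforward.
apply: (@lt_le_trans _ _ (nu (cylinder (mkseq s n)))).
  by rewrite nuE lte_fin mulr_gt0 ?Y_pos ?Qprod_surviving.
apply: le_measure; rewrite ?inE; [exact: measurable_cylinder|exact: measurable_coding_preimage|].
by move=> s'; rewrite /cylinder /= size_mkseq => /hn.
Qed.

End support.
End coding_map.

(** * The cascade *)

Section ae_equal_integral.
Context d (Omega : measurableType d) (R : realType) (P : probability Omega R).
Local Open Scope ereal_scope.

(** No measurability is asked: the integral of a nonnegative function is a supremum over the simple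
    functions below it. *)
Let integral_mono (f g : Omega -> \bar R) : (forall x, 0 <= f x) ->
  (forall x, f x <= g x) -> \int[P]_x f x <= \int[P]_x g x.
Proof.
move=> f0 fg; have g0 x : 0 <= g x by exact: le_trans (fg x).
rewrite !ge0_integralTE//; apply: ereal_sup_le => _ [h hf <-].
by exists h => // x; exact: le_trans (hf x) (fg x).
Qed.

(* [f] need not be measurable: it is squeezed between two measurable functions
   that agree off the exceptional set. *)
Lemma integral_ae_measurable (f g : Omega -> \bar R) : (forall x, 0 <= f x) ->
  (forall x, 0 <= g x) -> measurable_fun setT g -> {ae P, forall x, f x = g x} ->
  \int[P]_x f x = \int[P]_x g x.
Proof.
move=> f0 g0 mg [N [mN PN subN]].
have fgN x : ~ N x -> f x = g x by move=> Nx; apply: contrapT => fg; exact/Nx/subN.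
pose lo x := if x \in N then 0 else g x.
pose hi x := if x \in N then +oo else g x.
have mif c : measurable_fun setT (fun x => if x \in N then c else g x).
  apply: measurable_fun_if => //; last by apply: measurable_funTS.
  apply: (measurable_fun_bool true); rewrite setTI.
  rewrite (_ : _ @^-1` _ = N)//.
  by apply/seteqP; split => x /=; [exact: set_mem|exact: mem_set].
have eg c : 0 <= c -> \int[P]_x (if x \in N then c else g x) = \int[P]_x g x.
  move=> c0; apply: ge0_ae_eq_integral => //.
    by move=> x _; case: ifP.
  exists N; split => // x /= h; apply: contrapT => Nx; apply: h => _.
  by rewrite memNset.
apply/eqP; rewrite eq_le; apply/andP; split.
  rewrite -(eg +oo)//; apply: integral_mono => // x.
  by case: ifPn => [_|]; rewrite ?leey// notin_setE => /fgN ->.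
rewrite -(eg 0)//; apply: integral_mono => x; first by case: ifP.
by case: ifPn => // ; rewrite notin_setE => /fgN ->.
Qed.

End ae_equal_integral.

Section same_law_transfer.
Context d (Omega : measurableType d) (R : realType) (P : probability Omega R).
Context d' (T : measurableType d').
Variables X Y : {RV P >-> T}.
Hypothesis XY : same_law P X Y.

Lemma same_law_L1 (phi : T -> R) : measurable_fun setT phi ->
  L1 P (fun om => phi (Y om)) -> L1 P (fun om => phi (X om)).
Proof.
move=> mphi /integrableP[_ IY].
have mn : measurable_fun setT (fun y => `|phi y|%:E).
  by apply/measurable_EFinP; exact: measurableT_comp.
apply/integrableP; split.
  by apply/measurable_EFinP; exact: measurableT_comp.
suff -> : (\int[P]_x `|(EFin \o (fun om => phi (X om))) x| =
   \int[P]_x `|(EFin \o (fun om => phi (Y om))) x|)%E by [].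
transitivity (\int[distribution P X]_y `|phi y|%:E)%E.
  by rewrite ge0_integral_distribution.
transitivity (\int[distribution P Y]_y `|phi y|%:E)%E.
  by apply: eq_measure_integral => A mA _; exact: XY.
by rewrite ge0_integral_distribution.
Qed.

Lemma same_law_Ex (phi : T -> R) : measurable_fun setT phi ->
  L1 P (fun om => phi (Y om)) ->
  Ex P (fun om => phi (X om)) = Ex P (fun om => phi (Y om)).
Proof.
move=> mphi LY; have LX := same_law_L1 mphi LY.
apply: EFin_inj; rewrite -!ExE//.
have mE : measurable_fun setT (EFin \o phi) by exact/measurable_EFinP.
transitivity (\int[distribution P X]_y (phi y)%:E)%E.
  by rewrite integral_distribution.
transitivity (\int[distribution P Y]_y (phi y)%:E)%E.
  by apply: eq_measure_integral => A mA _; exact: XY.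
by rewrite integral_distribution.
Qed.

Lemma same_law_ae (B : set T) : measurable B ->
  {ae P, forall om, B (Y om)} -> {ae P, forall om, B (X om)}.
Proof.
move=> mB [N [mN N0 sN]]; exists (X @^-1` (~` B)); split.
- by rewrite -[_ @^-1` _]setTI; apply: measurable_funP => //; exact: measurableC.
- transitivity (P (Y @^-1` (~` B))); first by apply: XY; exact: measurableC.
  apply/eqP; rewrite eq_le measure_ge0 andbT -N0; apply: le_measure; rewrite ?inE//.
  by rewrite -[_ @^-1` _]setTI; apply: measurable_funP => //; exact: measurableC.
- by [].
Qed.

End same_law_transfer.

Section real_series.
Context {R : realType}.

Lemma bounded_series_tail (u : nat -> R) (K : R) : (forall n, 0 <= u n) ->
  (forall N, \sum_(0 <= j < N) u j <= K) -> forall e : R, 0 < e ->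
  exists J, forall n m, (J <= n)%N -> \sum_(n <= j < m) u j <= e.
Proof.
move=> u0 uK e e0; pose S N := \sum_(0 <= j < N) u j.
have nd : nondecreasing_seq S.
  move=> n m nm; rewrite /S (big_cat_nat (leq0n n) nm) /= lerDl.
  by apply: sumr_ge0.
have cv : cvgn S.
  by apply: nondecreasing_is_cvgn => //; exists K => _ [n _ <-]; exact: uK.
have /cvgrPdist_le /(_ e e0)[J _ HJ] : S @ \oo --> limn S by exact: cv.
exists J => n m Jn; have [nm|/ltnW mn] := leqP n m; last by rewrite big_geq// ltW.
have h1 := nondecreasing_cvgn_le nd cv m.
have := HJ n Jn; rewrite /= ler_norml => /andP[_ h2].
have : S m = S n + \sum_(n <= j < m) u j by rewrite /S (big_cat_nat (leq0n n) nm).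
lra.
Qed.

Lemma cesaro_lower_bound (h : nat -> R) :
  (0 < limn_einf (fun N => (N%:R^-1 * \sum_(0 <= j < N) h j)%:E))%E ->
  exists c C0 : R, 0 < c /\ forall k, 3 * c * k%:R - C0 <= \sum_(j < k) h j.
Proof.
set u := fun N => _; move=> hu.
have [N0 hN0] : exists N0, (0 < einfs u N0)%E.
  apply: contrapT => /forallNP no; move: hu; rewrite limn_einf_lim ltNge => /negP; apply.
  apply: lime_le; first exact: is_cvg_einfs.
  by apply: nearW => n; rewrite leNgt; apply/negP; exact: no.
have inf_le k : (N0 <= k)%N -> (einfs u N0 <= u k)%E.
  by move=> Nk; apply: ereal_inf_lbound; exists k.
have [r r0 ru] : exists2 r : R, 0 < r & (r%:E <= einfs u N0)%E.
  have := inf_le N0 (leqnn _); move: hN0; case: (einfs u N0) => [r| |] //.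
  by rewrite lte_fin => r0 _; exists r.
pose S k := \sum_(j < k) h j.
have Sk k : (N0 <= k)%N -> (0 < k)%N -> r * k%:R <= S k.
  move=> Nk k0; have := le_trans ru (inf_le k Nk); rewrite lee_fin big_mkord -/(S k).
  by rewrite ler_pdivlMl ?ltr0n// mulrC.
(* The linear bound holds from some rank on; the constant is the sum of what each earlier index
   could require. *)
exists (r / 3), (\sum_(k < N0.+1) (`|S k| + r * k%:R)); split; first by rewrite divr_gt0.
move=> k; rewrite (_ : 3 * (r / 3) = r); last by field.
have t0 (j : nat) : 0 <= `|S j| + r * j%:R by rewrite addr_ge0// mulr_ge0// ltW.
have [kN|Nk] := ltnP k N0.+1.
  rewrite (bigD1 (Ordinal kN))//= -/(S k).
  have : 0 <= \sum_(i < N0.+1 | i != Ordinal kN) (`|S i| + r * i%:R) by apply: sumr_ge0.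
  have : - `|S k| <= S k by rewrite lerNl -normrN ler_norm.
  lra.
have := Sk k (ltnW Nk) (leq_ltn_trans (leq0n _) Nk); rewrite -/(S k).
have : 0 <= \sum_(i < N0.+1) (`|S i| + r * i%:R) by apply: sumr_ge0.
lra.
Qed.

End real_series.

Section expectation_facts.
Context d (Omega : measurableType d) (R : realType) (P : probability Omega R).
Implicit Types f g : Omega -> R.

Lemma expectation_Ex f : L1 P f -> ('E_P[f] = (Ex P f)%:E)%E.
Proof. by move=> If; rewrite unlock ExE. Qed.

Lemma expectation_L1 f : measurable_fun setT f -> (forall x, 0 <= f x) ->
  ('E_P[f] < +oo)%E -> L1 P f.
Proof.
move=> mf f0; rewrite unlock => Ef; apply/integrableP; split.
  exact/measurable_EFinP.
by under eq_integral do rewrite /= ger0_norm//.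
Qed.

Lemma L1_summand (I : finType) (F : I -> Omega -> R) i :
  (forall j, measurable_fun setT (F j)) -> (forall j x, 0 <= F j x) ->
  L1 P (fun x => \sum_j F j x) -> L1 P (F i).
Proof.
move=> mF F0 LF; apply: (L1_le (mF i) LF) => x.
by rewrite ger0_norm// (bigD1 i)//= lerDl sumr_ge0.
Qed.

Lemma Ex_le_ae f g : L1 P f -> L1 P g -> {ae P, forall x, f x <= g x} ->
  Ex P f <= Ex P g.
Proof.
move=> If Ig fg; pose f' x := Num.min (f x) (g x).
have mf' : measurable_fun setT f'.
  by apply: measurable_minr; [exact: L1_measurable If|exact: L1_measurable Ig].
have If' : L1 P f'.
  apply: (L1_le mf' (L1D (L1_norm If) (L1_norm Ig))) => x.
  rewrite /f'; case: (leP (f x) (g x)) => _; first by rewrite lerDl.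
  by rewrite lerDr.
have -> : Ex P f = Ex P f'.
  apply: EFin_inj; rewrite -!ExE//; apply: ae_eq_integral => //.
  - by apply/measurable_EFinP; exact: L1_measurable If.
  - exact/measurable_EFinP.
  - by apply: filterS fg => x h _; rewrite /f' min_l.
by apply: Ex_le => // x; rewrite /f' ge_min lexx orbT.
Qed.

End expectation_facts.

(** * From the hypotheses on the laws to the estimates for the cascade *)

Section cascade_environment.
Context d (Omega : measurableType d) (R : realType) (P : probability Omega R).
Context (I : pointedFinType).
Variables (C : {RV P >-> random_vec_space I bool})
  (X : nat -> {RV P >-> weighted I R}) (V : seq I -> {RV P >-> weighted I R}).
Hypothesis supC : supercritical C.
Hypothesis admX : forall n, (1 <= n)%N -> admissible_weights C (X n).
Hypothesis casV : cascade_of X V.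
Hypothesis entropyX : (0 < limn_einf (fun N : nat =>
         (N%:R^-1)%:E * \sum_(1 <= n < N.+1) Hent P (X n)))%E.
Hypothesis phi2X :
  (\sum_(1 <= n <oo) phi2 P (X n) * ((n%:R ^+ 2)^-1)%:E < +oo)%E.
Implicit Types (u v w : seq I) (i : I) (om : Omega).

Let mXw n i : measurable_fun setT (fun om => wgt (X n om) i).
Proof. exact: measurableT_comp (measurable_wgt i) (measurable_funP (X n)). Qed.

Let X0 n om i : 0 <= wgt (X n.+1 om) i.
Proof. by have [_ h _ _] := admX (ltn0Sn n); exact: h. Qed.

Let L1X n i : L1 P (fun om => wgt (X n.+1 om) i).
Proof.
have [_ _ h _] := admX (ltn0Sn n).
apply: (@L1_summand _ _ _ P I (fun i om => wgt (X n.+1 om) i)) => //.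
apply: expectation_L1; first exact: measurable_sum.
  by move=> om; exact: sumr_ge0.
by rewrite h ltry.
Qed.

Let meanX n : \sum_i Ex P (fun om => wgt (X n.+1 om) i) = 1.
Proof.
have [_ _ h _] := admX (ltn0Sn n); apply: EFin_inj.
by rewrite -h expectation_Ex ?Ex_sum//; exact: L1_sum.
Qed.

Let mxln : measurable_fun setT (fun x : R => x * ln x).
Proof. by apply: measurable_funM => //; exact: measurable_ln. Qed.

Let mxln2 : measurable_fun setT (fun x : R => x * ln x ^+ 2).
Proof. by apply: measurable_funM => //; apply: measurable_funX; exact: measurable_ln. Qed.

Let phi2_ge0 n : (0 <= phi2 P (X n.+1))%E.
Proof.
apply: expectation_ge0 => om; apply: sumr_ge0 => i _.
by rewrite mulr_ge0// sqr_ge0.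
Qed.

Let term_ge0 n : (0 <= phi2 P (X n.+1) * ((n.+1%:R ^+ 2)^-1)%:E)%E.
Proof. by rewrite mule_ge0// lee_fin invr_ge0 exprn_ge0. Qed.

Let partial_lt N :
  (\sum_(1 <= n < N) phi2 P (X n) * ((n%:R ^+ 2)^-1)%:E < +oo)%E.
Proof.
apply: le_lt_trans phi2X; apply: nneseries_lim_ge => -[|n] // _ _; exact: term_ge0.
Qed.

Let phi2_lty n : (phi2 P (X n.+1) < +oo)%E.
Proof.
have := partial_lt n.+2; rewrite big_nat_recr//= => h.
have p0 : (0 <= \sum_(1 <= i < n.+1) phi2 P (X i) * ((i%:R ^+ 2)^-1)%:E)%E.
  rewrite big_add1 /=; apply: sume_ge0 => i _; exact: term_ge0.
have {}h : (phi2 P (X n.+1) * ((n.+1%:R ^+ 2)^-1)%:E < +oo)%E.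
  by apply: le_lt_trans h; rewrite leeDr.
by rewrite ltey; apply/eqP => e; move: h; rewrite e gt0_mulye ?ltxx.
Qed.

Let L1X2 n i : L1 P (fun om => wgt (X n.+1 om) i * ln (wgt (X n.+1 om) i) ^+ 2).
Proof.
apply: (@L1_summand _ _ _ P I (fun i om => wgt (X n.+1 om) i * ln (wgt (X n.+1 om) i) ^+ 2)).
- by move=> j; exact: measurableT_comp mxln2 (mXw n.+1 j).
- by move=> j om; rewrite mulr_ge0// sqr_ge0.
apply: expectation_L1; last exact: phi2_lty.
  apply: measurable_sum => j; exact: measurableT_comp mxln2 (mXw n.+1 j).
by move=> om; apply: sumr_ge0 => j _; rewrite mulr_ge0// sqr_ge0.
Qed.

Let L1X1 n i : L1 P (fun om => wgt (X n.+1 om) i * ln (wgt (X n.+1 om) i)).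
Proof.
apply: (L1_le _ (L1D (L1X n i) (L1X2 n i))).
  exact: measurableT_comp mxln (mXw n.+1 i).
(* [x |z| <= x + x z ^+ 2] with [z = ln x]: finite mass and finite second moment control the
   entropy. *)
move=> om; rewrite normrM ger0_norm// -[X in _ <= X + _]mulr1 -mulrDr ler_wpM2l//.
rewrite -[X in _ <= _ + X]real_normK ?num_real//.
move: (`|ln _|) => z; nra.
Qed.

(** Index shift: the vertices of length [k] carry the law of [X k.+1]. *)
Definition level_entropy (k : nat) : R :=
  - \sum_i Ex P (fun om => wgt (X k.+1 om) i * ln (wgt (X k.+1 om) i)).

Definition level_phi2 (k : nat) : R :=
  \sum_i Ex P (fun om => wgt (X k.+1 om) i * ln (wgt (X k.+1 om) i) ^+ 2).

Let HentE k : (Hent P (X k.+1) = (level_entropy k)%:E)%E.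
Proof.
rewrite /Hent /level_entropy EFinN -sumEFin; congr (- _)%E.
by apply: eq_bigr => i _; exact: expectation_Ex.
Qed.

Let phi2E k : (phi2 P (X k.+1) = (level_phi2 k)%:E)%E.
Proof.
by rewrite /phi2 expectation_Ex ?Ex_sum//; exact: L1_sum.
Qed.

Lemma level_phi2_tail (e : R) : 0 < e -> exists J, forall n m, (J <= n)%N ->
  \sum_(n <= j < m) level_phi2 j / j.+1%:R ^+ 2 <= e.
Proof.
have u0 j : 0 <= level_phi2 j / j.+1%:R ^+ 2.
  by rewrite -lee_fin EFinM -phi2E; exact: term_ge0.
pose S := (\sum_(1 <= n <oo) phi2 P (X n) * ((n%:R ^+ 2)^-1)%:E)%E.
apply: (@bounded_series_tail _ _ (fine S)) => // N.
have S0 : (0 <= S)%E.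
  by apply: nneseries_ge0 => -[|n] // _ _; exact: term_ge0.
rewrite -lee_fin fineK; last by rewrite ge0_fin_numE.
have -> : ((\sum_(0 <= j < N) level_phi2 j / j.+1%:R ^+ 2)%:E =
   \sum_(1 <= n < N.+1) phi2 P (X n) * ((n%:R ^+ 2)^-1)%:E)%E.
  by rewrite big_add1 /= -sumEFin; apply: eq_bigr => j _; rewrite EFinM -phi2E.
apply: nneseries_lim_ge => -[|n] // _ _; exact: term_ge0.
Qed.

Lemma level_entropy_bound : exists c C0 : R, 0 < c /\
  forall k, 3 * c * k%:R - C0 <= \sum_(j < k) level_entropy j.
Proof.
apply: cesaro_lower_bound; move: entropyX.
rewrite (_ : (fun N => _) = (fun N : nat =>
  (N%:R^-1 * \sum_(0 <= j < N) level_entropy j)%:E)) //.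
apply/funext => N; rewrite EFinM; congr (_ * _)%E.
by rewrite big_add1 /= -sumEFin; apply: eq_bigr => j _; rewrite HentE.
Qed.

Let mV u : measurable_fun setT (V u : Omega -> weighted I R).
Proof. exact: measurable_funP. Qed.

Let lawV u : same_law P (V u) (X (size u).+1).
Proof. by have [_ h _] := casV; exact: h. Qed.

Let indV : mutually_independent P (fun v => V v : Omega -> weighted I R).
Proof. by have [] := casV. Qed.

Let V0 u om i : 0 <= wgt (V u om) i.
Proof. by have [_ _ h] := casV; exact: h. Qed.

Let mphi (phi : R -> R) i : measurable_fun setT phi ->
  measurable_fun setT (fun x : weighted I R => phi (wgt x i)).
Proof. by move=> mp; exact: measurableT_comp mp (measurable_wgt i). Qed.

Let L1V u i : L1 P (fun om => wgt (V u om) i).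
Proof. exact: (same_law_L1 (lawV u) (measurable_wgt i) (L1X (size u) i)). Qed.

Let L1V1 u i : L1 P (fun om => wgt (V u om) i * ln (wgt (V u om) i)).
Proof. exact: (same_law_L1 (lawV u) (mphi i mxln) (L1X1 (size u) i)). Qed.

Let L1V2 u i : L1 P (fun om => wgt (V u om) i * ln (wgt (V u om) i) ^+ 2).
Proof. exact: (same_law_L1 (lawV u) (mphi i mxln2) (L1X2 (size u) i)). Qed.

Let meanV u : \sum_i Ex P (fun om => wgt (V u om) i) = 1.
Proof.
rewrite -(meanX (size u)); apply: eq_bigr => i _.
exact: (same_law_Ex (lawV u) (measurable_wgt i) (L1X (size u) i)).
Qed.

Let meanV1 u : \sum_i Ex P (fun om => wgt (V u om) i * ln (wgt (V u om) i)) =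
  - level_entropy (size u).
Proof.
rewrite opprK; apply: eq_bigr => i _.
exact: (same_law_Ex (lawV u) (mphi i mxln) (L1X1 (size u) i)).
Qed.

Let meanV2 u : \sum_i Ex P (fun om => wgt (V u om) i * ln (wgt (V u om) i) ^+ 2) =
  level_phi2 (size u).
Proof.
apply: eq_bigr => i _.
exact: (same_law_Ex (lawV u) (mphi i mxln2) (L1X2 (size u) i)).
Qed.

Definition offspring_law (J : {set I}) : R :=
  Ex P \1_[set om | [set i | C om i]%SET = J].

Let m : R := offspring_mean offspring_law.

Let mCi i : measurable_fun setT (fun x : random_vec_space I bool => x i).
Proof.
move=> _ B mB; rewrite setTI; apply: sub_sigma_algebra.
by exists i, B.
Qed.

Let mCX i : measurable_fun setT (fun om => C om i).
Proof. exact: measurableT_comp (mCi i) (measurable_funP C). Qed.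

Let m_ev (b : Omega -> bool) : measurable_fun setT b -> measurable [set om | b om].
Proof. exact: measurable_true_set. Qed.

Let indicb (b : Omega -> bool) om : \1_[set om | b om] om = (b om)%:R :> R.
Proof.
by rewrite indicE; case: (boolP (b om)) => h; [rewrite mem_set|rewrite memNset//; exact/negP].
Qed.

Let L1C i : L1 P (fun om => (C om i)%:R).
Proof. by apply: (eq_L1 (indicb _)); apply: L1_indic; exact: m_ev. Qed.

Let mean_offspring : m = \sum_i Ex P (fun om => (C om i)%:R).
Proof.
rewrite -(Ex_sum _ (fun i _ => L1C i)) /m /offspring_mean.
have LJ J : L1 P (\1_[set om | [set i | C om i]%SET = J] : Omega -> R).
  by apply: L1_indic; exact: (measurable_pattern J mCX).
rewrite (@eq_Ex _ _ _ P _ (fun om => \sum_(J : {set I}) #|J|%:R *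
   \1_[set om | [set i | C om i]%SET = J] om)); last first.
  move=> om; rewrite (bigD1 [set i | C om i]%SET)//= [X in _ = _ + X]big1 ?addr0 => [|J nJ].
    by rewrite indicE mem_set// mulr1 -sum1_card natr_sum [RHS]big_mkcond /=;
      apply: eq_bigr => i _; rewrite inE; case: (C om i).
  by rewrite indicE memNset ?mulr0//= => e; rewrite e eqxx in nJ.
rewrite Ex_sum => [|J _]; last exact: L1Z.
by apply: eq_bigr => J _; rewrite ExZ// mulrC.
Qed.

Lemma offspring_mean_gt1 : 1 < m.
Proof.
have [h _] := supC; rewrite -lte_fin mean_offspring.
by rewrite -(Ex_sum _ (fun i _ => L1C i)) -expectation_Ex//; exact: L1_sum.
Qed.

Let lawX n : same_law P (fun om => cpt (X n.+1 om) : random_vec_space I bool) C.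
Proof. by have [] := admX (ltn0Sn n). Qed.

Lemma offspring_lawV v J :
  Ex P \1_[set om | offspring (fun u => V u : Omega -> weighted I R) v om = J] =
  offspring_law J.
Proof.
have mw : measurable [set x : weighted I R | [set i | cpt x i]%SET = J].
  by apply: measurable_pattern => i; exact: measurable_cpt.
have mb : measurable [set x : random_vec_space I bool | [set i | x i]%SET = J].
  by apply: (measurable_pattern (b := fun i (x : random_vec_space I bool) => x i)) => i; exact: mCi.
rewrite /offspring_law !Ex_indic; last first.
- apply: (measurable_pattern (b := fun i om => cpt (V v om) i)) => i.
  exact: measurableT_comp (measurable_cpt i) (mV v).
- exact: (measurable_pattern J mCX).
congr fine; transitivity (pushforward P (X (size v).+1)
    [set x : weighted I R | [set i | cpt x i]%SET = J]); first exact: lawV.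
exact: (lawX (size v) mb).
Qed.

Let mcX n i : measurable_fun setT (fun om => cpt (X n om) i).
Proof. exact: measurableT_comp (measurable_cpt i) (measurable_funP (X n)). Qed.

Let L1cX n i : L1 P (fun om => (cpt (X n om) i)%:R).
Proof. by apply: (eq_L1 (indicb _)); apply: L1_indic; exact: m_ev. Qed.

Let meancX n : \sum_i Ex P (fun om => (cpt (X n.+1 om) i)%:R) = m.
Proof.
rewrite mean_offspring; apply: eq_bigr => i _.
rewrite -(eq_Ex P (indicb (fun om => cpt (X n.+1 om) i))).
rewrite -(eq_Ex P (indicb (fun om => C om i))).
rewrite !Ex_indic; [|exact: m_ev..].
congr fine; apply: (lawX n (A := [set x : random_vec_space I bool | x i])).
exact: (measurable_true_set (mCi i)).
Qed.

(* the tangent of [x ln x] at [m^-1]; summed over the offspring it gives [H <= ln m] *)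
Let ln_tangent (x : R) : 0 < x -> - (x * ln x) <= m^-1 - x + x * ln m.
Proof.
move=> x0; have m0 : 0 < m by rewrite (lt_trans ltr01)// offspring_mean_gt1.
have y0 : 0 < x * m by rewrite mulr_gt0.
have := expR_ge1Dx (- ln (x * m)); rewrite expRN lnK// lnM// => h.
have := ler_wpM2l (ltW x0) h; rewrite invfM mulrA mulfV ?gt_eqF// mul1r; lra.
Qed.

(** This bound lets [lm] be [ln m] in the subtree estimates and so brings the rate below the mean
    offspring number. Weights are positive only on retained letters, so the terms [m^-1] need only
    be counted there, with total mean 1. *)
Lemma level_entropy_le k : level_entropy k <= ln m.
Proof.
have m0 : 0 < m by rewrite (lt_trans ltr01)// offspring_mean_gt1.
have [_ _ _ pos] := admX (ltn0Sn k).
pose W i om := wgt (X k.+1 om) i.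
have Lr i : L1 P (fun om => (m^-1 * (cpt (X k.+1 om) i)%:R + (ln m - 1) * W i om)).
  by apply: L1D; apply: L1Z; [exact: L1cX|exact: L1X].
have -> : level_entropy k = Ex P (fun om => \sum_i (-1) * (W i om * ln (W i om))).
  rewrite Ex_sum => [|i _]; last by apply: L1Z; exact: L1X1.
  rewrite /level_entropy -sumrN; apply: eq_bigr => i _.
  by rewrite ExZ ?mulN1r//; exact: L1X1.
have -> : ln m = Ex P (fun om =>
    \sum_i (m^-1 * (cpt (X k.+1 om) i)%:R + (ln m - 1) * W i om)).
  rewrite Ex_sum//; under eq_bigr => i _.
    rewrite ExD; [|by apply: L1Z; exact: L1cX|by apply: L1Z; exact: L1X].
    rewrite !ExZ; [|exact: L1cX|exact: L1X].
    over.
  rewrite big_split /= -!mulr_sumr meancX (meanX k) mulVf ?gt_eqF//; ring.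
apply: Ex_le_ae.
- by apply: L1_sum => i _; apply: L1Z; exact: L1X1.
- exact: L1_sum.
apply: filterS pos => om h; apply: ler_sum => i _; rewrite mulN1r.
have [W0|Wn] := eqVneq (W i om) 0.
  by rewrite W0 mul0r mulr0 addr0 oppr0 mulr_ge0// invr_ge0 ltW.
have Wp : 0 < W i om by rewrite lt0r Wn X0.
by rewrite (h i Wp) mulr1; have := ln_tangent Wp; lra.
Qed.

Let Vf := (fun u => V u : Omega -> weighted I R).
Let YV v n om := Ysum (fun u => V u om) n v.

Lemma cascade_L1_cauchy v (e : R) : 0 < e -> exists N, forall n m,
  (N <= n)%N -> (N <= m)%N -> Ex P (fun om => `|YV v n om - YV v m om|) <= e.
Proof.
have [c [C0 [c0 lb]]] := level_entropy_bound.
exact: (Ysum_L1_cauchy mV indV V0 L1V L1V1 L1V2 meanV meanV1 meanV2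
  level_phi2_tail c0 lb level_entropy_le).
Qed.

Lemma cascade_mass_event : exists (l0 : nat) (M Th : R),
  [/\ 0 <= M, 0 <= Th, Th < m & forall v n (E : set Omega), (l0 <= size v)%N ->
  measurable E -> Ex P (fun om => YV v n om * \1_E om) <=
  1 / 2 + fine (P E) * (1 + M * Th ^+ size v)].
Proof.
have [c [C0 [c0 lb]]] := level_entropy_bound.
have [l0 [M M0 H]] := Ysum_mass_event mV indV V0 L1V L1V1 L1V2 meanV meanV1 meanV2
  level_phi2_tail c0 lb level_entropy_le.
have m0 : 0 < m by rewrite (lt_trans ltr01)// offspring_mean_gt1.
(* This is [m e^-c], strictly below [m] because the entropy slope is positive. *)
exists l0, M, (expR (ln m - c)); split => //.
by rewrite -[X in _ < X]lnK// ltr_expR; lra.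
Qed.

Lemma ae_cvg_cascade : {ae P, forall om, forall v,
  Ysum (fun u => V u om) ^~ v @ \oo --> Ylimit Vf v om}.
Proof.
apply: ae_countable => v.
exact: (ae_cvg_Ylimit mV indV L1V meanV cascade_L1_cauchy v).
Qed.

Lemma weight_pos_cpt : {ae P, forall om, forall v i,
  0 < wgt (V v om) i -> cpt (V v om) i}.
Proof.
apply: ae_countable => v.
have mB : measurable [set x : weighted I R | forall i, 0 < wgt x i -> cpt x i].
  have -> : [set x : weighted I R | forall i, 0 < wgt x i -> cpt x i] =
    \bigcap_(i in [set` enum I]) (~` [set x : weighted I R | 0 < wgt x i] `|`
       [set x : weighted I R | cpt x i]).
    apply/seteqP; split => x /= h.
      move=> i _; have [ci|/negP ci] := boolP (0 < wgt x i); last by left.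
      by right; exact: h.
    by move=> i ci; have := h i; rewrite /= mem_enum => /(_ isT)[|].
  apply: fin_bigcap_measurable => // i _; apply: measurableU.
    apply: measurableC; apply: measurable_true_set.
    by apply: measurable_fun_ltr; [exact: measurable_cst|exact: measurable_wgt].
  exact: (measurable_true_set (measurable_cpt i)).
have [_ _ _ pos] := admX (ltn0Sn (size v)).
exact: (same_law_ae (lawV v) mB pos).
Qed.

Lemma cascade_mass : (\int[P]_om (Ylimit Vf [::] om)%:E = 1)%E /\
  measurable_fun setT (Ylimit Vf [::]).
Proof.
have L := L1_Ylimit mV indV L1V meanV cascade_L1_cauchy [::].
split; last exact: L1_measurable L.
by rewrite ExE// (Ex_Ylimit mV indV L1V meanV cascade_L1_cauchy).
Qed.

Section positivity.
Hypothesis full : forall v i, P [set om | 0 < wgt (V v om) i] = P [set om | cpt (V v om) i].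

(** Up to a null set, positivity of the weight is contained in retention of the letter; with equal
    probabilities the two events differ by a null set. *)
Lemma cpt_weight_pos : {ae P, forall om, forall v i,
  cpt (V v om) i -> 0 < wgt (V v om) i}.
Proof.
apply: ae_countable => v; apply: ae_countable => i.
pose A := [set om | 0 < wgt (V v om) i]; pose B := [set om | cpt (V v om) i].
have mA : measurable A.
  apply: m_ev; apply: measurable_fun_ltr; first exact: measurable_cst.
  exact: measurableT_comp (measurable_wgt i) (mV v).
have mB : measurable B.
  by apply: m_ev; exact: measurableT_comp (measurable_cpt i) (mV v).
exists (B `\` A); split.
- exact: measurableD.
- transitivity (P B - P (B `&` A))%E.
    apply: measureD => //.
    by rewrite (le_lt_trans (probability_le1 _ mB))// ltry.
  have -> : P (B `&` A) = P A.
    apply/eqP; rewrite eq_le; apply/andP; split.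
      by apply: le_measure; rewrite ?inE//; exact: measurableI.
    have [N [mN N0 sN]] := weight_pos_cpt.
    rewrite -(measureU0 (measurableI _ _ mB mA) mN N0) le_measure ?inE//.
      by apply: measurableU => //; exact: measurableI.
    move=> om Aom; have [Bom|nB] := pselect (B om); first by left.
    by right; apply: sN => /= h; apply: nB; exact: h.
  by rewrite -[P B]full subee// fin_num_measure.
- by move=> om /= /not_implyP[? ?].
Qed.

Lemma dying_is_extinct : {ae P, forall om, forall v,
  dying Vf v om -> extinction Vf v om}.
Proof.
apply: ae_countable => v.
have [l0 [M [Th [M0 Th0 Thm H]]]] := cascade_mass_event.
have lb u (lu : (l0 <= size u)%N) :
    1 / 2 <= (1 - fine (P (dying Vf u))) * (1 + M * Th ^+ size u).
  exact: (dying_prob mV indV V0 L1V meanV cascade_L1_cauchy H lu).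
exact: (dying_extinction mV indV offspring_lawV V0 weight_pos_cpt cpt_weight_pos M0 Th0 lb
  offspring_mean_gt1 Thm).
Qed.

End positivity.

End cascade_environment.

Theorem theorem1p5 (R : realType) (d : nat) (I : pointedFinType)
    (a : I -> 'rV[R]_d) (t : I -> 'cV[R]_d)
    (disp : measure_display) (Omega : measurableType disp)
    (P : probability Omega R)
    (C : {RV P >-> random_vec_space I bool})
    (X : nat -> {RV P >-> weighted I R})
    (V : seq I -> {RV P >-> weighted I R})
    (nu : Omega -> {measure set (codes I) -> \bar R}) :
  (2 <= d)%N -> sponge_ifs a t -> good_sponge a t ->
  supercritical C ->
  (forall n, (1 <= n)%N -> admissible_weights C (X n)) ->
  cascade_of X V ->
  mandelbrot_measure V nu ->
  (0 < limn_einf (fun N : nat =>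
         (N%:R^-1)%:E * \sum_(1 <= n < N.+1) Hent P (X n)))%E ->
  (\sum_(1 <= n <oo) phi2 P (X n) * ((n%:R ^+ 2)^-1)%:E < +oo)%E ->
  (\int[P]_om nu om setT = 1)%E /\
  ((forall v i, P [set om | 0 < wgt (V v om) i] = P [set om | cpt (V v om) i]) ->
   {ae P, forall om,
      random_limit_set a t (fun v => V v om) !=set0 ->
      measure_support (projected_measure a t (nu om)) =
      random_limit_set a t (fun v => V v om)}).
Proof.
move=> _ [_ a1 cube _] _ supC admX casV nuV entropyX phi2X.
have V0 u om i : 0 <= wgt (V u om) i by have [_ _ h] := casV; exact: h.
have cvY := ae_cvg_cascade supC admX casV entropyX phi2X.
split.
  have [mass1 mY] := cascade_mass supC admX casV entropyX phi2X.
  set Y := Ylimit _ _ in mass1 mY.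
  (* The total mass of [nu om] is known only almost surely and is not given as a measurable function
     of [om]. [Num.max 0 (Y om)] is a measurable substitute that is nonnegative everywhere. *)
  have ae_nu : {ae P, forall om, nu om setT = (Num.max 0 (Y om))%:E /\ 0 <= Y om}.
    apply: filterS2 nuV cvY => om h /(_ [::]) cv.
    have Y0 : 0 <= Y om.
      by apply: (cvgr_to_ge cv); apply: nearW => n; exact: Ysum_ge0.
    split=> //; have := h [::]; rewrite (_ : cylinder [::] = setT).
      by rewrite mul1r /Ylim (cvg_lim _ cv)// max_r.
    by apply/seteqP; split.
  rewrite (integral_ae_measurable (g := fun om => (Num.max 0 (Y om))%:E)) //.
  - rewrite -mass1; apply: ae_eq_integral => //.
    + by apply/measurable_EFinP; exact: measurable_maxr.
    + exact/measurable_EFinP.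
    + by apply: filterS ae_nu => om [_ Y0] _; rewrite max_r.
  - by move=> om; rewrite lee_fin le_max lexx.
  - by apply/measurable_EFinP; exact: measurable_maxr.
  - by apply: filterS ae_nu => om [].
move=> full.
have D := dying_is_extinct supC admX casV entropyX phi2X full.
have pc := weight_pos_cpt admX casV.
have cp := cpt_weight_pos admX casV full.
apply: filterS3 (filterI pc cp) (filterI nuV cvY) D => om [pos1 pos2] [nuE cv] dy _.
apply: support_limit_set => //.
- by move=> u i; split; [exact: pos1|exact: pos2].
move=> s n ss; have cvs := cv (mkseq s n).
rewrite lt0r; apply/andP; split; last first.
  rewrite /Ylim (cvg_lim _ cvs)//; apply: (cvgr_to_ge cvs).
  by apply: nearW => k; exact: Ysum_ge0.
(* A zero limit mass at a prefix of a surviving code would make that vertex die, hence its subtree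
   extinct, which the code itself refutes. *)
apply/eqP => Y0; have cv0 : Ysum (fun u => V u om) ^~ (mkseq s n) @ \oo --> (0 : R).
  by rewrite -Y0 /Ylim (cvg_lim _ cvs).
have [|k _] := dy (mkseq s n).
  by apply/dyingP => // u om' i; exact: V0.
exact: extinct_not_surviving.
Qed.
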